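(* Let $d\ge 2$, $0\le a<b$, and let $(\mathbb P^u)_{u\in(a,b)}$ be a family of probability measures on $(\{0,1\}^{\mathbb Z^d},\mathcal F)$ satisfying conditions P1, P2, P3, S1 and S2 (listed in the context). Then for every $u\in(a,b)$ there exists a convex compact set $D_u\subset\mathbb R^d$ such that for each $\varepsilon\in(0,1)$ there exists a $\mathbb P^u[\,\cdot\mid 0\in\mathcal S_\infty]$-almost surely finite random variable $\tilde R_{\varepsilon,u}$ satisfying $$\forall R\ge\tilde R_{\varepsilon,u}:\qquad \mathcal S_\infty\cap(1-\varepsilon)R\cdot D_u\ \subseteq\ \mathrm B_{\mathcal S}(0,R)\ \subseteq\ \mathcal S_\infty\cap(1+\varepsilon)R\cdot D_u .$$
   Context: Notation. $\mathcal F$ is the product sigma-algebra on $\{0,1\}^{\mathbb Z^d}$, generated by the coordinate maps $\Psi_x(\xi)=\xi_x$, $x\in\mathbb Z^d$. For $\xi\in\{0,1\}^{\mathbb Z^d}$, $\mathcal S=\mathcal S(\xi)=\{x\in\mathbb Z^d:\xi_x=1\}$, viewed as a subgraph of $\mathbb Z^d$ with edges between vertices of $\mathcal S$ at $\ell^1$-distance $1$. For $r\in[0,\infty]$, $\mathcal S_r$ is the set of vertices of $\mathcal S$ in connected components of $\mathcal S$ of $\ell^1$-diameter $\ge r$; in particular $\mathcal S_\infty$ is the set of vertices in infinite connected components. $\mathrm B(x,r)=\{y\in\mathbb Z^d:|x-y|_\infty\le\lfloor r\rfloor\}$ and $\mathrm B(r)=\mathrm B(0,r)$. For $x,y\in\mathcal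 S$, $\rho_{\mathcal S}(x,y)\in\mathbb Z_+\cup\{\infty\}$ is the graph distance in $\mathcal S$ (equal to $\infty$ if $x,y$ are in different components), and $\mathrm B_{\mathcal S}(x,r)=\{y\in\mathcal S:\rho_{\mathcal S}(x,y)\le r\}$. An event $G\in\mathcal F$ is increasing (resp. decreasing) if $\xi\in G$ and $\xi_y\le\xi'_y$ (resp. $\xi_y\ge\xi_y'$) for all $y$ imply $\xi'\in G$. Conditions on a family $(\mathbb P^u)_{u\in(a,b)}$: P1. For each $u\in(a,b)$, $\mathbb P^u$ is invariant and ergodic with respect to the lattice shifts (invariant under all shifts of $\mathbb Z^d$, and ergodic under each nonzero shift). P2. For $u<u'$ in $(a,b)$ and any increasing $G\in\mathcal F$, $\mathbb P^u[G]\le\mathbb P^{u'}[G]$. P3. There exist $R_P,L_P<\infty$, $\varepsilon_P,\chi_P>0$ and a real-valued function $f_P$ with $f_P(L)\ge e^{(\log L)^{\varepsilon_P}}$ for all $L\ge L_P$, such that the following holds for every integer $L\ge1$, all $x_1,x_2\in\mathbb Z^d$, all decreasing events $A_i$ and increasing events $B_i$ in $\sigma(\Psi_y:y\in \mathrm B(x_i,10L))$, $i=1,2$, every integer $R\ge R_P$ and all $a<\widehat u<u<b$ with $u\ge(1+R^{-\chi_P})\widehat u$: if $|x_1-x_2|_\infty\ge R L$, then $\mathbb P^u[A_1\cap A_2]\le\mathbb P^{\widehat u}[A_1]\,\mathbb P^{\widehat u}[A_2]+e^{-f_P(L)}$ and $\mathbb P^{\widehat u}[B_1\cap B_2]\le\mathbb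 P^{u}[B_1]\,\mathbb P^{u}[B_2]+e^{-f_P(L)}$. S1. There is a function $f_S:(a,b)\times\mathbb Z_+\to\mathbb R$ such that for each $u\in(a,b)$ there are $\Delta_S=\Delta_S(u)>0$ and $R_S=R_S(u)<\infty$ with $f_S(u,R)\ge(\log R)^{1+\Delta_S}$ for all $R\ge R_S$, and for all $u\in(a,b)$ and integers $R\ge1$: $\mathbb P^u[\mathcal S_R\cap\mathrm B(R)\ne\emptyset]\ge1-e^{-f_S(u,R)}$ and $\mathbb P^u[\text{all }x,y\in\mathcal S_{R/10}\cap\mathrm B(R)\text{ are connected to each other in }\mathcal S\cap\mathrm B(2R)]\ge1-e^{-f_S(u,R)}$. S2. The function $\eta(u)=\mathbb P^u[0\in\mathcal S_\infty]$ is positive and continuous on $(a,b)$. *)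

(* Defs.v *)
From HB Require Import structures.
From mathcomp Require Import all_boot all_order all_algebra.
From mathcomp Require Import all_classical all_reals all_analysis.
From mathcomp Require Import zify.

Set Implicit Arguments.
Unset Strict Implicit.
Unset Printing Implicit Defensive.

Import Order.TTheory GRing.Theory Num.Theory.
Import numFieldNormedType.Exports.

Local Open Scope classical_set_scope.
Local Open Scope ring_scope.

Notation site d := ('rV[int]_d).
Notation config d := (site d -> bool).

Definition norm1 (d : nat) (x : site d) : nat := (\sum_(i < d) `|x ord0 i|)%N.
Definition normoo (d : nat) (x : site d) : nat := (\max_(i < d) `|x ord0 i|)%N.

(* Only integer radii occur, so the integer part of the radius is omitted. *)
Definition box (d : nat) (x : site d) (n : nat) : set (site d) :=
  [set y | (normoo (x - y) <= n)%N].

Definition coord_preimages (d : nat) (B : set (site d)) :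
    set (set (config d)) :=
  \bigcup_(y in B)
    preimage_set_system setT (fun xi : config d => xi y) measurable.

Definition coord_sigma (d : nat) (B : set (site d)) : set (set (config d)) :=
  <<s coord_preimages B >>.

Definition Omega (d : nat) := g_sigma_algebraType (@coord_preimages d setT).

Definition increasing_event (d : nat) (G : set (config d)) : Prop :=
  forall xi xi' : config d,
    G xi -> (forall y, (xi y <= xi' y)%N) -> G xi'.

Definition decreasing_event (d : nat) (G : set (config d)) : Prop :=
  forall xi xi' : config d,
    G xi -> (forall y, (xi' y <= xi y)%N) -> G xi'.

Definition shift_config (d : nat) (z : site d) (xi : config d) : config d :=
  fun y => xi (y + z).

Definition occupied (d : nat) (xi : config d) : set (site d) := [set x | xi x].

Definition nn_adjacent (d : nat) : rel (site d) :=
  fun x y => norm1 (x - y) == 1%N.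

(* The path visits the vertices x :: p, so its length is size p. *)
Definition path_in (d : nat) (A : set (site d)) (x y : site d)
    (p : seq (site d)) : Prop :=
  [/\ path (@nn_adjacent d) x p, last x p = y & forall z, z \in x :: p -> A z].

Definition connected_in (d : nat) (A : set (site d)) (x y : site d) : Prop :=
  exists p, path_in A x y p.

Definition occ_cluster (d : nat) (xi : config d) (x : site d) : set (site d) :=
  [set y | connected_in (occupied xi) x y].

Definition diam1 (R : realType) (d : nat) (A : set (site d)) : \bar R :=
  ereal_sup [set ((norm1 (y - z))%:R)%:E | y in A & z in A].

Definition S_ (R : realType) (d : nat) (r : \bar R) (xi : config d) :
    set (site d) :=
  [set x | occupied xi x /\ (r <= diam1 R (occ_cluster xi x))%E].

(* This is S_ at r = +oo, see S_pinfty below. *)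
Definition S_oo (d : nat) (xi : config d) : set (site d) :=
  [set x | occupied xi x /\ infinite_set (occ_cluster xi x)].

Definition graph_dist (R : realType) (d : nat) (xi : config d)
    (x y : site d) : \bar R :=
  ereal_inf [set ((size p)%:R)%:E | p in path_in (occupied xi) x y].

Definition graph_ball (R : realType) (d : nat) (xi : config d) (x : site d)
    (r : R) : set (site d) :=
  [set y | occupied xi y /\ (graph_dist R xi x y <= r%:E)%E].

Definition lattice_dilate (R : realType) (d : nat) (c : R)
    (D : set 'rV[R]_d) : set (site d) :=
  [set x | [set c *: v | v in D] (map_mx intr x)].

Definition ergodic (disp : measure_display) (T : measurableType disp)
    (R : realType) (P : probability T R) (t : T -> T) : Prop :=
  forall A : set T, measurable A -> t @^-1` A = A -> P A = 0%E \/ P A = 1%E.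

Definition cond_prob (disp : measure_display) (T : measurableType disp)
    (R : realType) (P : probability T R) (A B : set T) : R :=
  fine (P (A `&` B)) / fine (P B).

(* In the conditions below the family P is indexed by all reals, but only its
   members with index in ]a, b[ are constrained. *)

Definition condP1 (R : realType) (d : nat) (a b : R)
    (P : R -> probability (Omega d) R) : Prop :=
  forall u : R, a < u < b ->
    (forall (z : site d) (A : set (Omega d)), measurable A ->
       P u (@shift_config d z @^-1` A) = P u A) /\
    (forall z : site d, z != 0 -> ergodic (P u) (@shift_config d z)).

Definition condP2 (R : realType) (d : nat) (a b : R)
    (P : R -> probability (Omega d) R) : Prop :=
  forall u u' : R, a < u -> u < u' -> u' < b ->
  forall G : set (Omega d), measurable G -> increasing_event G ->
    (P u G <= P u' G)%E.

Definition condP3 (R : realType) (d : nat) (a b : R)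
    (P : R -> probability (Omega d) R) : Prop :=
  exists (RP LP eP chiP : R) (fP : nat -> R),
  [/\ 0 < eP, 0 < chiP,
      forall L : nat, (1 <= L)%N -> LP <= L%:R ->
        expR (ln L%:R `^ eP) <= fP L
    & forall (L : nat) (x1 x2 : site d) (A1 A2 B1 B2 : set (Omega d)),
      (1 <= L)%N ->
      coord_sigma (box x1 (10 * L)) A1 -> decreasing_event A1 ->
      coord_sigma (box x2 (10 * L)) A2 -> decreasing_event A2 ->
      coord_sigma (box x1 (10 * L)) B1 -> increasing_event B1 ->
      coord_sigma (box x2 (10 * L)) B2 -> increasing_event B2 ->
      forall (n : nat) (uhat u : R),
      (1 <= n)%N -> RP <= n%:R ->
      a < uhat -> uhat < u -> u < b ->
      (1 + n%:R `^ (- chiP)) * uhat <= u ->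
      (n * L <= normoo (x1 - x2))%N ->
      (P u (A1 `&` A2) <= P uhat A1 * P uhat A2 + (expR (- fP L))%:E)%E /\
      (P uhat (B1 `&` B2) <= P u B1 * P u B2 + (expR (- fP L))%:E)%E].

Definition condS1 (R : realType) (d : nat) (a b : R)
    (P : R -> probability (Omega d) R) : Prop :=
  exists fS : R -> nat -> R,
  (forall u : R, a < u < b ->
     exists DeltaS RS : R, 0 < DeltaS /\
       forall n : nat, (1 <= n)%N -> RS <= n%:R ->
         ln n%:R `^ (1 + DeltaS) <= fS u n) /\
  (forall (u : R) (n : nat), a < u < b -> (1 <= n)%N ->
     ((1 - expR (- fS u n))%:E <=
        P u [set xi | S_ (n%:R : R)%:E xi `&` box 0 n !=set0])%E /\
     ((1 - expR (- fS u n))%:E <=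
        P u [set xi | forall x y : site d,
               (S_ (n%:R / 10 : R)%:E xi `&` box 0 n) x ->
               (S_ (n%:R / 10 : R)%:E xi `&` box 0 n) y ->
               connected_in (occupied xi `&` box 0 (2 * n)) x y])%E).

Definition density_oo (R : realType) (d : nat)
    (P : R -> probability (Omega d) R) (u : R) : R :=
  fine (P u [set xi | S_oo xi 0]).

Definition condS2 (R : realType) (d : nat) (a b : R)
    (P : R -> probability (Omega d) R) : Prop :=
  (forall u : R, a < u < b -> 0 < density_oo P u) /\
  {in `]a, b[, continuous (density_oo P)}.

Lemma S_pinfty (R : realType) (d : nat) (xi : config d) :
  S_ (+oo%E : \bar R) xi = S_oo xi.
Proof.
apply/seteqP; split=> x [xS hx]; split=> //.
- move=> finC.
  have [M HM] : exists M : nat, forall y z, occ_cluster xi x y ->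
      occ_cluster xi x z -> (norm1 (y - z) <= M)%N.
    have /finite_seqP [s Hs] :
        finite_set [set norm1 (yz.1 - yz.2)
                   | yz in occ_cluster xi x `*` occ_cluster xi x].
      exact/finite_image/finite_setX.
    exists (\max_(k <- s) k)%N => y z yC zC.
    have ks : norm1 (y - z) \in s.
      by suff : [set` s] (norm1 (y - z)) by []; rewrite -Hs; exists (y, z).
    exact: (@leq_bigmax_seq _ _ predT id).
  move: hx; rewrite leNgt => /negP; apply.
  apply: (@le_lt_trans _ _ (M%:R%:E)); last exact: ltry.
  apply: ge_ereal_sup => _ [y yC] [z zC] <-.
  by rewrite lee_fin ler_nat; exact: HM.
- rewrite leye_eq; apply/negPn/negP => nE; apply: hx.
  have xC : occ_cluster xi x x.
    by exists [::]; split=> // z; rewrite inE => /eqP ->.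
  have [M HM] : exists M : nat, forall y, occ_cluster xi x y ->
      (norm1 (y - x) < M)%N.
    have s0 y : occ_cluster xi x y ->
        ((norm1 (y - x))%:R%:E <= diam1 R (occ_cluster xi x))%E.
      by move=> yC; apply: ereal_sup_ubound; exists y => //; exists x.
    case E : (diam1 R (occ_cluster xi x)) nE s0 => [r| |] // _ s0.
      exists (Num.bound r) => y /s0; rewrite lee_fin => yr.
      rewrite -(ltr_nat R); apply: (le_lt_trans yr).
      exact: archi_boundP (le_trans (ler0n R _) yr).
    by have := s0 _ xC; rewrite leeNy_eq.
  pose g (w : 'rV['I_(M + M)]_d) : site d :=
    \row_i (x ord0 i + (w ord0 i)%:Z - M%:Z).
  apply: (@sub_finite_set _ _ (g @` setT)); last exact: finite_image.
  move=> y /HM yM.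
  have yi i : (absz ((y - x)%R ord0 i) < M)%N.
    apply: leq_ltn_trans yM; rewrite /norm1.
    by rewrite (bigD1 i) //= leq_addr.
  have wi i : (absz ((y - x)%R ord0 i + M%:Z)%R < M + M)%N.
    by move: (yi i); lia.
  exists (\row_i Ordinal (wi i)) => //.
  apply/rowP => i; move: (yi i); rewrite !mxE /= !mxE.
  move: (x ord0 i) (y ord0 i : int) => q p; lia.
Qed.

(* Main.v *)
(* Let N(x) be the scale from which on all S1-events around x hold; by S1 and
   stationarity it has all moments.  The
   distance tau(x,y) in the infinite cluster between its points nearest to x and y
   is a stationary pseudometric on Z^d, and tau(x,y) <= t(x) = C N(x)^d for
   neighbours x, y, since within a good box a path can be shortened to visit each
   site at most once.  Thus tau is dominated by a first passage metric with weights
   in every L^p.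

   A maximal inequality bounds the sums of t^(2d) over all boxes B(R) by K R^d with
   a random K, and averaging over many discrete segments (Morrey's inequality with
   p = 2d > d) gives tau(x,y) <= C (K + 1) sqrt(R |x - y|) on B(R).  So tau is
   uniformly o(R) on B(R) at distances o(R), and it suffices to control finitely
   many directions, where Birkhoff's upper bound and Kingman's lower bound, both by
   the greedy argument of Katznelson and Weiss, identify tau(0,x) with its mean up
   to o(R).  The mean is subadditive, and its asymptotic unit ball is D. *)

Require Import Defs.
From HB Require Import structures.
From mathcomp Require Import all_boot all_order all_algebra.
From mathcomp Require Import all_classical all_reals all_analysis measurable_realfun.
From mathcomp Require Import zify ring lra.

Set Implicit Arguments.
Unset Strict Implicit.
Unset Printing Implicit Defensive.

Import Order.TTheory GRing.Theory Num.Theory.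
Import numFieldNormedType.Exports.

Local Open Scope classical_set_scope.
Local Open Scope ring_scope.

(** * Lattice boxes *)

(** The exponent [1 + Delta] in S1 is what gives all moments: [(ln R)^(1 + Delta)] eventually
    exceeds [q ln R] for every [q], so bad scales are rarer than any power of [1 / R]. The weights
    are dependent, so continuity in the direction has to come from their moments alone. As in
    Sobolev embedding this takes an exponent [p > d]; with [p = 2 d] the Hoelder exponent
    [1 - d / p] is one half, hence the square root. The power sums must be controlled on all boxes
    at once, which a bound in mean does not give; this is the task of the maximal inequality. The
    upper bound in a given direction is reached only along multiples of a large block length [k].
    Finitely many directions can share one [k], and the Morrey estimate also bridges the gaps
    between the multiples. In the opposite direction, a path is at least as long as the distance of
    its ends. This keeps [D] bounded and confines graph balls to boxes on which the convergence is
    uniform. All random quantities are natural numbers or sites, so measurability reduces to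
    countable combinations of events. *)

Section lattice.
Variable d : nat.
Implicit Types (x y z : site d) (n m : nat).

Lemma normoo_leP x n :
  reflect (forall i, (`|x ord0 i| <= n)%N) (normoo x <= n)%N.
Proof.
apply: (iffP idP) => [/bigmax_leqP h i|h]; first exact: h.
by apply/bigmax_leqP => i _.
Qed.

Lemma normoo_ge x i : (`|x ord0 i| <= normoo x)%N.
Proof. exact: (normoo_leP x _ (leqnn _)). Qed.

Lemma normooD x y : (normoo (x + y) <= normoo x + normoo y)%N.
Proof.
apply/normoo_leP => i; rewrite mxE.
have := normoo_ge x i; have := normoo_ge y i.
by move: (x _ i) (y _ i) => a b; lia.
Qed.

Lemma normooN x : normoo (- x) = normoo x.
Proof. by rewrite /normoo; apply: eq_bigr => i _; rewrite mxE abszN. Qed.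

Lemma normooB x y : normoo (x - y) = normoo (y - x).
Proof. by rewrite -normooN opprB. Qed.

Lemma normoo0 : normoo (0 : site d) = 0%N.
Proof. by apply/eqP; rewrite -leqn0; apply/normoo_leP => i; rewrite mxE. Qed.

Lemma normoo_eq0 x : (normoo x == 0%N) = (x == 0).
Proof.
apply/idP/eqP => [/eqP h|->]; last by rewrite normoo0.
apply/rowP => i; rewrite mxE; apply/eqP; rewrite -absz_eq0 -leqn0.
by apply: leq_trans (normoo_ge x i) _; rewrite h.
Qed.

Lemma normoo_norm1 x : (normoo x <= norm1 x)%N.
Proof. by apply/normoo_leP => i; rewrite /norm1 (bigD1 i)//= leq_addr. Qed.

Lemma norm1D x y : (norm1 (x + y) <= norm1 x + norm1 y)%N.
Proof.
rewrite /norm1 -big_split /=; apply: leq_sum => i _; rewrite mxE.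
by move: (x _ i) (y _ i) => a b; lia.
Qed.

Lemma norm1N x : norm1 (- x) = norm1 x.
Proof. by rewrite /norm1; apply: eq_bigr => i _; rewrite mxE abszN. Qed.

Lemma norm1_normoo x : (norm1 x <= d * normoo x)%N.
Proof.
rewrite /norm1; apply: (@leq_trans (\sum_(i < d) normoo x)).
  by apply: leq_sum => i _; exact: normoo_ge.
by rewrite sum_nat_const card_ord.
Qed.

Lemma normooMn x n : normoo (x *+ n) = (n * normoo x)%N.
Proof.
have h i : `|(x *+ n) ord0 i|%N = (n * `|x ord0 i|)%N.
  by rewrite -scaler_nat mxE -[n%:R]/(n%:~R) intz abszM.
apply/eqP; rewrite eqn_leq; apply/andP; split.
  by apply/normoo_leP => i; rewrite h leq_mul2l normoo_ge orbT.
case: n h => [|n] h; first by rewrite mul0n.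
rewrite mulnC -leq_divRL//; apply/normoo_leP => i.
by rewrite leq_divRL// mulnC -h normoo_ge.
Qed.

(** A list rather than a set, so that box sums are big operators and translating a box is a
    [map]. *)
Definition boxseq x n : seq (site d) :=
  [seq x + \row_i ((w i : nat)%:Z - n%:Z) | w : {ffun 'I_d -> 'I_(2 * n).+1}].

Lemma boxseq_uniq x n : uniq (boxseq x n).
Proof.
rewrite map_inj_uniq ?enum_uniq// => v w /addrI/rowP h.
apply/ffunP => i; apply/val_inj; have := h i; rewrite !mxE /=.
by move: (nat_of_ord (v i)) (nat_of_ord (w i)) => a b; lia.
Qed.

Lemma size_boxseq x n : size (boxseq x n) = ((2 * n).+1 ^ d)%N.
Proof. by rewrite size_map -cardE card_ffun !card_ord. Qed.

Lemma mem_boxseq x n y : (y \in boxseq x n) = (normoo (x - y) <= n)%N.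
Proof.
apply/mapP/normoo_leP => [[w _ ->] i|h].
  rewrite opprD addNKr !mxE; have := ltn_ord (w i).
  by move: (nat_of_ord (w i)) => k; lia.
have h' i : (absz (y ord0 i - x ord0 i + n%:Z)%R < (2 * n).+1)%N.
  by have := h i; rewrite !mxE; move: (x ord0 i) (y ord0 i) => a b; lia.
exists [ffun i => Ordinal (h' i)]; first by rewrite mem_enum.
apply/rowP => i; rewrite !mxE ffunE /=; have := h i; rewrite !mxE.
by move: (x ord0 i) (y ord0 i) => a b; lia.
Qed.

Lemma leq_sum_uniq (I : eqType) (s s' : seq I) (F : I -> nat) :
  uniq s -> {subset s <= s'} -> (\sum_(i <- s) F i <= \sum_(i <- s') F i)%N.
Proof.
elim: s s' => [|x s IH] s' /=; first by rewrite big_nil.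
case/andP=> xs us ss'; have xs' : x \in s' by apply: ss'; rewrite mem_head.
rewrite big_cons (perm_big _ (perm_to_rem xs')) big_cons /= leq_add2l.
apply: IH => // y ys; have := ss' y; rewrite inE ys orbT => /(_ isT) ys'.
have yx : y != x by apply: contraNneq xs => <-.
by move: ys'; rewrite (perm_mem (perm_to_rem xs')) inE (negbTE yx).
Qed.

(* Pick a center of maximal radius, discard all centers in its doubled box and
   recurse: the selected boxes are disjoint and their doubles cover E. *)
Lemma vitali_count (F : site d -> nat) (l : nat) (r : site d -> nat)
    (E V : seq (site d)) : uniq E -> uniq V ->
  (forall z, z \in E -> {subset boxseq z (r z) <= V}) ->
  (forall z, z \in E ->
    (l * (2 * r z).+1 ^ d <= \sum_(y <- boxseq z (r z)) F y)%N) ->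
  (l * size E <= 2 ^ d * \sum_(y <- V) F y)%N.
Proof.
move En : (size E) => n; elim/ltn_ind: n => n IH in E V En *.
move=> uE uV sV hE.
case: (posnP n) => [->|n0]; first by rewrite muln0.
have /hasP[z0 z0E _] : has predT E by rewrite has_predT En.
pose z := [arg max_(i > (SeqSub z0E : seq_sub E)) r (val i)]%N.
have [zE zmax] : val z \in E /\ forall y, y \in E -> (r y <= r (val z))%N.
  rewrite /z; case: arg_maxnP => //= i _ hi; split; first exact: valP.
  by move=> y yE; exact: (hi (SeqSub yE) isT).
move: (val z) zE zmax => {z z0 z0E} z zE zmax.
pose far y := (2 * r z < normoo (z - y))%N.
pose E' := [seq y <- E | far y].
pose V' := [seq y <- V | y \notin boxseq z (r z)].
have szE : (size E <= size E' + (4 * r z).+1 ^ d)%N.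
  rewrite -(count_predC far E) size_filter leq_add2l -size_filter.
  have -> : ((4 * r z).+1 ^ d)%N = size (boxseq z (2 * r z)).
    by rewrite size_boxseq mulnA.
  apply: uniq_leq_size; first exact: filter_uniq.
  by move=> y; rewrite mem_filter /= mem_boxseq -leqNgt => /andP[].
have ltE : (size E' < n)%N.
  rewrite -En size_filter -(count_predC far E) -[ltnLHS]addn0 ltn_add2l.
  by rewrite -has_count; apply/hasP; exists z => //=; rewrite /far subrr normoo0.
have IHE : (l * size E' <= 2 ^ d * \sum_(y <- V') F y)%N.
  apply: (IH _ ltE) => //; rewrite ?filter_uniq//; last first.
    by move=> y; rewrite mem_filter => /andP[_ yE]; exact: hE.
  move=> y; rewrite mem_filter => /andP[fy yE] u uy.
  rewrite mem_filter (sV _ yE _ uy) andbT; apply: contraL fy.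
  move: uy; rewrite !mem_boxseq /far -leqNgt normooB => h1 h2.
  have -> : z - y = (z - u) + (u - y) by rewrite addrA subrK.
  apply: leq_trans (normooD _ _) _; rewrite mul2n -addnn; apply: leq_add => //.
  exact: leq_trans h1 (zmax _ yE).
have hV : (\sum_(y <- V') F y + \sum_(y <- boxseq z (r z)) F y
    <= \sum_(y <- V) F y)%N.
  rewrite -big_cat; apply: leq_sum_uniq.
    rewrite cat_uniq filter_uniq// boxseq_uniq andbT /=.
    by apply/hasPn => y yb; rewrite mem_filter yb.
  move=> y; rewrite mem_cat mem_filter => /orP[/andP[]//|]; exact: sV.
have h4 : ((4 * r z).+1 ^ d <= 2 ^ d * (2 * r z).+1 ^ d)%N.
  rewrite -expnMn; case: (posnP d) => [->//|d0]; rewrite leq_exp2r//; lia.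
rewrite -En; apply: leq_trans (leq_mul (leqnn l) szE) _.
rewrite mulnDr; apply: leq_trans (leq_mul (leqnn _) hV).
rewrite mulnDr; apply: leq_add; first exact: IHE.
apply: leq_trans (leq_mul (leqnn l) h4) _.
by rewrite mulnCA leq_mul2l hE ?orbT.
Qed.

End lattice.

(** * A discrete Morrey inequality *)

Section discrete_line.
Variable d : nat.
Implicit Types (x y m : site d) (n k : nat).

(** The position at time [k] on the straight segment from [x] to [m], run in time [n] and rounded
    down coordinatewise. All segments take the same time, so [m |-> line_pt x m n k] is a rounded
    contraction by [k / n] and its fibres can be counted. *)
Definition line_pt x m n k : site d :=
  x + \row_i (k%:Z * (m - x) ord0 i %/ n%:Z)%Z.

Lemma line_pt0 x m n : line_pt x m n 0 = x.
Proof.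
by apply/rowP => i; rewrite !mxE mul0r div0z addr0.
Qed.

Lemma line_ptn x m n : (0 < n)%N -> line_pt x m n n = m.
Proof.
move=> n0; apply/rowP => i; rewrite !mxE mulrC mulzK; last by rewrite gt_eqF.
by rewrite addrC subrK.
Qed.

Lemma divz_bounds (q : int) n : (0 < n)%N ->
  (q %/ n%:Z)%Z * n%:Z <= q < ((q %/ n%:Z)%Z + 1) * n%:Z.
Proof.
move=> n0; have n0' : n%:Z != 0 by rewrite gt_eqF.
have h0 := modz_ge0 q n0'; have h1 : (q %% n%:Z)%Z < n%:Z by rewrite ltz_pmod.
have e := divz_eq q n%:Z.
by rewrite [X in _ <= X]e [X in X < _]e mulrDl mul1r lerDl ltrD2l h0 h1.
Qed.

Lemma line_pt_step x m n k : (0 < n)%N -> (normoo (m - x) <= n)%N ->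
  (normoo (line_pt x m n k.+1 - line_pt x m n k) <= 1)%N.
Proof.
move=> n0 h; apply/normoo_leP => i.
have := normoo_leP _ _ h i; rewrite !mxE.
set a := m ord0 i + - x ord0 i; move: a => a ha.
have := divz_bounds (k%:Z * a) n0; have := divz_bounds (k.+1%:Z * a) n0.
move: (x ord0 i) ((_ %/ _)%Z) ((_ %/ _)%Z) => b u v.
have -> : k.+1%:Z * a = k%:Z * a + a by rewrite -addn1 PoszD; ring.
by move: (k%:Z * a) => q /andP[h1 h2] /andP[h3 h4]; nia.
Qed.

Lemma line_pt_near x m n k : (0 < n)%N -> (normoo (m - x) <= n)%N ->
  (normoo (x - line_pt x m n k) <= k)%N.
Proof.
move=> n0 h; apply/normoo_leP => i.
have := normoo_leP _ _ h i; rewrite !mxE.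
set a := m ord0 i + - x ord0 i; move: a => a ha.
have := divz_bounds (k%:Z * a) n0.
move: (x ord0 i) ((_ %/ _)%Z) => b u /andP[h1 h2].
have ha1 : k%:Z * a <= k%:Z * n%:Z by apply: ler_wpM2l => //; lia.
have ha2 : k%:Z * - n%:Z <= k%:Z * a by apply: ler_wpM2l => //; lia.
by nia.
Qed.

(** Equal quotients by [n] force [k] times the difference of the endpoints to be at most [n] in each
    coordinate. This bounds the number of segments that visit a given site at time [k]. *)
Lemma line_pt_fiber x m m' n k : (0 < n)%N -> (0 < k)%N ->
  line_pt x m n k = line_pt x m' n k -> (normoo (m - m') <= n %/ k)%N.
Proof.
move=> n0 k0 /addrI/rowP h; apply/normoo_leP => i; have := h i.
rewrite leq_divRL// !mxE.
move: (m ord0 i) (m' ord0 i) (x ord0 i) => a a' b.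
have := divz_bounds (k%:Z * (a - b)) n0.
have := divz_bounds (k%:Z * (a' - b)) n0.
move=> ha' ha e; rewrite e in ha; move: ha ha' {e}.
move: ((_ %/ _)%Z) => u /andP[h1 h2] /andP[h3 h4].
have h5 : k%:Z * (a - a') <= n%:Z by lia.
have h6 : - n%:Z <= k%:Z * (a - a') by lia.
have -> : (`|(a - a')%R| * k = `|(k%:Z * (a - a'))%R|)%N by rewrite abszM mulnC.
by move: (k%:Z * _) h5 h6 => q; lia.
Qed.

End discrete_line.

Lemma sum_fiber_le (I J : eqType) (s : seq I) (s' : seq J) (g : I -> J)
    (F : J -> nat) (c : nat) : uniq s' ->
  (forall i, i \in s -> g i \in s') ->
  (forall j, (count (fun i => g i == j) s <= c)%N) ->
  (\sum_(i <- s) F (g i) <= c * \sum_(j <- s') F j)%N.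
Proof.
move=> us' gs' hc.
have -> : (\sum_(i <- s) F (g i) =
    \sum_(i <- s) \sum_(j <- s') (g i == j) * F j)%N.
  rewrite !big_seq; apply: eq_bigr => i /gs' gi.
  rewrite (bigD1_seq (g i))//= eqxx mul1n big1 ?addn0// => j jg.
  by rewrite eq_sym (negbTE jg).
rewrite exchange_big big_distrr /=; apply: leq_sum => j _.
rewrite -big_distrl /= leq_mul2r; apply/orP; right.
apply: leq_trans (hc j); rewrite -sum1_count [leqRHS]big_mkcond /=.
by apply: leq_sum => i _; case: eqP.
Qed.

Section morrey.
Variables (R : realType) (d : nat).
Variables (tau : site d -> site d -> nat) (t : site d -> nat).
Hypothesis tau_sym : forall x y, tau x y = tau y x.
Hypothesis tau_refl : forall x, tau x x = 0%N.
Hypothesis tau_tri : forall x y z, (tau x z <= tau x y + tau y z)%N.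
Hypothesis tau_loc : forall x y, (normoo (x - y) <= 1)%N -> (tau x y <= t x)%N.

(** By symmetry each step is charged to its later endpoint, so only the times [1] to [n] occur. At
    time 0 all segments sit at [x], and [line_pt_fiber] does not apply. *)
Lemma tau_line x m n : (0 < n)%N -> (normoo (m - x) <= n)%N ->
  (tau x m <= \sum_(k < n) t (line_pt x m n k.+1))%N.
Proof.
move=> n0 h.
suff H k : (tau x (line_pt x m n k) <= \sum_(j < k) t (line_pt x m n j.+1))%N.
  by rewrite -[in leqLHS](line_ptn x m n0).
elim: k => [|k IH]; first by rewrite line_pt0 tau_refl.
rewrite big_ord_recr /=; apply: leq_trans (tau_tri _ (line_pt x m n k) _) _.
by apply: leq_add => //; rewrite tau_sym tau_loc// line_pt_step.
Qed.

(** After exchanging the sums, the points at time [k + 1] lie in the box of radius [k + 1] around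
    [x], and each of them serves at most as many endpoints [m] as a box of radius [n / (k + 1)] has
    sites. *)
Lemma sum_tau_box x n : (0 < n)%N ->
  (\sum_(m <- boxseq x n) tau x m <= \sum_(k < n)
    (2 * (n %/ k.+1)).+1 ^ d * \sum_(z <- boxseq x k.+1) t z)%N.
Proof.
move=> n0; apply: (@leq_trans
    (\sum_(m <- boxseq x n) \sum_(k < n) t (line_pt x m n k.+1))).
  rewrite !big_seq; apply: leq_sum => m; rewrite mem_boxseq normooB.
  exact: tau_line.
rewrite exchange_big; apply: leq_sum => k _ /=.
apply: (sum_fiber_le t (g := fun m => line_pt x m n k.+1)).
- exact: boxseq_uniq.
- by move=> m; rewrite !mem_boxseq normooB => h; exact: line_pt_near.
move=> z; rewrite -size_filter.
have uf := filter_uniq (fun m => line_pt x m n k.+1 == z) (boxseq_uniq x n).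
(* A nonempty fibre is contained in a box centred at any one of its members. *)
case E : [seq _ <- _ | _] uf => [//|m0 s] uf; rewrite -E in uf *.
rewrite -(size_boxseq m0); apply: uniq_leq_size => // m mf.
have m0f : m0 \in [seq m <- boxseq x n | line_pt x m n k.+1 == z].
  by rewrite E mem_head.
move: mf m0f; rewrite !mem_filter !mem_boxseq => /andP[/eqP e _] /andP[/eqP e0 _].
by apply: (@line_pt_fiber _ x) => //; rewrite e e0.
Qed.

(* Replaces Hoelder's inequality with exponent [2 * d]. *)
Lemma young_nat (a : nat) (l : R) : 0 < l -> (0 < d)%N ->
  a%:R <= l * (1 + a%:R ^+ (2 * d) / l ^+ (2 * d)).
Proof.
move=> l0 d0; have [al|la] := leP a%:R l.
  apply: (le_trans al); rewrite ler_peMr ?(ltW l0)// lerDl.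
  by rewrite divr_ge0// exprn_ge0// ltW.
rewrite -expr_div_n -ler_pdivrMl// mulrC.
set b := _ / _; have b1 : 1 <= b by rewrite ler_pdivlMr// mul1r ltW.
apply: (@le_trans _ _ (b ^+ (2 * d))); last by rewrite lerDr.
by rewrite -[leLHS]expr1; apply: ler_weXn2l => //; lia.
Qed.

(** Telescoping, since [1 / b <= 2 (b - a)] whenever [b^2 = a^2 + 1]. *)
Lemma sum_inv_sqrt n : \sum_(k < n) (Num.sqrt (k.+1%:R : R))^-1 <= 2 * Num.sqrt n%:R.
Proof.
elim: n => [|n IH]; first by rewrite big_ord0 sqrtr0 mulr0.
rewrite big_ord_recr /=; apply: (le_trans (lerD IH (lexx _))).
set a := Num.sqrt n%:R; set b := Num.sqrt _.
have a0 : 0 <= a by exact: sqrtr_ge0.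
have b0 : 0 < b by rewrite sqrtr_gt0.
have hb : b ^+ 2 = a ^+ 2 + 1 by rewrite !sqr_sqrtr// -natr1.
rewrite -lerBrDl -mulrBr -[leLHS]mul1r ler_pdivrMr//.
nra.
Qed.

(* Averaging over the discrete segments from x to all m in the box of radius n,
   a site at distance k is used by a fraction at most [(3 / k) ^ d] of them; the
   choice [l = sqrt (r / k)] in [young_nat] makes the sum over k converge. *)
Lemma morrey_sum x n (r K : nat) : (0 < d)%N -> (0 < n)%N -> (n <= r)%N ->
  (normoo x <= r)%N ->
  (\sum_(z <- boxseq 0 (2 * r)) t z ^ (2 * d) <= K * (2 * (2 * r)).+1 ^ d)%N ->
  (\sum_(m <- boxseq x n) tau x m)%:R <=
    n%:R ^+ d * (15 ^+ d * (K%:R + 1) * (2 * Num.sqrt r%:R * Num.sqrt n%:R)) :> R.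
Proof.
move=> d0 n0 nr xr hK.
have r0 : (0 < r)%N := leq_trans n0 nr.
apply: (@le_trans _ _ (\sum_(k < n) (n%:R ^+ d * (15 ^+ d * (K%:R + 1)
    * (Num.sqrt r%:R * (Num.sqrt k.+1%:R)^-1))))); last first.
  rewrite -!mulr_sumr !ler_pM2l ?exprn_gt0 ?ltr0n ?ltr_wpDl ?mulr_gt0//.
  rewrite [leRHS](_ : _ = Num.sqrt r%:R * (2 * Num.sqrt n%:R)); last by ring.
  by apply: ler_wpM2l; [exact: sqrtr_ge0|exact: sum_inv_sqrt].
apply: le_trans (_ : _ <= (\sum_(k < n)
    (2 * (n %/ k.+1)).+1 ^ d * \sum_(z <- boxseq x k.+1) t z)%N%:R) _.
  by rewrite ler_nat sum_tau_box.
rewrite natr_sum; apply: ler_sum => k _; move: (ltn_ord k) => kn.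
set k1 := k.+1.
pose l : R := Num.sqrt r%:R * (Num.sqrt k1%:R)^-1.
have l0 : 0 < l by rewrite mulr_gt0 ?invr_gt0 ?sqrtr_gt0 ?ltr0n.
have l2 : l ^+ (2 * d) = (r%:R / k1%:R) ^+ d.
  by rewrite exprM; congr (_ ^+ d); rewrite /l exprMn exprVn !sqr_sqrtr.
have k10 : 0 < k1%:R :> R by rewrite ltr0n.
have sumt : (\sum_(z <- boxseq x k1) t z)%:R <=
    l * ((K%:R + 1) * (5 * k1%:R) ^+ d).
  apply: (@le_trans _ _ (\sum_(z <- boxseq x k1)
      l * (1 + (t z)%:R ^+ (2 * d) / l ^+ (2 * d)))).
    by rewrite natr_sum; apply: ler_sum => z _; exact: young_nat.
  rewrite -mulr_sumr ler_pM2l// big_split /= mulrDl mul1r addrC; apply: lerD.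
    rewrite -mulr_suml l2.
    apply: (@le_trans _ _ ((K * (2 * (2 * r)).+1 ^ d)%N%:R / (r%:R / k1%:R) ^+ d)).
      rewrite ler_wpM2r ?invr_ge0 ?exprn_ge0 ?divr_ge0//.
      under eq_bigr do rewrite -natrX.
      rewrite -natr_sum ler_nat; apply: leq_trans hK.
      apply: leq_sum_uniq; first exact: boxseq_uniq.
      move=> z; rewrite !mem_boxseq sub0r normooN => h.
      have -> : z = x - (x - z) by rewrite opprB addrC subrK.
      by have := normooD x (- (x - z)); rewrite normooN; lia.
    rewrite natrM -mulrA ler_wpM2l// natrX -expr_div_n.
    apply: lerXn2r; rewrite ?nnegrE ?divr_ge0 ?mulr_ge0//.
    rewrite invf_div mulrCA mulrC ler_pM2r// ler_pdivrMr ?ltr0n// -natrM ler_nat.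
    lia.
  rewrite big_const_seq count_predT iter_addr addr0 size_boxseq.
  rewrite natrX lerXn2r ?nnegrE ?mulr_ge0// -natrM ler_nat; lia.
rewrite natrM natrX.
(* The constant 15 is 3 times 5: the 3 comes from [2 (n / k) + 1 <= 3 n / k], the 5 from
   [4 r + 1 <= 5 r]. *)
apply: (@le_trans _ _ ((3 * (n%:R / k1%:R)) ^+ d * (l * ((K%:R + 1) * (5 * k1%:R) ^+ d)))).
  apply: ler_pM => //; rewrite ?exprn_ge0//.
  apply: lerXn2r; rewrite ?nnegrE ?mulr_ge0 ?invr_ge0//.
  rewrite mulrA ler_pdivlMr// -!natrM ler_nat.
  have := leq_trunc_div n k1; have : (k1 <= n)%N by []. nia.
rewrite le_eqVlt; apply/orP; left; apply/eqP.
have -> : (15 : R) = 3 * 5 by rewrite -natrM.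
rewrite -/l !exprMn exprVn; field.
by rewrite expf_neq0// gt_eqF.
Qed.

(** Averages [tau x y <= tau x m + tau m y] over [m] in the box of radius [n] around [x], which lies
    in the box of radius [2 n] around [y]. The doubled radius costs [2^d], turning [15^d] into
    [30^d], and the two terms add up to at most [6] times that. *)
Lemma morrey x y n (r K : nat) : (0 < d)%N -> (0 < n)%N -> (2 * n <= r)%N ->
  (normoo x <= r)%N -> (normoo y <= r)%N -> (normoo (x - y) <= n)%N ->
  (\sum_(z <- boxseq 0 (2 * r)) t z ^ (2 * d) <= K * (2 * (2 * r)).+1 ^ d)%N ->
  (tau x y)%:R <=
    6 * 30 ^+ d * (K%:R + 1) * (Num.sqrt r%:R * Num.sqrt n%:R) :> R.
Proof.
move=> d0 n0 nr xr yr xy hK.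
have nr1 : (n <= r)%N by lia.
have n20 : (0 < 2 * n)%N by lia.
have h1 := morrey_sum d0 n0 nr1 xr hK.
have h2 := morrey_sum d0 n20 nr yr hK.
have sub : (\sum_(m <- boxseq x n) tau y m <= \sum_(m <- boxseq y (2 * n)) tau y m)%N.
  apply: leq_sum_uniq; first exact: boxseq_uniq.
  move=> m; rewrite !mem_boxseq => h.
  have -> : y - m = - (x - y) + (x - m) by rewrite opprB addrA subrK.
  apply: leq_trans (normooD _ _) _; rewrite normooN mul2n -addnn; exact: leq_add.
have hsum : (n ^ d * tau x y <= \sum_(m <- boxseq x n) tau x m
    + \sum_(m <- boxseq x n) tau y m)%N.
  rewrite -big_split /=.
  apply: (@leq_trans (\sum_(m <- boxseq x n) tau x y)).
    rewrite big_const_seq count_predT iter_addn_0 size_boxseq mulnC leq_mul2l.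
    by rewrite leq_exp2r//; apply/orP; right; lia.
  by apply: leq_sum => m _; rewrite (tau_sym y); exact: tau_tri.
have nd0 : 0 < n%:R ^+ d :> R by rewrite exprn_gt0// ltr0n.
rewrite -(ler_pM2l nd0) -natrX -natrM.
apply: (@le_trans _ _ (\sum_(m <- boxseq x n) tau x m
    + \sum_(m <- boxseq y (2 * n)) tau y m)%N%:R).
  by rewrite ler_nat; apply: leq_trans hsum _; rewrite leq_add2l.
rewrite natrD; apply: (le_trans (lerD h1 h2)).
have s2 : Num.sqrt (2 * n%:R) <= 2 * Num.sqrt n%:R :> R.
  rewrite sqrtrM// ler_wpM2r ?sqrtr_ge0//.
  by rewrite -[leRHS]ger0_norm// -sqrtr_sqr ler_sqrt// -natrX ler_nat.
rewrite natrM exprMn natrX.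
set N := n%:R ^+ d; set sn := Num.sqrt n%:R in s2 *; set sr := Num.sqrt r%:R.
set s2n := Num.sqrt (2 * _) in s2 *.
have -> : (30 : R) = 2 * 15 by rewrite -natrM.
rewrite exprMn.
set A := (15 ^+ d); set B := 2 ^+ d; set K1 := K%:R + 1.
have A0 : 0 <= A by rewrite exprn_ge0.
have B1 : 1 <= B by rewrite exprn_ege1// ler1n.
have K0 : 0 <= K1 by rewrite addr_ge0.
have N0 : 0 <= N := ltW nd0.
have sn0 : 0 <= sn by exact: sqrtr_ge0.
have sr0 : 0 <= sr by exact: sqrtr_ge0.
have -> : N * (A * K1 * (2 * sr * sn)) + B * N * (A * K1 * (2 * sr * s2n)) =
  (N * A * K1 * sr) * (2 * sn + 2 * B * s2n) by ring.
have -> : N * (6 * (B * A) * K1 * (sr * sn)) =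
  (N * A * K1 * sr) * (6 * B * sn) by ring.
apply: ler_wpM2l; first by rewrite !mulr_ge0.
nra.
Qed.

End morrey.

(** * Countably valued random variables *)

Section discrete_measurability.
Context {disp : measure_display} {T : measurableType disp}.
Implicit Types (Q : T -> Prop).

Lemma meas_const (b : Prop) : measurable [set w : T | b].
Proof.
have [h|h] := pselect b.
  by rewrite (_ : [set _ | _] = setT); [exact: measurableT|apply/seteqP; split].
by rewrite (_ : [set _ | _] = set0); [exact: measurable0|apply/seteqP; split].
Qed.

Lemma meas_not Q : measurable [set w | Q w] -> measurable [set w | ~ Q w].
Proof. exact: measurableC. Qed.

Lemma meas_and Q Q' : measurable [set w | Q w] -> measurable [set w | Q' w] ->
  measurable [set w | Q w /\ Q' w].
Proof. exact: measurableI. Qed.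

Lemma meas_or Q Q' : measurable [set w | Q w] -> measurable [set w | Q' w] ->
  measurable [set w | Q w \/ Q' w].
Proof. exact: measurableU. Qed.

Lemma meas_ext Q Q' : (forall w, Q w <-> Q' w) ->
  measurable [set w | Q w] -> measurable [set w | Q' w].
Proof.
by move=> h; rewrite (_ : [set w | Q w] = [set w | Q' w])//;
  apply/seteqP; split=> w /= /h.
Qed.

Lemma meas_imp Q Q' : measurable [set w | Q w] -> measurable [set w | Q' w] ->
  measurable [set w | Q w -> Q' w].
Proof.
move=> h h'; apply: (@meas_ext (fun w => ~ Q w \/ Q' w)).
  by move=> w; rewrite implyE.
by apply: meas_or => //; exact: meas_not.
Qed.

(** Sites, finite paths and integers are countable types, so with countable quantifiers the
    measurability of cluster events follows the shape of their definitions. *)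
Lemma meas_ex (I : countType) (Q : I -> T -> Prop) :
  (forall i, measurable [set w | Q i w]) -> measurable [set w | exists i, Q i w].
Proof.
move=> h; rewrite (_ : [set w | _] =
  \bigcup_n (if unpickle n is Some i then [set w | Q i w] else set0)).
  by apply: bigcup_measurable => n _; case: (unpickle n).
apply/seteqP; split=> w /=; first by case=> i qi; exists (pickle i) => //; rewrite pickleK.
by case=> n _; case: (unpickle n) => // i qi; exists i.
Qed.

Lemma meas_all (I : countType) (Q : I -> T -> Prop) :
  (forall i, measurable [set w | Q i w]) -> measurable [set w | forall i, Q i w].
Proof.
move=> h; apply: (@meas_ext (fun w => ~ exists i, ~ Q i w)).
  by move=> w; split=> [/forallNP h' i|h' [i]//]; apply: contrapT; exact: h'.
by apply: meas_not; apply: meas_ex => i; exact: meas_not.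
Qed.

(** Only fibres are required to be events, so [I] needs no sigma-algebra; for countable [I] every
    predicate of [f] is then an event. *)
Definition discrete_meas (I : Type) (f : T -> I) :=
  forall i, measurable [set w | f w = i].

Lemma meas_discrete (I : countType) (f : T -> I) (p : I -> Prop) :
  discrete_meas f -> measurable [set w | p (f w)].
Proof.
move=> mf; apply: (@meas_ext (fun w => exists i, f w = i /\ p i)).
  by move=> w; split=> [[i [-> //]]|h]; exists (f w).
by apply: meas_ex => i; apply: meas_and; [exact: mf|exact: meas_const].
Qed.

Lemma discrete_meas_comp (I : countType) J (f : T -> I) (g : I -> J) :
  discrete_meas f -> discrete_meas (fun w => g (f w)).
Proof. by move=> mf j; exact: (meas_discrete (fun i => g i = j) mf). Qed.

Lemma discrete_meas_pair (I J : countType) (f : T -> I) (g : T -> J) :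
  discrete_meas f -> discrete_meas g -> discrete_meas (fun w => (f w, g w)).
Proof.
move=> mf mg [i j]; apply: (@meas_ext (fun w => f w = i /\ g w = j)).
  by move=> w; split=> [[-> ->]//|[-> ->]].
exact: meas_and.
Qed.

Lemma discrete_meas_comp2 (I J : countType) K (f : T -> I) (g : T -> J)
    (k : I -> J -> K) : discrete_meas f -> discrete_meas g ->
  discrete_meas (fun w => k (f w) (g w)).
Proof.
move=> mf mg.
exact: (discrete_meas_comp (fun ij => k ij.1 ij.2) (discrete_meas_pair mf mg)).
Qed.

Lemma discrete_meas_cst I (i : I) : discrete_meas (fun _ : T => i).
Proof. by move=> j; exact: meas_const. Qed.

Lemma discrete_meas_asbool Q : measurable [set w | Q w] ->
  discrete_meas (fun w => `[< Q w >]).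
Proof.
move=> mQ b; case: b.
  by apply: meas_ext mQ => w; split=> [h|/asboolP//]; apply/asboolP.
by apply: meas_ext (meas_not mQ) => w; split=> [h|/asboolP//]; apply/asboolP.
Qed.

Lemma discrete_meas_sum (I : Type) (s : seq I) (f : I -> T -> nat) :
  (forall i, discrete_meas (f i)) ->
  discrete_meas (fun w => \sum_(i <- s) f i w)%N.
Proof.
move=> mf; elim: s => [|i s IH].
  by under eq_fun do rewrite big_nil; exact: discrete_meas_cst.
under eq_fun do rewrite big_cons.
exact: (discrete_meas_comp2 addn).
Qed.

Lemma measurable_fun_discrete (I : countType) disp' (U : measurableType disp')
    (f : T -> I) (g : I -> U) :
  discrete_meas f -> measurable_fun setT (fun w => g (f w)).
Proof.
move=> mf _ Y _; rewrite setTI.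
exact: (meas_discrete (fun i => Y (g i)) mf).
Qed.

(** Choice is harmless when at most one value is admissible: the default is taken exactly where none
    exists. It serves for the minimisers [scale], [nearest] and [chem]. *)
Lemma discrete_meas_xget (I : countType) (i0 : I) (Q : T -> set I) :
  (forall i, measurable [set w | Q w i]) ->
  (forall w i j, Q w i -> Q w j -> i = j) ->
  discrete_meas (fun w => xget i0 (Q w)).
Proof.
move=> mQ uQ i; apply: (@meas_ext (fun w => Q w i \/ ((~ exists j, Q w j) /\ i0 = i))).
  move=> w; split=> [[Qi|[nQ <-]]|<-].
  - exact: (uQ w _ _ (xgetPex i0 (ex_intro _ i Qi)) Qi).
  - by apply: xgetPN => j Qj; apply: nQ; exists j.
  - have [[j Qj]|nQ] := pselect (exists j, Q w j).
      by left; exact: (xgetPex i0 (ex_intro _ j Qj)).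
    by right; split=> //; apply/esym/xgetPN => j Qj; apply: nQ; exists j.
apply: meas_or => //; apply: meas_and; last exact: meas_const.
by apply: meas_not; apply: meas_ex.
Qed.

End discrete_measurability.

(** * Expectations of integer-valued variables *)

Section nat_expectation.
Context {disp : measure_display} {T : measurableType disp} {R : realType}.
Variable P : probability T R.
Implicit Types (f g : T -> nat).

Definition Ex f : \bar R := (\int[P]_w ((f w)%:R)%:E)%E.

Lemma Ex_meas f (c : R) : discrete_meas f ->
  measurable_fun setT (fun w => (c * (f w)%:R)%:E).
Proof. by move=> mf; exact: (measurable_fun_discrete (fun n => (c * n%:R)%:E)). Qed.

Lemma Ex_meas1 f : discrete_meas f -> measurable_fun setT (fun w => ((f w)%:R : R)%:E).
Proof. by move=> mf; exact: (measurable_fun_discrete (fun n => (n%:R : R)%:E)). Qed.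

Lemma Ex_ge0 f : (0 <= Ex f)%E.
Proof. by apply: integral_ge0 => w _; rewrite lee_fin. Qed.

(* The two sides carry real coefficients because the greedy arguments below
   compare nat-valued costs with real multiples of lengths. *)
Lemma Ex_le_affine (c0 c1 c2 c3 c4 : R) f g f' : discrete_meas f ->
  discrete_meas g -> discrete_meas f' ->
  0 <= c0 -> 0 <= c1 -> 0 <= c2 -> 0 <= c3 -> 0 <= c4 ->
  {ae P, forall w,
    c0 + c1 * (f w)%:R <= c2 + c3 * (g w)%:R + c4 * (f' w)%:R} ->
  (c0%:E + c1%:E * Ex f <= c2%:E + c3%:E * Ex g + c4%:E * Ex f')%E.
Proof.
move=> mf mg mf' c00 c10 c20 c30 c40 h.
have E1 c k : 0 <= c -> discrete_meas k ->
    (c%:E * Ex k = \int[P]_w (c * (k w)%:R)%:E)%E.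
  move=> c00' mk; rewrite /Ex -ge0_integralZl//; exact: Ex_meas1.
have E0 c : (c%:E = \int[P]_w c%:E)%E.
  by rewrite integral_cst//= probability_setT mule1.
have ED (F G : T -> R) : measurable_fun setT (EFin \o F) ->
    measurable_fun setT (EFin \o G) -> (forall w, 0 <= F w) -> (forall w, 0 <= G w) ->
    (\int[P]_w (F w)%:E + \int[P]_w (G w)%:E = \int[P]_w (F w + G w)%:E)%E.
  move=> mF mG F0 G0; rewrite -ge0_integralD//; first by move=> w _; rewrite lee_fin.
  by move=> w _; rewrite lee_fin.
have mM (c : R) (k : T -> nat) : discrete_meas k -> measurable_fun setT (EFin \o (fun w => c * (k w)%:R : R)).
  by move=> mk; exact: (Ex_meas c mk).
have m0 c : measurable_fun setT (EFin \o (fun=> c) : T -> \bar R).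
  exact: measurable_cst.
have mD (F G : T -> R) : measurable_fun setT (EFin \o F) ->
    measurable_fun setT (EFin \o G) -> measurable_fun setT (EFin \o (fun w => F w + G w)).
  by move=> mF mG; exact: (emeasurable_funD mF mG).
rewrite !E1// (E0 c0) (E0 c2) ED ?ED//; do ?[by move=> w; rewrite ?addr_ge0 ?mulr_ge0].
- apply: ae_ge0_le_integral => //.
  + by move=> w _; rewrite lee_fin addr_ge0// mulr_ge0.
  + by apply: (@mD _ _); [exact: m0|exact: mM].
  + by move=> w _; rewrite lee_fin !addr_ge0// mulr_ge0.
  + by apply: (@mD _ _); [apply: (@mD _ _); [exact: m0|exact: mM]|exact: mM].
  + by apply: filterS h => w h _; rewrite lee_fin.
- by apply: (@mD _ _); [exact: m0|exact: mM].
- exact: mM.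
- exact: mM.
- exact: mM.
Qed.

Lemma Ex_le f g : discrete_meas f -> discrete_meas g ->
  (forall w, (f w <= g w)%N) -> (Ex f <= Ex g)%E.
Proof.
move=> mf mg h; apply: ge0_le_integral => //; do ?[exact: Ex_meas1].
by move=> w _; rewrite lee_fin ler_nat.
Qed.

Lemma ExD f g : discrete_meas f -> discrete_meas g ->
  (Ex (fun w => f w + g w)%N = Ex f + Ex g)%E.
Proof.
move=> mf mg; rewrite /Ex -ge0_integralD//; do ?[exact: Ex_meas1].
by apply: eq_integral => w _; rewrite natrD EFinD.
Qed.

Lemma Ex_sum (I : Type) (s : seq I) (f : I -> T -> nat) :
  (forall i, discrete_meas (f i)) ->
  (Ex (fun w => \sum_(i <- s) f i w)%N = \sum_(i <- s) Ex (f i))%E.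
Proof.
move=> mf; elim: s => [|i s IH].
  rewrite big_nil /Ex; under eq_integral do rewrite big_nil.
  exact: integral0.
rewrite big_cons -IH -ExD//; last exact: discrete_meas_sum.
by rewrite /Ex; under eq_integral do rewrite big_cons.
Qed.

Lemma ExZ (c : nat) f : discrete_meas f ->
  (Ex (fun w => c * f w)%N = (c%:R)%:E * Ex f)%E.
Proof.
move=> mf; rewrite /Ex -ge0_integralZl//; do ?[exact: Ex_meas1].
by apply: eq_integral => w _; rewrite natrM EFinM.
Qed.

Lemma Ex_prob (Q : T -> Prop) : measurable [set w | Q w] ->
  Ex (fun w => `[< Q w >]) = P [set w | Q w].
Proof.
move=> mQ; rewrite -[in RHS](setIT [set w | Q w]) -integral_indic//.
Qed.

End nat_expectation.

(** * Clusters and the chemical distance *)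

Section paths.
Variable d : nat.
Implicit Types (A B : set (site d)) (x y z : site d) (p : seq (site d)).

Lemma nn_adjacent_sym x y : nn_adjacent x y = nn_adjacent y x.
Proof. by rewrite /nn_adjacent -norm1N opprB. Qed.

Lemma path_in_cat A x y z p q : path_in A x y p -> path_in A y z q ->
  path_in A x z (p ++ q).
Proof.
move=> [pp lp Ap] [pq lq Aq]; split.
- by rewrite cat_path pp lp.
- by rewrite last_cat lp.
move=> u; rewrite -cat_cons mem_cat => /orP[/Ap//|uq].
by apply: Aq; rewrite inE uq orbT.
Qed.

Lemma path_in_rev A x y p : path_in A x y p -> exists q,
  path_in A y x q /\ size q = size p.
Proof.
move=> [pp lp Ap]; exists (rev (belast x p)); split; last by rewrite size_rev size_belast.
split.
- rewrite -lp rev_path; apply: sub_path pp => u v.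
  by rewrite nn_adjacent_sym.
- by case: p lp {pp Ap} => [|u p] //= _; rewrite rev_cons last_rcons.
move=> u; rewrite -lp inE mem_rev -in_cons -mem_rcons -lastI.
exact: Ap.
Qed.

Lemma path_in_sub A B x y p : A `<=` B -> path_in A x y p -> path_in B x y p.
Proof. by move=> AB [? ? Ap]; split=> // z /Ap /AB. Qed.

Lemma path_in_shift A x y z p :
  path_in [set u | A (u + z)] x y p ->
  path_in A (x + z) (y + z) (map (fun u => u + z) p).
Proof.
move=> [pp lp Ap]; split.
- rewrite (@path_map _ _ (fun u => u + z)); apply: sub_path pp => u v.
  by rewrite /= /nn_adjacent opprD addrACA subrr addr0.
- exact: etrans (last_map (fun u => u + z) p x) (congr1 (fun u => u + z) lp).
move=> u; rewrite -(map_cons (fun u => u + z)) => /mapP[v vp ->].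
exact: Ap.
Qed.

Lemma path_in_uniq A x y p : path_in A x y p -> exists q,
  [/\ path_in A x y q, (size q <= size p)%N & uniq (x :: q)].
Proof.
move=> [pp lp Ap]; case/shortenP: pp lp => q pq uq qp lq.
exists q; split=> //; last first.
  by apply: uniq_leq_size => //; case/andP: uq.
split=> // z; rewrite inE => /orP[/eqP->|/qp zp]; first by apply: Ap; rewrite mem_head.
by apply: Ap; rewrite inE zp orbT.
Qed.

Lemma path_in_norm A x y p : path_in A x y p -> (norm1 (x - y) <= size p)%N.
Proof.
move=> [pp lp _]; elim: p x pp lp => [|u p IH] x /=.
  by move=> _ ->; rewrite subrr /norm1 big1// => i _; rewrite mxE.
move=> /andP[/eqP xu pp] lp; have := IH _ pp lp.
have -> : x - y = (x - u) + (u - y) by rewrite addrA subrK.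
by have := norm1D (x - u) (u - y); rewrite xu; lia.
Qed.

Lemma connected_in_sym A x y : connected_in A x y -> connected_in A y x.
Proof. by move=> [p /path_in_rev[q [hq _]]]; exists q. Qed.

Lemma connected_in_trans A x y z : connected_in A x y -> connected_in A y z ->
  connected_in A x z.
Proof. by move=> [p hp] [q hq]; exists (p ++ q); exact: path_in_cat hp hq. Qed.

Lemma connected_in_sub A B x y : A `<=` B -> connected_in A x y ->
  connected_in B x y.
Proof. by move=> AB [p hp]; exists p; exact: path_in_sub AB hp. Qed.

Lemma connected_in_refl A x : A x -> connected_in A x x.
Proof. by move=> Ax; exists [::]; split=> // z; rewrite inE => /eqP->. Qed.

Lemma connected_in_r A x y : connected_in A x y -> A y.
Proof. by move=> [p [_ <- Ap]]; apply: Ap; rewrite mem_last. Qed.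

Lemma short_path A x y n z : connected_in (A `&` box z n) x y ->
  exists p, path_in A x y p /\ (size p <= (2 * n).+1 ^ d)%N.
Proof.
move=> [p /path_in_uniq[q [hq _ uq]]]; exists q; split.
  by apply: path_in_sub hq => u [].
apply: (@leq_trans (size (x :: q))) => //; rewrite -(size_boxseq z).
apply: uniq_leq_size => // u; rewrite mem_boxseq; case: hq => _ _ hq /hq [_].
by [].
Qed.

End paths.

Section clusters.
Variable d : nat.
Implicit Types (xi : config d) (x y z : site d).

Definition reach xi := connected_in (occupied xi).

Lemma shift_config0 xi : shift_config 0 xi = xi.
Proof. by apply/funext => y; rewrite /shift_config addr0. Qed.

Lemma shift_configD xi x z : shift_config x (shift_config z xi) = shift_config (x + z) xi.
Proof. by apply/funext => y; rewrite /shift_config addrA. Qed.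

Lemma reach_shift xi x y z : reach (shift_config z xi) x y <-> reach xi (x + z) (y + z).
Proof.
split=> [[p hp]|[p hp]].
  by exists (map (fun u => u + z) p); exact: path_in_shift.
exists (map (fun u => u - z) p).
have hp' : path_in [set u | occupied (shift_config z xi) (u - z)] (x + z) (y + z) p.
    by apply: path_in_sub hp => u; rewrite /occupied/= /shift_config subrK.
by have := path_in_shift hp'; rewrite !addrK.
Qed.

(** An infinite set of sites leaves every box. In this form membership is a countable combination of
    connection events. *)
Lemma S_ooP xi x : S_oo xi x <-> occupied xi x /\
  forall n, exists y, reach xi x y /\ (n <= normoo (x - y))%N.
Proof.
split=> [[ox ix]|[ox h]]; split=> //.
  move=> n; apply: contrapT => /forallNP h; apply: ix.
  apply: (@sub_finite_set _ _ [set` boxseq x n]); last exact: finite_seq.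
  move=> y xy; rewrite /= mem_boxseq leqNgt; apply/negP => /ltnW hn.
  by apply: (h y).
move=> /finite_seqP[s hs].
have [y [xy]] := h (\max_(z <- s) (normoo (x - z))).+1.
rewrite ltnNge => /negP; apply.
have ys : y \in s by have : [set` s] y by rewrite -hs.
exact: (@leq_bigmax_seq _ _ predT (fun z => normoo (x - z))).
Qed.

Lemma S_oo_reach xi x y : reach xi x y -> S_oo xi x -> S_oo xi y.
Proof.
move=> xy /S_ooP[ox hx]; apply/S_ooP; split; first exact: connected_in_r xy.
move=> n; have [z [xz hz]] := hx (n + normoo (x - y))%N.
exists z; split; first exact: connected_in_trans (connected_in_sym xy) xz.
have -> : y - z = (x - z) - (x - y) by rewrite [RHS]addrC opprB addrA subrK.
have := normooD ((x - z) - (x - y)) (x - y); rewrite subrK; lia.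
Qed.

Lemma S_oo_shift xi x z : S_oo (shift_config z xi) x <-> S_oo xi (x + z).
Proof.
split=> /S_ooP[ox h]; apply/S_ooP; split=> // n; have [y [xy hy]] := h n.
  exists (y + z); split; first exact/reach_shift.
  by rewrite opprD addrACA subrr addr0.
exists (y - z); split; first by apply/reach_shift; rewrite subrK.
by rewrite opprB addrA.
Qed.

Lemma S_ooS (R : realType) (r : \bar R) xi : S_oo xi `<=` S_ r xi.
Proof.
rewrite -(@S_pinfty R) => x [ox h]; split=> //.
exact: le_trans (leey _) h.
Qed.

(** The supremum in [diam1] runs over integers, so it reaches [r] only if some pair does: otherwise
    all distances are at most [ceil r - 1], which is below [r]. *)
Lemma S_realP (R : realType) (r : R) xi x : S_ r%:E xi x <->
  occupied xi x /\ exists yz : site d * site d,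
    [/\ reach xi x yz.1, reach xi x yz.2 & r <= (norm1 (yz.1 - yz.2))%:R].
Proof.
split=> [[ox h]|[ox [[y z] [/= xy xz h]]]]; split=> //; last first.
  by apply: (@le_trans _ _ (norm1 (y - z))%:R%:E);
    [rewrite lee_fin|apply: ereal_sup_ubound; exists y => //; exists z].
apply: contrapT => /forallNP hn.
have lt y z : reach xi x y -> reach xi x z -> (norm1 (y - z))%:R < r.
  by move=> xy xz; rewrite ltNge; apply/negP => le; apply: (hn (y, z)).
have r0 : 0 < r.
  have xx : reach xi x x by exact: connected_in_refl.
  by apply: le_lt_trans (lt _ _ xx xx).
have /andP[k1 _] := ceil_itv r.
move: h; rewrite leNgt => /negP; apply.
apply: (@le_lt_trans _ _ ((Num.ceil r - 1)%:~R : R)%:E); last by rewrite lte_fin.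
apply: ge_ereal_sup => _ [y xy] [z xz] <-; rewrite lee_fin.
have := lt _ _ xy xz; rewrite -[(norm1 _)%:R]/((norm1 (y - z))%:Z%:~R).
by rewrite -ceil_gt_int ler_int; move: (Num.ceil r) (norm1 _) => a b; lia.
Qed.

End clusters.

Lemma min_natP (Q : nat -> Prop) : (exists n, Q n) ->
  exists n, Q n /\ forall m, Q m -> (n <= m)%N.
Proof.
move=> [n Qn]; have h : exists n, `[< Q n >] by exists n; apply/asboolP.
exists (ex_minn h); case: ex_minnP => m /asboolP Qm hm; split=> // k Qk.
by apply: hm; apply/asboolP.
Qed.

Section chemical_distance.
Variables (R : realType) (d : nat).
Implicit Types (xi : config d) (x y z : site d).

Definition crossing_event n : set (config d) :=
  [set xi | S_ (n%:R : R)%:E xi `&` box 0 n !=set0].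

Definition uniqueness_event n : set (config d) :=
  [set xi | forall x y : site d,
     (S_ (n%:R / 10 : R)%:E xi `&` box 0 n) x ->
     (S_ (n%:R / 10 : R)%:E xi `&` box 0 n) y ->
     connected_in (occupied xi `&` box 0 (2 * n)) x y].

(* Indices are shifted by one because S1 says nothing about radius 0. *)
Definition good xi n := crossing_event n.+1 xi /\ uniqueness_event n.+1 xi.

Definition good_from xi n := forall m, (n <= m)%N -> good xi m.

Definition tame xi := exists n, good_from xi n.

Definition scale xi : nat :=
  xget 0%N [set n | good_from xi n /\ forall m, good_from xi m -> (n <= m)%N].

Definition regular xi := forall z, tame (shift_config z xi).

(* Ties are broken by the countable enumeration of sites. *)
Definition closest xi y := S_oo xi y /\ forall y', S_oo xi y' ->
  (normoo y < normoo y')%N \/ normoo y = normoo y' /\ (pickle y <= pickle y')%N.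

Definition nearest xi : site d := xget 0 (closest xi).

(** Computed in the configuration seen from [x], so that ties are broken in a translation-covariant
    way. *)
Definition anchor xi x := x + nearest (shift_config x xi).

(** The graph distance with values in [nat]. It is 0, not infinite, when there is no path, which is
    why its properties are stated under [reach]. *)
Definition chem xi x y : nat :=
  xget 0%N [set n | (exists2 p, path_in (occupied xi) x y p & size p = n) /\
    forall p, path_in (occupied xi) x y p -> (n <= size p)%N].

(* The value 0 outside the shift-invariant almost sure set [regular] makes [tau]
   a pseudometric for every configuration. *)
Definition tau xi x y : nat :=
  if `[< regular xi >] then chem xi (anchor xi x) (anchor xi y) else 0%N.

(* The number of sites of a box of radius [2 * (scale xi + 3)]: at radius
   [scale xi + 3] the box contains the anchors of 0 and of all its neighbours. *)
Definition local_cost xi : nat := ((4 * scale xi + 13) ^ d)%N.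

Lemma scaleP xi : tame xi -> good_from xi (scale xi).
Proof.
move=> /min_natP[n hn]; rewrite /scale.
by have [] := xgetPex 0%N (ex_intro _ n hn : exists n, [set n | _ n /\ _] n).
Qed.

(* At a good scale a cluster of diameter at least n also reaches a cluster of
   diameter at least 2 n; iterating, it is infinite. *)
Lemma S_oo_good xi n x : good_from xi n ->
  (S_ (n.+1%:R : R)%:E xi `&` box 0 n.+1) x -> S_oo xi x.
Proof.
move=> gn [Sx bx]; apply/S_ooP; split; first by case: Sx.
have step k : exists y, reach xi x y /\
    (S_ ((2 ^ k * n.+1)%:R : R)%:E xi `&` box 0 (2 ^ k * n.+1)) y.
  elim: k => [|k [y [xy [Sy By]]]].
    by exists x; rewrite mul1n; split=> //; case: Sx => ox _; exact: connected_in_refl.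
  have e : (2 ^ k.+1 * n.+1 = (2 ^ k.+1 * n.+1).-1.+1)%N.
    by rewrite prednK// muln_gt0 expn_gt0.
  have le : (n <= (2 ^ k.+1 * n.+1).-1)%N.
    have : (0 < 2 ^ k.+1)%N by rewrite expn_gt0.
    by move: e; set q := (2 ^ k.+1)%N; nia.
  have [[y' [Sy' By']] un] := gn _ le; rewrite -e in Sy' By' un.
  exists y'; split; last by [].
  apply: connected_in_trans xy _.
  (* The old point still counts at the doubled radius, because uniqueness there concerns all
     clusters of diameter at least a tenth of the radius. *)
  have le2 : ((2 ^ k.+1 * n.+1)%:R / 10 <= (2 ^ k * n.+1)%:R :> R).
    rewrite ler_pdivrMr// -natrM ler_nat expnS; nia.
  have le3 : ((2 ^ k.+1 * n.+1)%:R / 10 <= (2 ^ k.+1 * n.+1)%:R :> R).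
    by rewrite ler_pdivrMr// -natrM ler_nat leq_pmulr.
  apply: (@connected_in_sub _ (occupied xi `&` box 0 (2 * (2 ^ k.+1 * n.+1)))).
    by move=> u [].
  apply: un; split; [| |  |exact: By'].
  - by case: Sy => oy hy; split=> //; apply: le_trans hy; rewrite lee_fin.
  - move: By; rewrite /box /= => h; apply: leq_trans h _.
    by rewrite leq_mul2r leq_exp2l// leqnSn orbT.
  - by case: Sy' => oy hy; split=> //; apply: le_trans hy; rewrite lee_fin.
(* With [k = 2 d m] the diameter is at least [2 ^ k > 2 d m], and two points that far apart in
   [norm1] cannot both be within [normoo]-distance [m] of [x]. *)
move=> m; have [y [xy [/S_realP[_ [[u v] [/= yu yv uv]]] _]]] := step (2 * (d * m))%N.
rewrite ler_nat in uv.
have [h|h] := leqP m (normoo (x - u)).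
  by exists u; split=> //; exact: connected_in_trans xy yu.
exists v; split; first exact: connected_in_trans xy yv.
rewrite leqNgt; apply/negP => h'.
have {uv} : (2 * (d * m) < norm1 (u - v))%N.
  apply: leq_trans uv; apply: leq_trans (ltn_expl _ (ltnSn 1)) _.
  by rewrite leq_pmulr.
rewrite ltnNge => /negP; apply.
apply: leq_trans (norm1_normoo _) _; rewrite mulnCA leq_mul2l; apply/orP; right.
have -> : u - v = - (x - u) + (x - v) by rewrite opprB addrA subrK.
apply: leq_trans (normooD _ _) _; rewrite normooN; lia.
Qed.

Lemma S_oo_near xi n : good_from xi n ->
  exists2 x, S_oo xi x & (normoo x <= n.+1)%N.
Proof.
move=> gn; have [[x Sx] _] := gn n (leqnn n).
exists x; first exact: S_oo_good gn Sx.
by case: Sx => _; rewrite /box /= sub0r normooN.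
Qed.

(** Points of infinite clusters lie in [S_ r] for every [r], so uniqueness at radius [m + 1] joins
    them inside the box of radius [2 (m + 1)]; the bound is the number of its sites. *)
Lemma S_oo_connected xi n m x y : good_from xi n -> (n <= m)%N ->
  S_oo xi x -> S_oo xi y -> (normoo x <= m.+1)%N -> (normoo y <= m.+1)%N ->
  exists p, path_in (occupied xi) x y p /\ (size p <= (4 * m.+1).+1 ^ d)%N.
Proof.
move=> gn nm Sx Sy xm ym; have [_ un] := gn _ nm.
have -> : (4 * m.+1 = 2 * (2 * m.+1))%N by lia.
apply: (short_path (z := 0)); apply: un; split; do ?exact: S_ooS.
  by rewrite /box /= sub0r normooN.
by rewrite /box /= sub0r normooN.
Qed.

Lemma S_oo_reach_tame xi x y : tame xi -> S_oo xi x -> S_oo xi y -> reach xi x y.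
Proof.
move=> [n gn] Sx Sy.
have [p [hp _]] := @S_oo_connected xi n (n + normoo x + normoo y) x y gn
  ltac:(lia) Sx Sy ltac:(lia) ltac:(lia).
by exists p.
Qed.

Lemma closest_uniq xi y y' : closest xi y -> closest xi y' -> y = y'.
Proof.
move=> [Sy hy] [Sy' hy']; have := hy _ Sy'; have := hy' _ Sy.
move=> [h|[e h]] [h'|[e' h']]; try lia.
by apply: (pcan_inj pickleK); lia.
Qed.

Lemma closest_ex xi : (exists x, S_oo xi x) -> exists y, closest xi y.
Proof.
move=> [x Sx].
have [n [[y [Sy ny]] hn]] : exists n, (exists y, S_oo xi y /\ normoo y = n) /\
    forall m, (exists y, S_oo xi y /\ normoo y = m) -> (n <= m)%N.
  by apply: min_natP; exists (normoo x), x.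
have [k [[y' [Sy' ny' py']] hk]] : exists k,
    (exists y, [/\ S_oo xi y, normoo y = n & pickle y = k]) /\
    forall m, (exists y, [/\ S_oo xi y, normoo y = n & pickle y = m]) -> (k <= m)%N.
  by apply: min_natP; exists (pickle y), y.
exists y'; split=> // z Sz; have := hn _ (ex_intro _ z (conj Sz erefl)).
rewrite leq_eqVlt => /orP[/eqP e|]; last by rewrite ny'; left.
right; split; first by rewrite ny'.
by rewrite py'; apply: hk; exists z.
Qed.

Lemma nearestP xi : (exists x, S_oo xi x) -> closest xi (nearest xi).
Proof. by move=> /closest_ex[y hy]; exact: (xgetPex 0 (ex_intro _ y hy)). Qed.

Lemma nearest_le xi x : S_oo xi x -> (normoo (nearest xi) <= normoo x)%N.
Proof.
by move=> Sx; have [_ /(_ _ Sx)] := nearestP (ex_intro _ x Sx); lia.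
Qed.

Lemma nearest0 xi : S_oo xi 0 -> nearest xi = 0.
Proof.
by move=> /nearest_le; rewrite normoo0 leqn0 normoo_eq0 => /eqP.
Qed.

Lemma tame_S_oo xi : tame xi -> exists x, S_oo xi x.
Proof. by move=> [n /S_oo_near[x Sx _]]; exists x. Qed.

Lemma nearest_scale xi : tame xi -> (normoo (nearest xi) <= (scale xi).+1)%N.
Proof.
by move=> /scaleP/S_oo_near[x Sx h]; apply: leq_trans (nearest_le Sx) h.
Qed.

Lemma anchor_S_oo xi x : regular xi -> S_oo xi (anchor xi x).
Proof.
move=> /(_ x)/tame_S_oo/nearestP[h _]; rewrite /anchor addrC.
exact/S_oo_shift.
Qed.

Lemma anchor_shift xi x z : anchor (shift_config z xi) x + z = anchor xi (x + z).
Proof. by rewrite /anchor shift_configD addrAC. Qed.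

Lemma regular_shift xi z : regular (shift_config z xi) <-> regular xi.
Proof.
split=> h x; last by rewrite shift_configD.
by have := h (x - z); rewrite shift_configD subrK.
Qed.

Lemma regular_tame xi : regular xi -> tame xi.
Proof. by move=> /(_ 0); rewrite shift_config0. Qed.

Lemma regular_reach xi x y : regular xi -> S_oo xi x -> S_oo xi y -> reach xi x y.
Proof. by move=> /regular_tame; exact: S_oo_reach_tame. Qed.

Lemma chemP xi x y : reach xi x y ->
  (exists2 p, path_in (occupied xi) x y p & size p = chem xi x y) /\
  forall p, path_in (occupied xi) x y p -> (chem xi x y <= size p)%N.
Proof.
move=> [p hp].
have [n [hn mn]] : exists n, (exists2 p, path_in (occupied xi) x y p & size p = n) /\
    forall m, (exists2 p, path_in (occupied xi) x y p & size p = m) -> (n <= m)%N.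
  by apply: min_natP; exists (size p), p.
pose Q := [set n | (exists2 p, path_in (occupied xi) x y p & size p = n) /\
    forall p, path_in (occupied xi) x y p -> (n <= size p)%N].
apply: (@xgetPex _ 0%N Q); exists n; split=> // q hq.
by apply: mn; exists q.
Qed.

Lemma chem_le xi x y p : path_in (occupied xi) x y p -> (chem xi x y <= size p)%N.
Proof.
by move=> hp; have [_ h] := chemP (ex_intro _ p hp : reach xi x y); exact: h.
Qed.

Lemma chem_tri xi x y z : reach xi x y -> reach xi y z ->
  (chem xi x z <= chem xi x y + chem xi y z)%N.
Proof.
move=> /chemP[[p hp <-] _] /chemP[[q hq <-] _].
by rewrite -size_cat; apply: chem_le; exact: path_in_cat hp hq.
Qed.

Lemma chem_sym xi x y : reach xi x y -> chem xi x y = chem xi y x.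
Proof.
move=> xy; have yx := connected_in_sym xy.
have [[p hp sp] _] := chemP xy; have [[q hq sq] _] := chemP yx.
have [p' [hp' sp']] := path_in_rev hp; have [q' [hq' sq']] := path_in_rev hq.
by have := chem_le hp'; have := chem_le hq'; lia.
Qed.

Lemma chem_shift xi x y z : reach (shift_config z xi) x y ->
  chem (shift_config z xi) x y = chem xi (x + z) (y + z).
Proof.
move=> xy; have xyz := (reach_shift xi x y z).1 xy.
apply/eqP; rewrite eqn_leq; apply/andP; split.
  have [[p hp sp] _] := chemP xyz.
  have hp' : path_in [set u | occupied (shift_config z xi) (u - z)] (x + z) (y + z) p.
    by apply: path_in_sub hp => u; rewrite /occupied/= /shift_config subrK.
  have := path_in_shift hp'; rewrite !addrK => /chem_le.
  by rewrite size_map sp.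
have [[p hp <-] _] := chemP xy.
by rewrite -(size_map (fun u => u + z)); apply: chem_le; exact: path_in_shift.
Qed.

Lemma tau_regular xi x y : regular xi -> tau xi x y = chem xi (anchor xi x) (anchor xi y).
Proof. by move=> h; rewrite /tau asboolT. Qed.

Lemma tau_irregular xi x y : ~ regular xi -> tau xi x y = 0%N.
Proof. by move=> h; rewrite /tau asboolF. Qed.

Lemma tau_refl xi x : tau xi x x = 0%N.
Proof.
have [h|/tau_irregular->//] := pselect (regular xi); rewrite (tau_regular _ _ h).
apply/eqP; rewrite -leqn0; apply: (@chem_le _ _ _ [::]); split=> // z.
by rewrite inE => /eqP->; case: (anchor_S_oo x h).
Qed.

Lemma tau_sym xi x y : tau xi x y = tau xi y x.
Proof.
have [h|h] := pselect (regular xi); last by rewrite !(tau_irregular _ _ h).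
rewrite !(tau_regular _ _ h); apply: chem_sym.
by apply: (regular_reach h); exact: anchor_S_oo.
Qed.

Lemma tau_tri xi x y z : (tau xi x z <= tau xi x y + tau xi y z)%N.
Proof.
have [h|h] := pselect (regular xi); last by rewrite !(tau_irregular _ _ h).
by rewrite !(tau_regular _ _ h); apply: chem_tri; apply: (regular_reach h);
  exact: anchor_S_oo.
Qed.

Lemma tau_shift xi x y z : tau (shift_config z xi) x y = tau xi (x + z) (y + z).
Proof.
have [h|h] := pselect (regular xi); last first.
  by rewrite !tau_irregular// => /regular_shift.
have h' := (regular_shift xi z).2 h.
rewrite (tau_regular _ _ h') (tau_regular _ _ h) chem_shift; last first.
  by apply: (regular_reach h'); exact: anchor_S_oo.
by rewrite !anchor_shift.
Qed.

Lemma tau_loc0 xi y : (normoo y <= 1)%N -> (tau xi 0 y <= local_cost xi)%N.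
Proof.
move=> y1; have [h|h] := pselect (regular xi); last by rewrite tau_irregular.
have gt := regular_tame h; have gn := scaleP gt.
have p0 := nearest_scale gt.
have Sy := anchor_S_oo y h; have S0 := anchor_S_oo 0 h.
have e0 : anchor xi 0 = nearest xi by rewrite /anchor add0r shift_config0.
(* The anchor of 0 competes for the anchor of [y], one step farther away; measuring from 0 again
   adds another step, whence [scale xi + 3]. *)
have ny : (normoo (nearest (shift_config y xi)) <= (scale xi).+2)%N.
  have : S_oo (shift_config y xi) (nearest xi - y).
    by apply/S_oo_shift; rewrite subrK -e0.
  move=> /nearest_le hle; apply: leq_trans hle _.
  have := normooD (nearest xi) (- y); rewrite normooN; lia.
have py : (normoo (anchor xi y) <= (scale xi).+3)%N.
  by apply: leq_trans (normooD _ _) _; lia.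
have p0' : (normoo (anchor xi 0) <= (scale xi).+3)%N by rewrite e0; lia.
have le2 : (scale xi <= (scale xi).+2)%N by lia.
have [p [/chem_le hp sp]] := S_oo_connected gn le2 S0 Sy p0' py.
rewrite (tau_regular _ _ h); apply: (leq_trans hp); apply: (leq_trans sp).
rewrite /local_cost; have -> : ((4 * (scale xi).+3).+1 = 4 * scale xi + 13)%N by lia.
by [].
Qed.

Lemma tau_loc xi x y : (normoo (x - y) <= 1)%N ->
  (tau xi x y <= local_cost (shift_config x xi))%N.
Proof.
move=> xy; have := @tau_loc0 (shift_config x xi) (y - x).
by rewrite tau_shift add0r subrK normooB; apply.
Qed.

(** A path is at least as long as the distance of its ends, here the two anchors, and each anchor is
    within [local_cost] of its site. *)
Lemma tau_ge xi x y : (0 < d)%N -> regular xi -> (normoo (x - y) <= tau xi x y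
  + local_cost (shift_config x xi) + local_cost (shift_config y xi))%N.
Proof.
move=> d0 h; rewrite (tau_regular _ _ h).
have : (normoo (anchor xi x - anchor xi y) <= chem xi (anchor xi x) (anchor xi y))%N.
  have [[p hp <-] _] := chemP (regular_reach h (anchor_S_oo x h) (anchor_S_oo y h)).
  exact: leq_trans (normoo_norm1 _) (path_in_norm hp).
have near z : (normoo (nearest (shift_config z xi)) <= local_cost (shift_config z xi))%N.
  apply: leq_trans (nearest_scale (h z)) _; rewrite /local_cost.
  apply: (@leq_trans (4 * scale (shift_config z xi) + 13)); first by lia.
  by rewrite -[leqLHS]expn1 leq_pexp2l//; lia.
have := near x; have := near y.
move=> hy hx hp.
have -> : x - y = (anchor xi x - anchor xi y) + (nearest (shift_config y xi)
    - nearest (shift_config x xi)).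
  rewrite /anchor; move: (nearest _) (nearest _) => u v.
  by apply/rowP => i; rewrite !mxE; ring.
have := normooD (anchor xi x - anchor xi y) (nearest (shift_config y xi)
    - nearest (shift_config x xi)).
have := normooD (nearest (shift_config y xi)) (- nearest (shift_config x xi)).
rewrite normooN; lia.
Qed.

End chemical_distance.

(** * Measurability and moments *)

Section omega_measurability.
Variable d : nat.
Implicit Types (x y z : site d).

Lemma meas_coord y : measurable [set xi : Omega d | (xi : config d) y].
Proof.
apply: sub_gen_smallest; exists y => //; exists [set true] => //.
by rewrite setTI; apply/seteqP; split.
Qed.

Lemma measurable_shift z :
  measurable_fun setT (@shift_config d z : Omega d -> Omega d).
Proof.
apply: (@measurability _ _ (Omega d) (Omega d) setT (@shift_config d z)
  (@coord_preimages d setT)); first by [].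
move=> _ [_ [y _ [B mB <-]] <-].
rewrite !setTI; have : measurable [set xi : Omega d | B ((xi : config d) (y + z))].
  apply: (@meas_ext _ _ (fun xi : Omega d => ((xi : config d) (y + z) /\ B true) \/
    (~ (xi : config d) (y + z) /\ B false))).
    by move=> xi; case: (xi _); split=> [[[//]|[//]]|]; [left|right].
  by apply: meas_or; apply: meas_and; do ?[exact: meas_const|apply: meas_not];
    exact: meas_coord.
by [].
Qed.

Lemma meas_shift (Q : Omega d -> Prop) z : measurable [set w | Q w] ->
  measurable [set w : Omega d | Q (shift_config z w)].
Proof. by move=> mQ; rewrite -[X in measurable X]setTI; exact: measurable_shift. Qed.

Lemma discrete_meas_shift (I : Type) (f : Omega d -> I) z : discrete_meas f ->
  discrete_meas (fun w : Omega d => f (shift_config z w)).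
Proof. by move=> mf i; exact: meas_shift (mf i). Qed.

Lemma meas_path_in (A : Omega d -> set (site d)) x y p :
  (forall z, measurable [set w | A w z]) -> measurable [set w | path_in (A w) x y p].
Proof.
move=> mA; apply: (@meas_ext _ _ (fun w => (path (@nn_adjacent d) x p /\ last x p = y) /\
    forall z, z \in x :: p -> A w z)).
  by move=> w; split=> [[[? ?] ?]|[? ? ?]].
apply: meas_and; first exact: meas_const.
by apply: meas_all => z; apply: meas_imp; [exact: meas_const|exact: mA].
Qed.

Lemma meas_connected (A : Omega d -> set (site d)) x y :
  (forall z, measurable [set w | A w z]) -> measurable [set w | connected_in (A w) x y].
Proof. by move=> mA; apply: meas_ex => p; exact: meas_path_in. Qed.

Lemma meas_reach x y : measurable [set w : Omega d | reach w x y].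
Proof. by apply: meas_connected => z; exact: meas_coord. Qed.

Lemma meas_S_oo x : measurable [set w : Omega d | S_oo w x].
Proof.
apply: meas_ext; first by move=> w; exact: iff_sym (S_ooP w x).
apply: meas_and; first exact: meas_coord.
apply: meas_all => n; apply: meas_ex => y; apply: meas_and; first exact: meas_reach.
exact: meas_const.
Qed.

Lemma meas_S_real (R : realType) (r : R) x :
  measurable [set w : Omega d | S_ r%:E w x].
Proof.
apply: meas_ext; first by move=> w; exact: iff_sym (S_realP r w x).
apply: meas_and; first exact: meas_coord.
apply: meas_ex => -[y z] /=; apply: (@meas_ext _ _ (fun w : Omega d => reach w x y /\
   (reach w x z /\ r <= (norm1 (y - z))%:R))).
  by move=> w; split=> [[? [? ?]]|[? ? ?]].
by do ?apply: meas_and; do ?[exact: meas_reach|exact: meas_const].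
Qed.

Lemma meas_crossing (R : realType) n :
  measurable [set w : Omega d | @crossing_event R d n w].
Proof.
by apply: meas_ex => x; apply: meas_and; [exact: meas_S_real|exact: meas_const].
Qed.

Lemma meas_uniqueness (R : realType) n :
  measurable [set w : Omega d | @uniqueness_event R d n w].
Proof.
have mS x : measurable [set w : Omega d | (S_ (n%:R / 10 : R)%:E w `&` box 0 n) x].
  by apply: meas_and; [exact: meas_S_real|exact: meas_const].
apply: meas_all => x; apply: meas_all => y; do 2 apply: meas_imp => //.
by apply: meas_connected => z; apply: meas_and; [exact: meas_coord|exact: meas_const].
Qed.

Variable R : realType.

Lemma meas_good n : measurable [set w : Omega d | @good R d w n].
Proof. by apply: meas_and; [exact: meas_crossing|exact: meas_uniqueness]. Qed.

Lemma meas_good_from n : measurable [set w : Omega d | @good_from R d w n].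
Proof. by apply: meas_all => m; apply: meas_imp; [exact: meas_const|exact: meas_good]. Qed.

Lemma meas_tame : measurable [set w : Omega d | @tame R d w].
Proof. by apply: meas_ex => n; exact: meas_good_from. Qed.

Lemma meas_regular : measurable [set w : Omega d | @regular R d w].
Proof. by apply: meas_all => z; exact: (meas_shift z meas_tame). Qed.

Lemma discrete_meas_scale : discrete_meas (@scale R d : Omega d -> nat).
Proof.
apply: discrete_meas_xget => [n|w n m [gn hn] [gm hm]].
  apply: meas_and; first exact: meas_good_from.
  by apply: meas_all => m; apply: meas_imp; [exact: meas_good_from|exact: meas_const].
by apply/eqP; rewrite eqn_leq hn// hm.
Qed.

Lemma discrete_meas_nearest : discrete_meas (@nearest d : Omega d -> site d).
Proof.
apply: discrete_meas_xget => [y|w y y']; last exact: closest_uniq.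
apply: meas_and; first exact: meas_S_oo.
by apply: meas_all => y'; apply: meas_imp; [exact: meas_S_oo|exact: meas_const].
Qed.

Lemma discrete_meas_anchor x : discrete_meas (fun w : Omega d => anchor w x).
Proof.
exact: (discrete_meas_comp (fun y => x + y)
  (discrete_meas_shift x discrete_meas_nearest)).
Qed.

Lemma discrete_meas_chem x y : discrete_meas (fun w : Omega d => chem w x y).
Proof.
have mp p : measurable [set w : Omega d | path_in (occupied w) x y p].
  by apply: meas_path_in => z; exact: meas_coord.
apply: discrete_meas_xget => [n|w n m [[p hp sp] hn] [[q hq sq] hm]].
  apply: meas_and.
    apply: (@meas_ext _ _ (fun w : Omega d => exists p, path_in (occupied w) x y p /\ size p = n)).
      by move=> w; split=> [[p [? ?]]|[p ? ?]]; exists p.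
    by apply: meas_ex => p; apply: meas_and => //; exact: meas_const.
  by apply: meas_all => p; apply: meas_imp => //; exact: meas_const.
by have := hn _ hq; have := hm _ hp; lia.
Qed.

Lemma discrete_meas_tau x y : discrete_meas (fun w : Omega d => @tau R d w x y).
Proof.
have mb := discrete_meas_asbool meas_regular.
have mc : discrete_meas (fun w : Omega d => chem w (anchor w x) (anchor w y)).
  (* The endpoints are random themselves: split according to their countably many values. *)
  move=> n; apply: (@meas_ext _ _ (fun w : Omega d => exists uv : site d * site d,
      (anchor w x, anchor w y) = uv /\ chem w uv.1 uv.2 = n)).
    by move=> w; split=> [[_ [<- //]]|h]; exists (anchor w x, anchor w y).
  apply: meas_ex => uv; apply: meas_and; last exact: discrete_meas_chem.
  exact: (discrete_meas_pair (discrete_meas_anchor x) (discrete_meas_anchor y)).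
exact: (discrete_meas_comp2 (fun (b : bool) n => if b then n else 0%N) mb mc).
Qed.

Lemma discrete_meas_local_cost : discrete_meas (@local_cost R d : Omega d -> nat).
Proof. exact: (discrete_meas_comp (fun n => (4 * n + 13) ^ d)%N discrete_meas_scale). Qed.

Variable P : probability (Omega d) R.
Hypothesis Pinv : forall (z : site d) (A : set (Omega d)), measurable A ->
  P (@shift_config d z @^-1` A) = P A.

Lemma Ex_shift (f : Omega d -> nat) z : discrete_meas f ->
  Ex P (fun w : Omega d => f (shift_config z w)) = Ex P f.
Proof.
move=> mf; have mf' := @Ex_meas1 _ _ R _ mf.
have ms : measurable_fun setT (@shift_config d z : Omega d -> Omega d).
  exact: measurable_shift.
transitivity (\int[pushforward P (@shift_config d z : Omega d -> Omega d)]_w ((f w)%:R : R)%:E)%E.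
  by rewrite ge0_integral_pushforward.
by apply: eq_measure_integral => A mA _; exact: (Pinv z mA).
Qed.

End omega_measurability.

Section ae_countable.
Context {disp : measure_display} {T : measurableType disp} {R : realType}.
Variable P : probability T R.

Lemma ae_all (I : countType) (Q : I -> T -> Prop) :
  (forall i, {ae P, forall w, Q i w}) -> {ae P, forall w, forall i, Q i w}.
Proof.
move=> h; have := @ae_foralln _ _ _ P (fun n w => if unpickle n is Some i then Q i w else True).
case=> [n|A [mA A0 hA]]; first by case: (unpickle n) => [i|]; [exact: h|exact: aeW].
exists A; split=> // w /= nQ; apply: hA => /= hn; apply: nQ => i.
by have := hn (pickle i); rewrite pickleK.
Qed.

Lemma ae_prob0 (Q : T -> Prop) : measurable [set w | Q w] ->
  {ae P, forall w, Q w} <-> P [set w | ~ Q w] = 0%E.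
Proof.
move=> mQ; rewrite -(negligibleP _ (meas_not mQ)).
by [].
Qed.

Lemma ae_prob1 (Q : T -> Prop) : measurable [set w | Q w] ->
  {ae P, forall w, Q w} <-> P [set w | Q w] = 1%E.
Proof.
move=> mQ; rewrite ae_prob0//; have := probability_setC P mQ.
rewrite -[~` _]/[set w | ~ Q w] => ->.
have := fin_num_measure P _ mQ; case: (P _) => //= r _.
by split=> [[]|[->]]; [|rewrite subee]; move=> // /eqP; rewrite subr_eq0 => /eqP ->.
Qed.

End ae_countable.


(** Telescoping against [1 / q - 1 / (q + 1)]; the induction carries the stronger bound
    [2 - 1 / n]. *)
Lemma sum_inv_sq_le (R : realType) n : \sum_(m < n) ((m.+1%:R ^+ 2)^-1 : R) <= 2.
Proof.
have h k : \sum_(m < k.+1) ((m.+1%:R ^+ 2)^-1 : R) <= 2 - k.+1%:R^-1.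
  elim: k => [|k IH]; first by rewrite big_ord1 expr1n invr1; lra.
  rewrite big_ord_recr /=; apply: (le_trans (lerD IH (lexx _))).
  have k0 : 0 < k.+1%:R :> R by rewrite ltr0n.
  have -> : k.+2%:R = k.+1%:R + 1 :> R by rewrite natr1.
  move: k0; move: (k.+1%:R : R) => q q0.
  suff : ((q + 1) ^+ 2)^-1 <= q^-1 - (q + 1)^-1.
    move: (_ ^-1) (q^-1) ((q + 1)^-1) => A B C; lra.
  have -> : q^-1 - (q + 1)^-1 = (q * (q + 1))^-1.
    by field; rewrite !gt_eqF ?addr_gt0.
  rewrite lef_pV2 ?posrE ?exprn_gt0 ?mulr_gt0 ?addr_gt0//.
  rewrite expr2 ler_pM2r ?addr_gt0//; lra.
case: n => [|n]; first by rewrite big_ord0.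
by apply: (le_trans (h n)); rewrite gerBl.
Qed.

Lemma nneseries_le (R : realType) (u : nat -> \bar R) (c : \bar R) :
  (forall n, (0 <= u n)%E) -> (forall n, (\sum_(0 <= i < n) u i <= c)%E) ->
  (\sum_(i <oo) u i <= c)%E.
Proof.
move=> u0 uc; apply: lime_le; first by apply: is_cvg_nneseries => n _ _.
by apply: nearW => n; exact: uc.
Qed.

(** Once [ln n] exceeds [x = q^(1 / Delta)], the factor [(ln n)^Delta] is at least [q] and hence
    [f n >= q ln n]. *)
Lemma bernoulli_tail (R : realType) (q : nat) (Delta RS : R) (f : nat -> R) :
  0 < Delta ->
  (forall n : nat, (1 <= n)%N -> RS <= n%:R -> ln n%:R `^ (1 + Delta) <= f n) ->
  exists n0, forall n, (n0 <= n)%N -> (0 < n)%N /\ expR (- f n) <= (n%:R ^+ q)^-1.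
Proof.
move=> D0 hf.
pose x : R := q%:R `^ Delta^-1.
pose c := Num.bound (`|RS| + expR x + 1).
have hc : `|RS| + expR x + 1 < c%:R by apply: archi_boundP; rewrite !addr_ge0// expR_ge0.
exists c.+1 => n cn; have n0 : (0 < n)%N by exact: leq_trans cn.
split=> //.
have cn' : c%:R <= n%:R :> R by rewrite ler_nat ltnW.
have RSn : RS <= n%:R.
  have := ler_norm RS; have := expR_gt0 x; lra.
have xn : expR x <= n%:R.
  have := normr_ge0 RS; have := expR_gt0 x; lra.
have n0' : 0 < n%:R :> R by rewrite ltr0n.
have ln_x : x <= ln n%:R.
  by rewrite -[x]expRK ler_ln ?posrE ?expR_gt0.
have x0 : 0 <= x by exact: powR_ge0.
have l0 : 0 <= ln n%:R := le_trans x0 ln_x.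
have l0' : 0 <= ln (n%:R : R) by [].
have qf : q%:R * ln n%:R <= f n.
  apply: le_trans (hf n n0 RSn); rewrite powRD; last first.
    by rewrite gt_eqF// addr_gt0.
  rewrite powRr1// mulrC ler_wpM2l//.
  have -> : q%:R = x `^ Delta :> R.
    by rewrite /x -powRrM mulVf ?gt_eqF// powRr1.
  by apply: ge0_ler_powR; rewrite ?nnegrE ?(ltW D0).
apply: (@le_trans _ _ (expR (- (q%:R * ln n%:R)))).
  by rewrite ler_expR lerN2.
by rewrite expRN expRM_natl lnK.
Qed.

Section moments.
Variables (R : realType) (d : nat) (P : probability (Omega d) R).
Variables (Delta RS : R) (f : nat -> R).
Hypothesis Delta_gt0 : 0 < Delta.
Hypothesis f_ge : forall n : nat, (1 <= n)%N -> RS <= n%:R ->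
  ln n%:R `^ (1 + Delta) <= f n.
Hypothesis P_crossing : forall n, (1 <= n)%N ->
  ((1 - expR (- f n))%:E <= P (@crossing_event R d n))%E.
Hypothesis P_uniqueness : forall n, (1 <= n)%N ->
  ((1 - expR (- f n))%:E <= P (@uniqueness_event R d n))%E.
Hypothesis Pinv : forall (z : site d) (A : set (Omega d)), measurable A ->
  P (@shift_config d z @^-1` A) = P A.

(** The 2 in the constant counts the crossing and the uniqueness event; [n0 ^ q] makes the bound
    exceed 1, hence trivial, at the radii below [n0]. *)
Lemma P_bad_le (q : nat) : exists2 c : R, 0 <= c &
  forall n, (P [set w | ~ @good R d w n] <= (c / n.+1%:R ^+ q)%:E)%E.
Proof.
have [n0 hn0] := bernoulli_tail q Delta_gt0 f_ge.
exists (2 + n0%:R ^+ q); first by rewrite addr_ge0// exprn_ge0.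
move=> n; have nq0 : 0 < n.+1%:R ^+ q :> R by rewrite exprn_gt0// ltr0n.
have [le|lt] := leqP n0 n.+1; last first.
  apply: (@le_trans _ _ 1%E); first by apply: probability_le1; apply: meas_not; exact: (@meas_good d R).
  rewrite lee_fin ler_pdivlMr// mul1r -[leLHS]add0r lerD//.
  by apply: lerXn2r; rewrite ?nnegrE// ler_nat ltnW.
have [_ hf] := hn0 _ le.
have compl A : measurable A -> ((1 - expR (- f n.+1))%:E <= P A)%E ->
    (P (~` A) <= (expR (- f n.+1))%:E)%E.
  move=> mA; rewrite probability_setC// -(fineK (fin_num_measure P _ mA)).
  by rewrite -EFinB !lee_fin; lra.
have hC := compl _ (@meas_crossing d R n.+1) (P_crossing (ltn0Sn n)).
have hU := compl _ (@meas_uniqueness d R n.+1) (P_uniqueness (ltn0Sn n)).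
rewrite (_ : [set w | _] = ~` (@crossing_event R d n.+1) `|` ~` (@uniqueness_event R d n.+1)).
  2: by rewrite -setCI.
apply: (le_trans (measureU2 _ _ _)).
- by apply: measurableC; exact: (@meas_crossing d R).
- by apply: measurableC; exact: (@meas_uniqueness d R).
apply: (le_trans (leeD hC hU)); rewrite -EFinD lee_fin.
apply: (@le_trans _ _ (2 / n.+1%:R ^+ q)); first by lra.
by rewrite ler_pM2r ?invr_gt0// lerDl exprn_ge0.
Qed.

(** Borel-Cantelli: a configuration is not tame exactly when infinitely many scales are bad. *)
Lemma ae_tame : {ae P, forall w, @tame R d w}.
Proof.
apply/(ae_prob0 _ (@meas_tame d R)).
pose F n := [set w : Omega d | ~ @good R d w n].
have mF n : measurable (F n) by apply: meas_not; exact: (@meas_good d R).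
have -> : [set w | ~ @tame R d w] = lim_sup_set F.
  apply/seteqP; split=> w /=.
    move=> h n _; apply: contrapT => hn; apply: h; exists n => m nm.
    by apply: contrapT => hm; apply: hn; exists m.
  by move=> h [n gn]; have [m nm] := h n I; apply; exact: gn.
apply: lim_sup_set_cvg0 => //.
have [c c0 hc] := P_bad_le 2.
apply: (@le_lt_trans _ _ (c * 2)%:E); last exact: ltry.
apply: nneseries_le => // n; rewrite big_mkord.
apply: (@le_trans _ _ (\sum_(i < n) (c / i.+1%:R ^+ 2)%:E)%E).
  by apply: lee_sum => i _; exact: hc.
by rewrite sumEFin lee_fin -mulr_sumr ler_wpM2l// sum_inv_sq_le.
Qed.

Lemma ae_shift (Q : Omega d -> Prop) z : measurable [set w | Q w] ->
  {ae P, forall w, Q w} -> {ae P, forall w : Omega d, Q (shift_config z w)}.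
Proof.
move=> mQ /(ae_prob0 _ mQ) h; apply/(ae_prob0 _ (meas_shift z mQ)).
by rewrite -[RHS]h; exact: (Pinv z (meas_not mQ)).
Qed.

Lemma ae_regular : {ae P, forall w, @regular R d w}.
Proof. by apply: ae_all => z; apply: (ae_shift z (@meas_tame d R)); exact: ae_tame. Qed.

(** By minimality the index just below the scale is bad. Off the tame event [scale] takes its
    default 0, which the hypothesis excludes. *)
Lemma scale_bad (w : config d) n : scale R w = n.+1 -> ~ @good R d w n.
Proof.
move=> sn gn; have [tw|tw] := pselect (@tame R d w); last first.
  move: sn; rewrite /scale xgetPN// => k [gk _]; apply: tw; by exists k.
have [k hk] := min_natP tw.
have [gs ms] : good_from R w n.+1 /\ forall m, good_from R w m -> (n.+1 <= m)%N.
  by rewrite -sn; exact: (@xgetPex _ 0%N [set n | good_from R w n /\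
     forall m, good_from R w m -> (n <= m)%N] (ex_intro _ k hk)).
suff /ms : good_from R w n by rewrite ltnn.
by move=> m; rewrite leq_eqVlt => /orP[/eqP <-//|]; exact: gs.
Qed.

(* [g (scale) <= g 0 + sum_n g (n + 1) 1{n is bad}] since [scale = n + 1] makes n
   bad, and bad scales have superpolynomially small probability. *)
Lemma Ex_scale_poly (a b k : nat) : (Ex P (fun w : Omega d => (a * scale R w + b) ^ k)%N < +oo)%E.
Proof.
pose g n := ((a * n + b) ^ k)%N.
(* Of the exponent [k + 2], the part [k] absorbs the growth of [g] and the 2 makes the series
   converge. *)
have [c c0 hc] := P_bad_le (k + 2).
pose bad n (w : Omega d) := `[< ~ @good R d w n >].
have mbad n : discrete_meas (bad n) by apply: discrete_meas_asbool; apply: meas_not; exact: (@meas_good d R).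
pose G (n : nat) (w : Omega d) := (if n is m.+1 then g m.+1 * bad m w else g 0)%N.
have mG n : discrete_meas (G n).
  case: n => [|n]; first exact: discrete_meas_cst.
  exact: (discrete_meas_comp (fun x : bool => (g n.+1 * x)%N) (mbad n)).
apply: (@le_lt_trans _ _ (\int[P]_w \sum_(n <oo) ((G n w)%:R : R)%:E)%E).
  apply: ge0_le_integral => //.
  - apply: Ex_meas1; exact: (discrete_meas_comp g (@discrete_meas_scale d R)).
  - by apply: ge0_emeasurable_sum => // n _; exact: Ex_meas1.
  move=> w _; have ge0 n : (0 <= n)%N -> xpredT n -> (0 <= ((G n w)%:R : R)%:E)%E.
    by rewrite lee_fin.
  (* Of the partial sum only the term of index [scale R w] is kept; it equals [g (scale R w)]. *)
  apply: le_trans (nneseries_lim_ge (scale R w).+1 ge0).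
  rewrite big_mkord (bigD1 ord_max)//= -[leLHS]adde0; apply: leeD; last first.
    by apply: sume_ge0 => n _; rewrite lee_fin.
  rewrite lee_fin ler_nat -/(g _); case E : (scale R w) => [//|n] /=.
  by rewrite /bad asboolT ?muln1//; exact: scale_bad.
rewrite integral_nneseries//; last by move=> n; exact: Ex_meas1.
apply: (@le_lt_trans _ _ ((g 0)%:R + c * (a + b)%:R ^+ k * 4)%:E); last exact: ltry.
apply: nneseries_le => [n|n]; first exact: Ex_ge0.
rewrite -/(Ex P _) big_mkord; case: n => [|n].
  by rewrite big_ord0 lee_fin addr_ge0// !mulr_ge0// exprn_ge0.
rewrite big_ord_recl /= EFinD; apply: leeD.
  by rewrite integral_cst//= probability_setT mule1.
apply: (@le_trans _ _ (\sum_(i < n) (c * (a + b)%:R ^+ k * 2 * (i.+1%:R ^+ 2)^-1)%:E)%E).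
  apply: lee_sum => i _.
  have -> : (\int[P]_w ((g i.+1 * bad i w)%:R)%:E = (g i.+1)%:R%:E * P [set w | ~ @good R d w i])%E.
    rewrite -Ex_prob; last by apply: meas_not; exact: (@meas_good d R).
    rewrite -ExZ//; exact: (discrete_meas_comp nat_of_bool (mbad i)).
  apply: (@le_trans _ _ ((g i.+1)%:R * (c / i.+1%:R ^+ (k + 2)))%:E).
    by rewrite EFinM lee_wpmul2l ?lee_fin.
  rewrite lee_fin exprD invfM.
  have i0 : 0 < i.+1%:R :> R by rewrite ltr0n.
  have ik : 0 < i.+1%:R ^+ k :> R by rewrite exprn_gt0.
  have hg : (g i.+1)%:R <= (a + b)%:R ^+ k * i.+1%:R ^+ k :> R.
    rewrite -exprMn -natrM -natrX ler_nat /g; case: (posnP k) => [->//|k0].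
    by rewrite leq_exp2r//; nia.
  apply: (@le_trans _ _ (((a + b)%:R ^+ k * i.+1%:R ^+ k) * (c * ((i.+1%:R ^+ k)^-1 * (i.+1%:R ^+ 2)^-1)))).
    by rewrite ler_wpM2r// !mulr_ge0 ?invr_ge0 ?exprn_ge0.
  have -> : (a + b)%:R ^+ k * i.+1%:R ^+ k * (c * ((i.+1%:R ^+ k)^-1 * (i.+1%:R ^+ 2)^-1))
     = c * (a + b)%:R ^+ k * (i.+1%:R ^+ 2)^-1 :> R.
    by field; rewrite expf_neq0 ?gt_eqF.
  rewrite ler_wpM2r ?invr_ge0 ?exprn_ge0// ler_peMr ?mulr_ge0 ?exprn_ge0//.
  by rewrite ler1n.
rewrite sumEFin lee_fin -mulr_sumr -[leRHS]mulrA.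
have -> : c * ((a + b)%:R ^+ k * 4) = (c * (a + b)%:R ^+ k * 2) * 2 by ring.
by rewrite ler_wpM2l ?sum_inv_sq_le// !mulr_ge0// exprn_ge0.
Qed.

Lemma Ex_local_cost_pow k : (Ex P (fun w : Omega d => local_cost R w ^ k)%N < +oo)%E.
Proof.
have := Ex_scale_poly 4 13 (d * k).
by rewrite /Ex; under eq_integral do rewrite expnM.
Qed.

End moments.

(** * Maximal and ergodic inequalities *)

Lemma boxseqD d (x y : site d) n : boxseq (x + y) n = [seq z + y | z <- boxseq x n].
Proof. by rewrite /boxseq -map_comp; apply: eq_map => w /=; rewrite addrAC. Qed.

Section maximal.
Variables (R : realType) (d : nat) (P : probability (Omega d) R).
Hypothesis Pinv : forall (z : site d) (A : set (Omega d)), measurable A ->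
  P (@shift_config d z @^-1` A) = P A.
Variable s : Omega d -> nat.
Hypothesis ms : discrete_meas s.
Hypothesis s_int : (Ex P s < +oo)%E.

Definition box_sum (w : Omega d) r : nat :=
  (\sum_(y <- boxseq 0 r) s (shift_config y w))%N.

Lemma discrete_meas_box_sum r : discrete_meas (fun w => box_sum w r).
Proof. by apply: discrete_meas_sum => y; exact: discrete_meas_shift. Qed.

(** The event that the maximal function of [s], truncated at radius [N], is at least [l]. The
    truncation confines the covering to a finite box. *)
Definition dense_upto l N : set (Omega d) :=
  [set w | exists r, (r <= N)%N /\ (l * (2 * r).+1 ^ d <= box_sum w r)%N].

Lemma meas_dense_upto l N : measurable (dense_upto l N).
Proof.
apply: meas_ex => r; apply: meas_and; first exact: meas_const.
exact: (meas_discrete (fun k => is_true (l * (2 * r).+1 ^ d <= k)%N)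
  (@discrete_meas_box_sum r)).
Qed.

(** Transference: for a fixed configuration the covering lemma is applied to the dense sites of the
    box of radius [N]. Their witnessing boxes have radius at most [N], so they stay in the box of
    radius [2 N]. *)
Lemma dense_count l N (w : Omega d) :
  (l * \sum_(z <- boxseq 0 N) `[< dense_upto l N (shift_config z w) >] <=
   2 ^ d * \sum_(y <- boxseq 0 (2 * N)) s (shift_config y w))%N.
Proof.
pose E := [seq z <- boxseq 0 N | `[< dense_upto l N (shift_config z w) >]].
have -> : (\sum_(z <- boxseq (0 : site d) N) `[< dense_upto l N (shift_config z w) >])%N = size E.
  by rewrite size_filter -sum1_count [RHS]big_mkcond; apply: eq_bigr => z _; case: `[< _ >].
pose Q z := [set r | (r <= N)%N /\
  (l * (2 * r).+1 ^ d <= box_sum (shift_config z w) r)%N].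
pose r z := xget 0%N (Q z).
have hr z : z \in E -> (r z <= N)%N /\
    (l * (2 * r z).+1 ^ d <= box_sum (shift_config z w) (r z))%N.
  by rewrite mem_filter => /andP[/asboolP[k hk] _]; exact: (@xgetPex _ 0%N (Q z) (ex_intro _ k hk)).
apply: (@vitali_count d (fun y => s (shift_config y w)) l r).
- exact/filter_uniq/boxseq_uniq.
- exact: boxseq_uniq.
- move=> z zE y; have [rN _] := hr z zE; move: zE.
  rewrite mem_filter !mem_boxseq !sub0r !normooN => /andP[_ zN] h.
  have := normooD z (- (z - y)); rewrite normooN opprB addrC subrK; lia.
- move=> z zE; have [_ h] := hr z zE; apply: leq_trans h _.
  have -> : boxseq z (r z) = [seq y + z | y <- boxseq 0 (r z)].
    by rewrite -boxseqD add0r.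
  rewrite /box_sum [leqRHS]big_map.
  by apply: leq_sum => y _; rewrite shift_configD.
Qed.

(** Integrating [dense_count], stationarity makes all terms of each sum equal. One factor [2^d] is
    from the covering, the other bounds the ratio of the box sizes at radii [2 N] and [N]. *)
Lemma P_dense_upto l N :
  ((l%:R)%:E * P (dense_upto l N) <= ((4 ^ d)%:R)%:E * Ex P s)%E.
Proof.
have mD z := discrete_meas_shift z (discrete_meas_asbool (meas_dense_upto l N)).
have mb z : discrete_meas (fun w : Omega d => (`[< dense_upto l N (shift_config z w) >] : nat)).
  exact: (discrete_meas_comp nat_of_bool (mD z)).
have mS1 : discrete_meas (fun w : Omega d =>
    \sum_(z <- boxseq 0 N) `[< dense_upto l N (shift_config z w) >])%N.
  by apply: discrete_meas_sum => z; exact: mb.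
have mS2 : discrete_meas (fun w : Omega d =>
    \sum_(y <- boxseq 0 (2 * N)) s (shift_config y w))%N.
  by apply: discrete_meas_sum => y; exact: discrete_meas_shift.
have := Ex_le P (discrete_meas_comp (muln l) mS1) (discrete_meas_comp (muln (2 ^ d)) mS2)
  (@dense_count l N).
rewrite !ExZ// !Ex_sum//; last by move=> y; exact: discrete_meas_shift.
have mb0 : discrete_meas (fun w : Omega d => (`[< dense_upto l N w >] : nat)).
  exact: (discrete_meas_comp nat_of_bool (discrete_meas_asbool (meas_dense_upto l N))).
under eq_bigr => z _ do
  rewrite (Ex_shift Pinv z mb0) (Ex_prob P (meas_dense_upto l N)).
under [in leRHS]eq_bigr => y _ do rewrite (Ex_shift Pinv y ms).
rewrite !big_const_seq !count_predT !size_boxseq.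
have fs : Ex P s \is a fin_num by rewrite ge0_fin_numE ?Ex_ge0.
have e0 : 0 <= fine (Ex P s) by rewrite fine_ge0 ?Ex_ge0.
rewrite -(fineK fs) -(fineK (fin_num_measure P _ (meas_dense_upto l N))).
move: (fine (Ex P s)) e0 => e e0; move: (fine (P _)) => p.
have it (x : R) k : iter k (+%E x%:E) 0%E = (x *+ k)%:E.
  by elim: k => [//|k IH]; rewrite iterS IH -EFinD mulrS.
rewrite !it -!EFinM !lee_fin -[p *+ _]mulr_natl -[e *+ _]mulr_natl !mulrA => h.
have n0 : 0 < ((2 * N).+1 ^ d)%:R :> R by rewrite ltr0n expn_gt0.
rewrite -(ler_pM2l n0) [X in X <= _]mulrA [X in X * p <= _]mulrC.
apply: le_trans h _; rewrite mulrA ler_wpM2r// -!natrM ler_nat.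
have -> : (4 ^ d = 2 ^ d * 2 ^ d)%N by rewrite -expnMn.
rewrite mulnCA leq_mul2l; apply/orP; right; rewrite mulnC -expnMn.
by case: (posnP d) => [->//|d0]; rewrite leq_exp2r//; lia.
Qed.

(** Where no [K] works, the maximal function exceeds every [l]. Letting [N] grow bounds [l] times
    the probability of this event by a constant, for every [l]. *)
Lemma ae_box_sum : {ae P, forall w, exists K, forall r,
  (box_sum w r <= K * (2 * r).+1 ^ d)%N}.
Proof.
have mQ : measurable [set w : Omega d | exists K, forall r,
    (box_sum w r <= K * (2 * r).+1 ^ d)%N].
  apply: meas_ex => K; apply: meas_all => r.
  exact: (meas_discrete (fun k => is_true (k <= K * (2 * r).+1 ^ d)%N)
    (@discrete_meas_box_sum r)).
apply/(ae_prob0 _ mQ); set Q := [set w | _].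
have QU l : (P Q <= P (\bigcup_N dense_upto l N))%E.
  apply: le_measure; rewrite ?inE; first exact: meas_not.
    by apply: bigcupT_measurable => N; exact: meas_dense_upto.
  move=> w /forallNP/(_ l)/existsNP[r /negP]; rewrite -ltnNge => /ltnW h.
  by exists r => //; exists r.
have hU l : ((l%:R)%:E * P (\bigcup_N dense_upto l N) <= ((4 ^ d)%:R)%:E * Ex P s)%E.
  have cv : (P \o dense_upto l) N @[N --> \oo] --> P (\bigcup_N dense_upto l N).
    apply: nondecreasing_cvg_mu => //; first by move=> N; exact: meas_dense_upto.
      by apply: bigcupT_measurable => N; exact: meas_dense_upto.
    move=> N M NM; apply/subsetPset => w [r [rN h]]; exists r; split=> //.
    exact: leq_trans rN NM.
  have cv2 := cvgeZl (y := (l%:R)%:E) isT cv.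
  rewrite -(cvg_lim _ cv2)//; apply: lime_le; first by apply/cvg_ex; eexists; exact: cv2.
  by apply: nearW => N; exact: P_dense_upto.
have hQ l : ((l%:R)%:E * P Q <= ((4 ^ d)%:R)%:E * Ex P s)%E.
  by apply: le_trans (hU l); rewrite lee_wpmul2l// lee_fin.
have fs : Ex P s \is a fin_num by rewrite ge0_fin_numE ?Ex_ge0.
have e0 : 0 <= fine (Ex P s) by rewrite fine_ge0 ?Ex_ge0.
have fQ : P Q \is a fin_num := fin_num_measure P _ (meas_not mQ).
have p0 : 0 <= fine (P Q) by rewrite fine_ge0.
move: hQ; rewrite -(fineK fs) -(fineK fQ); move: (fine (P Q)) p0 => p p0.
move: (fine (Ex P s)) e0 => e e0 hQ.
have hQ' l : l%:R * p <= (4 ^ d)%:R * e by have := hQ l; rewrite -!EFinM lee_fin.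
congr EFin; apply/eqP; rewrite eq_le p0 andbT leNgt; apply/negP => pp.
have := hQ' (Num.bound ((4 ^ d)%:R * e / p)); rewrite leNgt => /negP; apply.
by rewrite -ltr_pdivrMr//; apply: archi_boundP; rewrite divr_ge0 ?mulr_ge0.
Qed.

End maximal.

(** Dominated convergence: the indicators of [bad M] tend to 0 almost surely. This supplies the
    truncation level in both greedy arguments. *)
Lemma Ex_tail (disp : measure_display) (T : measurableType disp) (R : realType)
    (P : probability T R) (g : T -> nat) (bad : nat -> set T) (e : R) :
  discrete_meas g -> (Ex P g < +oo)%E -> (forall M, measurable (bad M)) ->
  (forall M N w, (M <= N)%N -> bad N w -> bad M w) ->
  {ae P, forall w, exists M, ~ bad M w} -> 0 < e ->
  exists M, (Ex P (fun w => `[< bad M w >] * g w)%N <= e%:E)%E.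
Proof.
move=> mg ig mb nb hb e0.
have mbg M : discrete_meas (fun w => `[< bad M w >] * g w)%N.
  exact: (discrete_meas_comp2 (fun (b : bool) n => b * n)%N
    (discrete_meas_asbool (mb M)) mg).
pose f_ M (w : T) := (((`[< bad M w >] * g w)%N)%:R : R)%:E.
pose gg (w : T) := ((g w)%:R : R)%:E.
have [|||||_ _ cv] := @dominated_convergence _ T R P setT measurableT f_ (cst 0%E) gg.
- by move=> M; exact: Ex_meas1.
- exact: measurable_cst.
- apply: filterS hb => w [M hM] _; apply: cvg_near_cst; exists M => // N /= MN.
  by rewrite /f_ asboolF// => bN; apply: hM; exact: nb MN bN.
- apply/integrableP; split; first exact: Ex_meas1.
  by under eq_integral do rewrite gee0_abs ?lee_fin//.
- apply: aeW => w M _; rewrite /f_ /gg gee0_abs ?lee_fin// ler_nat.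
  by case: (`[< _ >]); rewrite ?mul1n ?mul0n.
rewrite integral0 in cv; apply: contrapT => /forallNP h.
have : (e%:E <= 0)%E.
  rewrite -(cvg_lim _ cv)//; apply: lime_ge; first by apply/cvg_ex; eexists; exact: cv.
  by apply: nearW => M; have /negP := h M; rewrite -ltNge => /ltW.
by rewrite lee_fin leNgt e0.
Qed.

(** * Ergodic bounds along one direction *)

Section greedy.
Variable R : realType.

(* Katznelson-Weiss: jump by n wherever the cost of the next n steps is below
   [g * n], and step by one at bad points and within M of the right end. *)
Lemma greedy_lower (c : nat -> nat -> nat) (bad : nat -> bool) (g : R) (M : nat) :
  0 <= g -> (forall p, c p p = 0%N) ->
  (forall p q r, (c p r <= c p q + c q r)%N) ->
  (forall p, ~~ bad p ->
    exists n, [/\ (0 < n)%N, (n <= M)%N & (c p (p + n)%N)%:R <= g * n%:R]) ->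
  forall p L, (c p (p + L)%N)%:R <= g * L%:R +
    (\sum_(p <= i < p + L) bad i * c i i.+1)%N%:R +
    (\sum_(p <= i < p + L) (p + L <= i + M)%N * c i i.+1)%N%:R.
Proof.
move=> g0 c0 ctri hb p L; move En : L => n; elim/ltn_ind: n p L En => n IH p L En.
case: n IH En => [|n] IH En.
  by rewrite addn0 c0 mulr0 !big_geq// !addr0.
have step : (bad p || (p + n.+1 <= p + M)%N) ->
    (c p (p + n.+1)%N)%:R <= g * n.+1%:R +
    (\sum_(p <= i < p + n.+1) bad i * c i i.+1)%N%:R +
    (\sum_(p <= i < p + n.+1) (p + n.+1 <= i + M)%N * c i i.+1)%N%:R.
  move=> h.
  have IHn := IH n (ltnSn n) p.+1 n erefl; rewrite addSnnS in IHn.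
  rewrite !(@big_ltn _ _ _ p (p + n.+1)) ?addnS ?ltnS ?leq_addr// -addnS.
  have ct : (c p (p + n.+1)%N)%:R <= (c p p.+1)%:R + (c p.+1 (p + n.+1)%N)%:R :> R.
    by rewrite -natrD ler_nat.
  apply: (le_trans ct); rewrite [in leRHS]natrD [in leRHS]natrD.
  have cp : (c p p.+1)%:R <= (bad p * c p p.+1)%N%:R
      + ((p + n.+1 <= p + M)%N * c p p.+1)%N%:R :> R.
    rewrite -natrD ler_nat; case: (bad p) h => /=; first by rewrite mul1n leq_addr.
    by move=> ->; rewrite mul1n leq_addl.
  have : g * n%:R <= g * n.+1%:R by rewrite ler_wpM2l// ler_nat.
  by lra.
case hbp : (bad p); first by apply: step; rewrite hbp.
have [nM|Mn] := leqP n.+1 M; first by apply: step; rewrite leq_add2l nM orbT.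
have [|k [k0 kM hk]] := hb p; first by rewrite hbp.
have kn : (k <= n.+1)%N by lia.
have ltk : (n.+1 - k < n.+1)%N by lia.
have IHk := IH (n.+1 - k)%N ltk (p + k)%N (n.+1 - k)%N erefl.
rewrite -addnA subnKC// in IHk.
have ct : (c p (p + n.+1)%N)%:R <= (c p (p + k)%N)%:R + (c (p + k)%N (p + n.+1)%N)%:R :> R.
  by rewrite -natrD ler_nat.
apply: (le_trans ct).
rewrite !(@big_cat_nat _ _ _ (p + k)%N p (p + n.+1)) ?leq_addr ?leq_add2l//=.
rewrite !natrD.
have e : g * n.+1%:R = g * k%:R + g * (n.+1 - k)%:R by rewrite -mulrDr -natrD subnKC.
have s1 : 0 <= (\sum_(p <= i < p + k) bad i * c i i.+1)%N%:R :> R by [].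
have s2 : 0 <= (\sum_(p <= i < p + k) (p + n.+1 <= i + M)%N * c i i.+1)%N%:R :> R by [].
by rewrite e; lra.
Qed.

(** The same walk with the inequality reversed: every jump collects at least [g] per step, a bad
    point forfeits [g], and the final stretch of length at most [M] forfeits at most [g * M]. *)
Lemma greedy_upper (f : nat -> nat) (bad : nat -> bool) (g : R) (M : nat) :
  0 <= g ->
  (forall p, ~~ bad p -> exists n, [/\ (0 < n)%N, (n <= M)%N &
    g * n%:R <= (\sum_(p <= i < p + n) f i)%N%:R]) ->
  forall p L, g * L%:R <= g * M%:R + 1 * (\sum_(p <= i < p + L) f i)%N%:R +
    g * (\sum_(p <= i < p + L) bad i)%N%:R.
Proof.
move=> g0 hb p L; move En : L => n; elim/ltn_ind: n p L En => n IH p L En.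
case: n IH En => [|n] IH En.
  by rewrite mulr0 !addr_ge0// mulr_ge0.
have [nM|Mn] := leqP n.+1 M.
  have h1 : g * n.+1%:R <= g * M%:R by rewrite ler_wpM2l// ler_nat.
  by rewrite -addrA (le_trans h1)// lerDl addr_ge0// mulr_ge0.
case hbp : (bad p).
  have IHn := IH n (ltnSn n) p.+1 n erefl; rewrite addSnnS in IHn.
  rewrite !(@big_ltn _ _ _ p (p + n.+1)) ?addnS ?ltnS ?leq_addr// -addnS hbp.
  rewrite !natrD -natr1 !mulrDr mulr1 mul1r.
  have : 0 <= (f p)%:R :> R by [].
  by move: IHn; rewrite mul1r; lra.
have [|k [k0 kM hk]] := hb p; first by rewrite hbp.
have kn : (k <= n.+1)%N by lia.
have ltk : (n.+1 - k < n.+1)%N by lia.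
have IHk := IH (n.+1 - k)%N ltk (p + k)%N (n.+1 - k)%N erefl.
rewrite -addnA subnKC// in IHk.
rewrite !(@big_cat_nat _ _ _ (p + k)%N p (p + n.+1)) ?leq_addr ?leq_add2l//=.
rewrite !natrD.
have e : g * n.+1%:R = g * k%:R + g * (n.+1 - k)%:R by rewrite -mulrDr -natrD subnKC.
have s1 : 0 <= g * (\sum_(p <= i < p + k) bad i)%N%:R :> R by rewrite mulr_ge0.
by rewrite e mulrDr [in leRHS]mulrDr; lra.
Qed.

(* This is [limsup b n / n > theta]. *)
Definition slack_above (theta : R) (b : nat -> R) :=
  exists m : nat, forall n0, exists n, (n0 <= n)%N /\
    (theta + m.+1%:R^-1) * n%:R < b n.

Lemma inv_double (m : nat) : (2 * m).+2%:R^-1 = m.+1%:R^-1 / 2 :> R.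
Proof.
have -> : (2 * m).+2 = (m.+1 * 2)%N by lia.
by rewrite natrM invfM.
Qed.

(** Half of the slack [1 / (m + 1)] absorbs the bounded change once [n] is large, hence the index
    [2 m + 1]. With its converse below this makes limsup events invariant under the shift. *)
Lemma slack_above_shift theta b b' (c : R) :
  (forall n, b n.+1 - b' n <= c) -> slack_above theta b -> slack_above theta b'.
Proof.
move=> hc [m hm]; exists (2 * m).+1 => n0.
pose k := Num.bound ((`|c| + `|theta + (2 * m).+2%:R^-1|) * (2 * m.+1%:R)).
have [n [kn hn]] := hm (n0 + k).+1; case: n kn hn => // n kn hn.
exists n; split; first lia.
have := hc n; rewrite inv_double in k kn *; move: hn.
have m0 : 0 < m.+1%:R^-1 :> R by rewrite invr_gt0.
have hk : `|c| + `|theta + m.+1%:R^-1 / 2| < m.+1%:R^-1 / 2 * n.+1%:R.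
  have -> : m.+1%:R^-1 / 2 * n.+1%:R = n.+1%:R / (2 * m.+1%:R) :> R.
    by rewrite invfM; ring.
  rewrite ltr_pdivlMr ?mulr_gt0//.
  have : (`|c| + `|theta + m.+1%:R^-1 / 2|) * (2 * m.+1%:R) < k%:R.
    by apply: archi_boundP; rewrite mulr_ge0 ?addr_ge0 ?mulr_ge0.
  move=> /lt_le_trans; apply; rewrite ler_nat; lia.
have := ler_norm c; have := ler_norm (- (theta + m.+1%:R^-1 / 2)); rewrite normrN.
move: hk; rewrite -(natr1 n); move: (m.+1%:R^-1) m0 (b n.+1) (b' n) => q q0 B B'.
move: (n%:R) `|c| `|_| => N C A; nra.
Qed.

Lemma slack_above_unshift theta b b' (c : R) :
  (forall n, b' n - b n.+1 <= c) -> slack_above theta b' -> slack_above theta b.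
Proof.
move=> hc [m hm]; exists (2 * m).+1 => n0.
pose k := Num.bound ((`|c| + `|theta + (2 * m).+2%:R^-1|) * (2 * m.+1%:R)).
have [n [kn hn]] := hm (n0 + k)%N.
exists n.+1; split; first lia.
have := hc n; rewrite inv_double in k kn *; move: hn.
have m0 : 0 < m.+1%:R^-1 :> R by rewrite invr_gt0.
have hk : `|c| + `|theta + m.+1%:R^-1 / 2| < m.+1%:R^-1 / 2 * n%:R.
  have -> : m.+1%:R^-1 / 2 * n%:R = n%:R / (2 * m.+1%:R) :> R.
    by rewrite invfM; ring.
  rewrite ltr_pdivlMr ?mulr_gt0//.
  have : (`|c| + `|theta + m.+1%:R^-1 / 2|) * (2 * m.+1%:R) < k%:R.
    by apply: archi_boundP; rewrite mulr_ge0 ?addr_ge0 ?mulr_ge0.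
  move=> /lt_le_trans; apply; rewrite ler_nat; lia.
have := ler_norm c; have := ler_norm (theta + m.+1%:R^-1 / 2).
move: hk; rewrite -(natr1 n); move: (m.+1%:R^-1) m0 (b n.+1) (b' n) => q q0 B B'.
move: (n%:R) `|c| `|_| => N C A; nra.
Qed.

End greedy.

Section ergodic_bounds.
Variables (R : realType) (d : nat) (P : probability (Omega d) R) (z : site d).
Hypothesis Pinv : forall (z : site d) (A : set (Omega d)), measurable A ->
  P (@shift_config d z @^-1` A) = P A.
Hypothesis Perg : ergodic P (@shift_config d z).

Lemma ergodic_ae (Q : Omega d -> Prop) : measurable [set w | Q w] ->
  (forall w : Omega d, Q (shift_config z w) <-> Q w) ->
  {ae P, forall w, Q w} \/ {ae P, forall w, ~ Q w}.
Proof.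
move=> mQ hQ; have [||h|h] := Perg (A := [set w | Q w]) => //.
- by apply/seteqP; split=> w; [move/(hQ w).1|move/(hQ w).2].
- right; apply/(ae_prob0 _ (meas_not mQ)); rewrite -[RHS]h; congr (P _).
  by apply/seteqP; split=> w /=; [move/contrapT|move=> Qw; exact].
- by left; apply/(ae_prob1 _ mQ).
Qed.

Definition orbit_sum (f : Omega d -> nat) (w : Omega d) n : nat :=
  (\sum_(0 <= i < n) f (shift_config (z *+ i) w))%N.

Lemma orbit_sumS f w n :
  orbit_sum f w n.+1 = (f w + orbit_sum f (shift_config z w) n)%N.
Proof.
rewrite /orbit_sum big_nat_recl//= mulr0n shift_config0; congr addn.
by apply: eq_bigr => i _; rewrite shift_configD mulrSr.
Qed.

Lemma discrete_meas_orbit_sum f n : discrete_meas f ->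
  discrete_meas (fun w => orbit_sum f w n).
Proof. by move=> mf; apply: discrete_meas_sum => i; exact: discrete_meas_shift. Qed.

Lemma Ex_orbit_sum f n : discrete_meas f ->
  Ex P (fun w => orbit_sum f w n) = (n%:R%:E * Ex P f)%E.
Proof.
move=> mf; rewrite Ex_sum; last by move=> i; exact: discrete_meas_shift.
under eq_bigr => i _ do rewrite (Ex_shift Pinv (z *+ i) mf).
have h0 := Ex_ge0 P f.
elim: n => [|n IH]; first by rewrite big_geq// mul0e.
by rewrite big_nat_recr//= IH -natr1 EFinD ge0_muleDl ?mul1e// lee_fin.
Qed.

Lemma meas_slack_above (I : countType) (b : nat -> Omega d -> I) (k : I -> R) theta :
  (forall n, discrete_meas (b n)) ->
  measurable [set w | slack_above theta (fun n => k (b n w))].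
Proof.
move=> mb; apply: meas_ex => m; apply: meas_all => n0; apply: meas_ex => n.
apply: meas_and; first exact: meas_const.
exact: (meas_discrete (fun i => is_true ((theta + m.+1%:R^-1) * n%:R < k i)) (mb n)).
Qed.

Lemma not_slack_above theta theta' (b : nat -> R) : theta < theta' ->
  ~ slack_above theta b -> exists n0, forall n, (n0 <= n)%N -> b n <= theta' * n%:R.
Proof.
move=> tt /forallNP h.
pose m := Num.bound ((theta' - theta)^-1).
have hm : m.+1%:R^-1 <= theta' - theta.
  rewrite invf_ple ?posrE ?subr_gt0// ?ltr0n//.
  apply: (@le_trans _ _ m%:R); last by rewrite ler_nat.
  by apply/ltW/archi_boundP; rewrite invr_ge0 subr_ge0 ltW.
have /existsNP[n0 /forallNP hn] := h m.
exists n0 => n n0n; have := hn n => /not_andP[//|/negP]; rewrite -leNgt.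
by move=> /le_trans; apply; rewrite ler_wpM2r// -lerBrDl.
Qed.

Lemma linear_contra (e K : R) : 0 < e -> (forall L : nat, e * L%:R <= K) -> False.
Proof.
move=> e0 h; have K0 : 0 <= K by have := h 0%N; rewrite mulr0.
have := h (Num.bound (K / e)); rewrite leNgt => /negP; apply.
by rewrite mulrC -ltr_pdivrMr// archi_boundP// divr_ge0// ltW.
Qed.

(* If the sums exceeded [th * n] infinitely often almost surely, with
   [Ex f < th < g], disjoint windows of average above th would fill almost all of
   the orbit and force [th <= Ex f]. *)
Lemma birkhoff_upper (f : Omega d -> nat) (g : R) : discrete_meas f ->
  (Ex P f < g%:E)%E ->
  {ae P, forall w, exists n0, forall n, (n0 <= n)%N ->
    (orbit_sum f w n)%:R <= g * n%:R}.
Proof.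
move=> mf fg.
have ff : Ex P f \is a fin_num by rewrite ge0_fin_numE ?Ex_ge0// (lt_trans fg) ?ltry.
move E : (fine (Ex P f)) => e; have eE : Ex P f = e%:E by rewrite -E fineK.
have e0 : 0 <= e by rewrite -E fine_ge0 ?Ex_ge0.
have eg : e < g by rewrite -lte_fin -eE.
pose th := (e + g) / 2.
have th0 : 0 < th by rewrite /th; lra.
have thg : th < g by rewrite /th; lra.
pose Q (w : Omega d) := slack_above th (fun n => (orbit_sum f w n)%:R).
have mS n := discrete_meas_orbit_sum n mf.
have mQ : measurable [set w | Q w].
  exact: (@meas_slack_above _ (fun n w => orbit_sum f w n) (fun k => k%:R)).
have iQ (w : Omega d) : Q (shift_config z w) <-> Q w.
  split; [apply: (@slack_above_unshift _ _ _ _ 0)|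
    apply: (@slack_above_shift _ _ _ _ (f w)%:R)] => n.
    by rewrite orbit_sumS subr_le0 ler_nat leq_addl.
  by rewrite orbit_sumS natrD addrK.
have [aeQ|aeN] := ergodic_ae mQ iQ; last first.
  by apply: filterS aeN => w /(not_slack_above thg).
exfalso.
pose bad M : set (Omega d) := [set w | forall n, (0 < n)%N -> (n <= M)%N ->
  (orbit_sum f w n)%:R < th * n%:R].
have mbad M : measurable (bad M).
  apply: meas_all => n; do 2 (apply: meas_imp; first exact: meas_const).
  exact: (meas_discrete (fun k => is_true (k%:R < th * n%:R)) (mS n)).
(* At this level bad points forfeit at most [(th - e) / 2] per step on average, and integrating the
   greedy bound leaves [(th - e) / 2 * L <= th * M] for every [L]. *)
have [M hM] : exists M, (Ex P (fun w => `[< bad M w >] * 1)%N <= ((th - e) / (2 * th))%:E)%E.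
  apply: Ex_tail => //.
  - exact: discrete_meas_cst.
  - by rewrite /Ex integral_cst//= probability_setT mule1 ltry.
  - by move=> M N w MN h n n0 nM; apply: h => //; exact: leq_trans MN.
  - apply: filterS aeQ => w [m /(_ 1%N)[n [n1 hn]]]; exists n => /(_ n n1 (leqnn n)).
    apply/negP; rewrite -leNgt; apply: le_trans (ltW hn).
    by rewrite ler_wpM2r// lerDl invr_ge0.
  - by rewrite divr_gt0 ?subr_gt0 ?mulr_gt0// /th; lra.
pose bb (w : Omega d) := (`[< bad M w >] * 1)%N.
have mbb : discrete_meas bb.
  exact: (discrete_meas_comp (fun b : bool => (b * 1)%N) (discrete_meas_asbool (mbad M))).
apply: (@linear_contra ((th - e) / 2) (th * M%:R)); first by rewrite /th; lra.
move=> L.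
have hw (w : Omega d) : th * L%:R + 0 * 0%N%:R <=
    th * M%:R + 1 * (orbit_sum f w L)%:R + th * (orbit_sum bb w L)%:R.
  rewrite mul0r addr0; have := @greedy_upper R (fun i => f (shift_config (z *+ i) w))
    (fun i => `[< bad M (shift_config (z *+ i) w) >]) th M (ltW th0) _ 0 L.
  rewrite add0n /orbit_sum; under [in X in _ -> _ <= _ + _ * X%:R]eq_bigr do rewrite /bb muln1.
  apply => p /asboolPn/existsNP[n /not_implyP[n0 /not_implyP[nM /negP]]].
  rewrite -leNgt => h; exists n; split=> //; apply: (le_trans h).
  have -> : (\sum_(p <= i < p + n) f (shift_config (z *+ i) w) =
      \sum_(0 <= i < n) f (shift_config (z *+ (i + p)) w))%N.
    by rewrite -{1}[p]add0n big_addn addKn.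
  rewrite ler_nat /orbit_sum.
  by apply: leq_sum => i _; rewrite shift_configD -mulrnDr.
have := Ex_le_affine (P := P) (discrete_meas_cst 0%N) (mS L) (discrete_meas_orbit_sum L mbb)
  (mulr_ge0 (ltW th0) (ler0n _ L)) (lexx 0) (mulr_ge0 (ltW th0) (ler0n _ M)) ler01 (ltW th0)
  (aeW P hw).
rewrite mul0e adde0 !Ex_orbit_sum// eE mul1e.
have fb : Ex P bb \is a fin_num by rewrite ge0_fin_numE ?Ex_ge0// (le_lt_trans hM) ?ltry.
have := hM; rewrite -/bb -(fineK fb) lee_fin; move: (fine _) => q hq.
rewrite -!EFinM -!EFinD lee_fin => h.
have h2 : th * (L%:R * q) <= L%:R * ((th - e) / 2).
  have t20 : 0 < 2 * th by lra.
  have hq2 := hq; rewrite ler_pdivlMr in hq2; last exact: t20.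
  by rewrite mulrCA ler_wpM2l//; lra.
by move: h h2; move: (L%:R) => l; lra.
Qed.

End ergodic_bounds.

Section kingman.
Variables (R : realType) (d : nat) (P : probability (Omega d) R) (z : site d).
Hypothesis Pinv : forall (z : site d) (A : set (Omega d)), measurable A ->
  P (@shift_config d z @^-1` A) = P A.
Hypothesis Perg : ergodic P (@shift_config d z).
Variable tau : Omega d -> site d -> site d -> nat.
Hypothesis tau_refl : forall w x, tau w x x = 0%N.
Hypothesis tau_sym : forall w x y, tau w x y = tau w y x.
Hypothesis tau_tri : forall w x y u, (tau w x u <= tau w x y + tau w y u)%N.
Hypothesis tau_shift : forall (w : Omega d) x y u,
  tau (shift_config u w) x y = tau w (x + u) (y + u).
Hypothesis tau_meas : forall x y, discrete_meas (fun w => tau w x y).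
Hypothesis tau_int : (Ex P (fun w => tau w 0 z) < +oo)%E.

(** Otherwise, by ergodicity, the lower limit of [tau w 0 (z *+ n) / n] is almost surely below some
    [th < mu]. Then cheap jumps of average cost at most [th] start from most points of the orbit,
    and chaining them greedily makes the mean of [tau w 0 (z *+ L)] too small for large [L]. *)
Lemma kingman_lower (mu g : R) : g < mu ->
  (forall L : nat, ((mu * L%:R)%:E <= Ex P (fun w => tau w 0%R (z *+ L)%R))%E) ->
  {ae P, forall w, exists n0, forall n, (n0 <= n)%N ->
    g * n%:R <= (tau w 0 (z *+ n))%:R}.
Proof.
move=> gmu hmu.
have [g0|g0] := ltP g 0.
  by apply: aeW => w; exists 0%N => n _; apply: (@le_trans _ _ 0); rewrite // mulr_le0_ge0// ltW.
pose th := (g + mu) / 2.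
have th0 : 0 <= th by rewrite /th; lra.
have gth : g < th by rewrite /th; lra.
have thmu : th < mu by rewrite /th; lra.
pose X (w : Omega d) n := tau w 0 (z *+ n).
have XT (w : Omega d) p n : X (shift_config (z *+ p) w) n = tau w (z *+ p) (z *+ (p + n)).
  by rewrite /X tau_shift add0r -mulrnDr addnC.
(* A lower limit below [th], written as an upper limit above [- th]. *)
pose Q (w : Omega d) := slack_above (- th) (fun n => - (X w n)%:R).
have mX n : discrete_meas (X^~ n) by exact: tau_meas.
have mQ : measurable [set w | Q w].
  exact: (@meas_slack_above R d _ (fun n w => X w n) (fun k => - k%:R)).
have XS (w : Omega d) n : X (shift_config z w) n = tau w z (z *+ n.+1).
  by have := XT w 1%N n; rewrite mulr1n add1n.
have iQ (w : Omega d) : Q (shift_config z w) <-> Q w.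
  split; [apply: (@slack_above_unshift _ _ _ _ (tau w 0 z)%:R)|
    apply: (@slack_above_shift _ _ _ _ (tau w 0 z)%:R)] => n; rewrite XS /X.
    by rewrite opprK addrC lerBlDr -natrD ler_nat tau_tri.
  by rewrite opprK addrC lerBlDr -natrD ler_nat (tau_sym w 0 z) tau_tri.
have [aeQ|aeN] := ergodic_ae Perg mQ iQ; last first.
  apply: filterS aeN => w; rewrite -ltrN2 in gth; move/(not_slack_above gth) => [n0 h].
  by exists n0 => n /h; rewrite mulNr lerN2.
exfalso.
pose bad M : set (Omega d) := [set w | forall n, (0 < n)%N -> (n <= M)%N ->
  th * n%:R < (X w n)%:R].
have mbad M : measurable (bad M).
  apply: meas_all => n; do 2 (apply: meas_imp; first exact: meas_const).
  exact: (meas_discrete (fun k => is_true (th * n%:R < k%:R)) (mX n)).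
pose X1 (w : Omega d) := tau w 0 z.
have mX1 : discrete_meas X1 by exact: tau_meas.
(* Bad points are crossed by unit steps of cost [X1]. Spending at most half of the gap on them
   leaves [(mu - th) / 2 * L <= M * e] for every [L]. *)
have [M hM] : exists M, (Ex P (fun w => `[< bad M w >] * X1 w)%N <= ((mu - th) / 2)%:E)%E.
  apply: Ex_tail => //.
  - by move=> M N w MN h n n0 nM; apply: h => //; exact: leq_trans MN.
  - apply: filterS aeQ => w [m /(_ 1%N)[n [n1 hn]]]; exists n => /(_ n n1 (leqnn n)).
    apply/negP; rewrite -leNgt -lerN2; apply: le_trans (ltW hn).
    by rewrite -mulNr ler_wpM2r// lerDl invr_ge0.
  - by rewrite divr_gt0 ?subr_gt0.
pose bX (w : Omega d) := (`[< bad M w >] * X1 w)%N.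
have mbX : discrete_meas bX.
  exact: (discrete_meas_comp2 (fun (b : bool) n => (b * n)%N)
    (discrete_meas_asbool (mbad M)) mX1).
pose tl L (w : Omega d) := (\sum_(0 <= i < L) (L <= i + M)%N * X1 (shift_config (z *+ i) w))%N.
have mtl0 L i : discrete_meas (fun w : Omega d => ((L <= i + M)%N * X1 (shift_config (z *+ i) w))%N).
  exact: (discrete_meas_comp (muln (L <= i + M)%N) (discrete_meas_shift _ mX1)).
have mtl L : discrete_meas (tl L) by apply: discrete_meas_sum => i; exact: mtl0.
have f1 : Ex P X1 \is a fin_num by rewrite ge0_fin_numE ?Ex_ge0.
move E : (fine (Ex P X1)) => e; have eE : Ex P X1 = e%:E by rewrite -E fineK.
have e0 : 0 <= e by rewrite -E fine_ge0 ?Ex_ge0.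
(* At most [M] indices lie within [M] of the end, and each costs [e] on average. *)
have Etl L : (Ex P (tl L) <= (M%:R * e)%:E)%E.
  rewrite Ex_sum//.
  under eq_bigr => i _ do
    rewrite (ExZ P (L <= i + M)%N (discrete_meas_shift (z *+ i) mX1)) (Ex_shift Pinv _ mX1) eE -EFinM.
  rewrite sumEFin lee_fin -mulr_suml -natr_sum ler_wpM2r// ler_nat.
  have [LM|ML] := leqP L M.
    apply: leq_trans LM; rewrite -[leqRHS](subn0 L) -[leqRHS]muln1 -sum_nat_const_nat.
    by apply: leq_sum => i _; exact: leq_b1.
  rewrite (@big_cat_nat _ _ _ (L - M)%N)//= ?leq_subr//.
  rewrite big_nat_cond big1 ?add0n; last first.
    by move=> i /andP[/andP[_ iL] _]; rewrite leqNgt addnC -ltn_subRL iL.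
  apply: (@leq_trans ((L - (L - M)) * 1)); last by rewrite muln1 subKn// ltnW.
  rewrite -sum_nat_const_nat; by apply: leq_sum => i _; exact: leq_b1.
apply: (@linear_contra R ((mu - th) / 2) (M%:R * e)); first by rewrite divr_gt0 ?subr_gt0.
move=> L.
have hw (w : Omega d) : 0 + 1 * (X w L)%:R <=
    th * L%:R + 1 * (orbit_sum z bX w L)%:R + 1 * (tl L w)%:R.
  have e1 : (\sum_(0 <= i < L) `[< bad M (shift_config (z *+ i) w) >]
      * tau w (z *+ i) (z *+ i.+1) = orbit_sum z bX w L)%N.
    by apply: eq_bigr => i _; rewrite /bX /X1 tau_shift add0r -mulrS.
  have e2 : (\sum_(0 <= i < L) (L <= i + M) * tau w (z *+ i) (z *+ i.+1) = tl L w)%N.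
    by apply: eq_bigr => i _; rewrite /X1 tau_shift add0r -mulrS.
  rewrite add0r !mul1r -e1 -e2.
  apply: (@greedy_lower R (fun p q => tau w (z *+ p) (z *+ q))
    (fun i => `[< bad M (shift_config (z *+ i) w) >]) th M th0 _ _ _ 0 L) => //.
  move=> p /asboolPn/existsNP[n /not_implyP[n0 /not_implyP[nM /negP]]].
  by rewrite -leNgt XT => h; exists n; split.
have := Ex_le_affine (P := P) (mX L) (discrete_meas_orbit_sum z L mbX) (mtl L)
  (lexx 0) ler01 (mulr_ge0 th0 (ler0n _ L)) ler01 ler01 (aeW P hw).
rewrite add0e !mul1e Ex_orbit_sum// => h.
have fb : Ex P bX \is a fin_num by rewrite ge0_fin_numE ?Ex_ge0// (le_lt_trans hM) ?ltry.
have := le_trans (hmu L) (le_trans h (leeD (lexx _) (Etl L))).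
have := hM; rewrite -/bX -(fineK fb) lee_fin; move: (fine _) => q hq.
rewrite -!EFinM -!EFinD lee_fin.
have : 0 <= L%:R :> R by [].
by move: (L%:R) => l l0; nra.
Qed.

End kingman.

(** * The limit shape *)

Lemma eventually_all_seq (I : eqType) (s : seq I) (Q : I -> nat -> Prop) :
  (forall i, i \in s -> exists n0, forall n, (n0 <= n)%N -> Q i n) ->
  exists n0, forall n, (n0 <= n)%N -> forall i, i \in s -> Q i n.
Proof.
elim: s => [|i s IH] H; first by exists 0%N.
have [n1 h1] := H i (mem_head _ _).
have [|n2 h2] := IH; first by move=> j js; apply: H; rewrite inE js orbT.
exists (n1 + n2)%N => n nn j; rewrite inE => /orP[/eqP->|js].
  by apply: h1; lia.
by apply: h2 => //; lia.
Qed.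

Section lattice_points.
Variables (R : realType) (d : nat).
Hypothesis d_gt0 : (0 < d)%N.
Implicit Types (x : site d) (u v : 'rV[R]_d).

Definition site_row x : 'rV[R]_d := map_mx intr x.
Definition row_floor v : site d := map_mx Num.floor v.

Lemma site_rowK x : row_floor (site_row x) = x.
Proof. by apply/rowP => i; rewrite !mxE intrKfloor. Qed.

Lemma row_norm_ge v i : `|v ord0 i| <= `|v|.
Proof. by rewrite [leRHS]/Num.norm /= mx_normrE; apply/bigmax_geP; right => /=; exists (ord0, i). Qed.

Lemma row_norm_le v (M : R) : 0 <= M -> (forall i, `|v ord0 i| <= M) -> `|v| <= M.
Proof.
move=> M0 hM; rewrite [leLHS]/Num.norm /= mx_normrE; apply/bigmax_leP; split=> // -[i j] _ /=.
by rewrite (ord1 i).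
Qed.

Lemma normoo_real x (M : R) : (forall i, `|(x ord0 i)%:~R : R| <= M) -> (normoo x)%:R <= M.
Proof.
move=> hM; have [|i e] := @bigop.eq_bigmax 'I_d (fun i => `|x ord0 i|%N).
  by rewrite card_ord.
by have := hM i; rewrite -intr_norm -abszE /normoo e.
Qed.

Lemma norm_site_row x : `|site_row x| = (normoo x)%:R.
Proof.
apply/eqP; rewrite eq_le; apply/andP; split.
  apply: row_norm_le => // i; rewrite mxE -intr_norm -abszE ler_nat.
  exact: normoo_ge.
by apply: normoo_real => i; have := row_norm_ge (site_row x) i; rewrite mxE.
Qed.

Lemma floor_itvD (a : R) : (Num.floor a)%:~R <= a < (Num.floor a)%:~R + 1.
Proof. by have := floor_itv a; rewrite intrD. Qed.

Lemma normoo_row_floorB u v : (normoo (row_floor u - row_floor v))%:R <= `|u - v| + 1.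
Proof.
apply: normoo_real => i; have := row_norm_ge (u - v) i; rewrite !mxE intrB.
have := floor_itvD (u ord0 i); have := floor_itvD (v ord0 i).
move: ((Num.floor (u ord0 i))%:~R : R) ((Num.floor (v ord0 i))%:~R : R) => a b.
by move: (u ord0 i) (v ord0 i) `|u - v| => c e N; rewrite !ler_norml; lra.
Qed.

Lemma normoo_row_floorD u v : (normoo (row_floor (u + v) - (row_floor u + row_floor v)))%:R <= 2 :> R.
Proof.
apply: normoo_real => i; rewrite !mxE !(intrB, intrD).
have := floor_itvD (u ord0 i); have := floor_itvD (v ord0 i).
have := floor_itvD (u ord0 i + v ord0 i).
move: ((Num.floor (u ord0 i))%:~R : R) ((Num.floor (v ord0 i))%:~R : R)
  ((Num.floor (u ord0 i + v ord0 i))%:~R : R) => p q r.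
by move: (u ord0 i) (v ord0 i) => x y; rewrite !ler_norml; lra.
Qed.

Lemma norm_le_row_floor v : `|v| <= (normoo (row_floor v))%:R + 1.
Proof.
apply: row_norm_le; first by rewrite addr_ge0.
move=> i; have := row_norm_ge (site_row (row_floor v)) i; rewrite norm_site_row !mxE.
have := floor_itvD (v ord0 i).
move: ((Num.floor (v ord0 i))%:~R : R) => a; move: (v ord0 i) (normoo _) => c N.
by rewrite !ler_norml; lra.
Qed.

Lemma row_floor_inj_near u v : row_floor u = row_floor v -> `|u - v| <= 1.
Proof.
move=> e; apply: row_norm_le => // i; have /rowP/(_ i) := e; rewrite !mxE => ei.
have := floor_itvD (u ord0 i); have := floor_itvD (v ord0 i); rewrite ei.
move: ((Num.floor (v ord0 i))%:~R : R) => a; move: (u ord0 i) (v ord0 i) => c b.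
by rewrite !ler_norml; lra.
Qed.

End lattice_points.

Section limit_shape.
Variables (R : realType) (d : nat).
Hypothesis d_gt0 : (0 < d)%N.
Variables (h : site d -> R) (C : R).
Hypothesis h_ge0 : forall x, 0 <= h x.
Hypothesis hD : forall x y, h (x + y) <= h x + h y.
Hypothesis hMn : forall x n, h (x *+ n) <= n%:R * h x.
Hypothesis C_ge0 : 0 <= C.
Hypothesis h_lip : forall x y, h x <= h y + C * (normoo (x - y))%:R.
Hypothesis h_ge : forall x, (normoo x)%:R <= h x + 2 * C.

(* The unit ball of the norm [lim h (floor (s v)) / s], written so that neither
   the existence of the limit nor its homogeneity is needed. *)
Definition limit_shape : set 'rV[R]_d :=
  [set v | forall e : R, 0 < e -> exists n0 : nat, forall s : R, n0%:R <= s ->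
     h (row_floor (s *: v)) <= (1 + e) * s].

Lemma h_row_floor_lip (u v : 'rV[R]_d) : h (row_floor u) <= h (row_floor v) + C * (`|u - v| + 1).
Proof.
apply: (le_trans (h_lip _ (row_floor v))); rewrite lerD2l ler_wpM2l//.
exact: normoo_row_floorB.
Qed.

Lemma exists_nat_ge (x : R) : exists n : nat, x <= n%:R.
Proof.
exists (Num.bound `|x|); apply: le_trans (ler_norm x) _.
by apply/ltW/archi_boundP.
Qed.

(** With [e = 1], the linear lower bound on [h] gives [s |v| <= 2 s + 2 C + 1] for all large [s]. *)
Lemma limit_shape_bounded v : limit_shape v -> `|v| <= 2.
Proof.
move=> Dv; rewrite leNgt; apply/negP => v2.
have e0 : 0 < (`|v| - 2) / 2 by rewrite divr_gt0 ?subr_gt0.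
have [n0 hn0] := Dv 1 ltr01.
have [n1 hn1] := exists_nat_ge ((2 * C + 2) / (`|v| - 2)).
pose s : R := (n0 + n1)%:R.
have s0 : 0 <= s by [].
have hs : h (row_floor (s *: v)) <= (1 + 1) * s by apply: hn0; rewrite ler_nat leq_addr.
have := norm_le_row_floor d_gt0 (s *: v); rewrite normrZ ger0_norm// => h1.
have h2 := h_ge (row_floor (s *: v)).
have : (2 * C + 2) <= s * (`|v| - 2).
  rewrite -ler_pdivrMr ?subr_gt0//; apply: (le_trans hn1).
  by rewrite ler_nat leq_addl.
move: hs h1 h2; move: (h _) (normoo _)%:R `|v| => H N V; nra.
Qed.

Lemma limit_shape_closed : closed limit_shape.
Proof.
move=> v cv e e0.
(* [C + 1] instead of [C], which may vanish. A quarter of [e] pays for the distance to [v'], another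
   for rounding. *)
have r0 : 0 < e / (4 * (C + 1)) by rewrite divr_gt0// mulr_gt0// ltr_wpDl.
have [v' [Dv' bv']] := cv _ (nbhsx_ballx v (PosNum r0)%:num (gt0 (PosNum r0))).
rewrite -ball_normE /= in bv'.
have e20 : 0 < e / 2 by rewrite divr_gt0.
have [n0 hn0] := Dv' _ e20; have [n1 hn1] := exists_nat_ge (4 * C / e).
exists (n0 + n1)%N => s ss.
have s0 : 0 <= s by apply: le_trans ss.
have hs : h (row_floor (s *: v')) <= (1 + e / 2) * s.
  by apply: hn0; apply: le_trans ss; rewrite ler_nat leq_addr.
apply: (le_trans (h_row_floor_lip _ (s *: v'))).
rewrite -scalerBr normrZ ger0_norm//.
have h1 : 4 * C <= e * s.
  rewrite [leRHS]mulrC -ler_pdivrMr//; apply: (le_trans hn1); apply: le_trans ss.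
  by rewrite ler_nat leq_addl.
have h2 : C * `|v - v'| <= e / 4.
  apply: (@le_trans _ _ ((C + 1) * (e / (4 * (C + 1))))).
    by apply: ler_pM => //; [rewrite lerDl|exact: ltW].
  rewrite le_eqVlt; apply/orP; left; apply/eqP; field.
  by rewrite gt_eqF// ltr_wpDl.
have h3 : C * `|v - v'| * s <= e / 4 * s by rewrite ler_wpM2r.
move: hs h3; move: (h _) `|v - v'| => H N; lra.
Qed.

Lemma limit_shape_compact : compact limit_shape.
Proof.
apply: bounded_closed_compact; last exact: limit_shape_closed.
exists 2; split; first exact: num_real.
move=> M M2 v Dv /=; exact: le_trans (limit_shape_bounded Dv) (ltW M2).
Qed.

(** Split [s] into [s a] and [s (1 - a)], both large with [s], and use subadditivity; rounding a sum
    differs from summing the rounded points by at most 2 per coordinate. *)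
Lemma limit_shape_convex : convex_set limit_shape.
Proof.
apply/convex_setW => u v; rewrite !inE => Du Dv k k0 k1 /=.
rewrite /conv/= inE /unstable.onem => e e0.
set a := k%:num in k0 k1 *; have b0 : 0 < 1 - a by rewrite subr_gt0.
have e20 : 0 < e / 2 by rewrite divr_gt0.
have [n0 hn0] := Du _ e20; have [n1 hn1] := Dv _ e20.
have [m0 hm0] := exists_nat_ge (n0%:R / a).
have [m1 hm1] := exists_nat_ge (n1%:R / (1 - a)).
have [m2 hm2] := exists_nat_ge (2 * C / (e / 2)).
exists (m0 + m1 + m2)%N => s ss.
have sm (m : nat) : (m <= m0 + m1 + m2)%N -> m%:R <= s.
  by move=> mm; apply: le_trans ss; rewrite ler_nat.
have l0 : (m0 <= m0 + m1 + m2)%N by rewrite -addnA leq_addr.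
have l1 : (m1 <= m0 + m1 + m2)%N by rewrite addnAC leq_addl.
have l2 : (m2 <= m0 + m1 + m2)%N by rewrite leq_addl.
have su : h (row_floor ((s * a) *: u)) <= (1 + e / 2) * (s * a).
  by apply: hn0; rewrite -ler_pdivrMr//; exact: le_trans hm0 (sm _ l0).
have sv : h (row_floor ((s * (1 - a)) *: v)) <= (1 + e / 2) * (s * (1 - a)).
  by apply: hn1; rewrite -ler_pdivrMr//; exact: le_trans hm1 (sm _ l1).
have sC : 2 * C <= s * (e / 2).
  by rewrite -ler_pdivrMr//; exact: le_trans hm2 (sm _ l2).
set U := (s * a) *: u in su; set V := (s * (1 - a)) *: v in sv.
have -> : s *: (a *: u + (1 - a) *: v) = U + V by rewrite scalerDr !scalerA.
have near : (normoo (row_floor (U + V) - (row_floor U + row_floor V)))%:R <= 2 :> R.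
  exact: normoo_row_floorD.
have h1 := h_lip (row_floor (U + V)) (row_floor U + row_floor V).
have h2 := hD (row_floor U) (row_floor V).
have h3 : C * (normoo (row_floor (U + V) - (row_floor U + row_floor V)))%:R <= C * 2 by rewrite ler_wpM2l.
move: su sv h1 h2 h3.
move: (h (row_floor (U + V))) (h (row_floor U + row_floor V)) (h (row_floor U)) (h (row_floor V)) (C * (normoo _)%:R).
move=> A1 A2 A3 A4 A5 su sv h1 h2 h3.
have -> : (1 + e) * s =
  (1 + e / 2) * (s * a) + (1 + e / 2) * (s * (1 - a)) + s * (e / 2) by field.
lra.
Qed.

(** In the definition the threshold depends on [v]. The bounded shape meets finitely many cells of
    side [1 / q], the fibres of [row_floor (q *: v)]; one representative per cell gives a common
    threshold, and the Lipschitz bound carries it to the whole cell. *)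
Lemma limit_shape_uniform (e : R) : 0 < e -> exists n0 : nat, forall (s : R) v,
  n0%:R <= s -> limit_shape v -> h (row_floor (s *: v)) <= (1 + e) * s.
Proof.
move=> e0; have e20 : 0 < e / 2 by rewrite divr_gt0.
have e40 : 0 < e / 4 by rewrite divr_gt0.
have [q0 hq0] := exists_nat_ge (C / (e / 4)); pose q := q0.+1.
have q_gt0 : 0 < q%:R :> R by rewrite ltr0n.
have hq : C / q%:R <= e / 4.
  rewrite ler_pdivrMr// mulrC -ler_pdivrMr//; apply: (le_trans hq0).
  by rewrite ler_nat leqnSn.
pose cell (g : site d) v := limit_shape v /\ row_floor (q%:R *: v) = g.
have cells g : g \in boxseq (0 : site d) (2 * q).+1 -> exists n0, forall n, (n0 <= n)%N ->
    (exists v, cell g v) -> forall s : R, n%:R <= s ->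
    exists v, cell g v /\ h (row_floor (s *: v)) <= (1 + e / 2) * s.
  move=> _; have [[v1 [Dv1 fv1]]|nc] := pselect (exists v, cell g v); last first.
    by exists 0%N => n _ /nc.
  have [n2 hn2] := Dv1 _ e20; exists n2 => n nn _ s1 ns1; exists v1; split=> //.
  by apply: hn2; apply: le_trans ns1; rewrite ler_nat.
have [n0 hn0] := eventually_all_seq cells; have [n1 hn1] := exists_nat_ge (C / (e / 4)).
exists (n0 + n1)%N => s v ss Dv.
have s0 : 0 <= s by apply: le_trans ss.
have vg : row_floor (q%:R *: v) \in boxseq 0 (2 * q).+1.
  rewrite mem_boxseq sub0r normooN -(ler_nat R).
  have := normoo_row_floorB d_gt0 (q%:R *: v) 0; rewrite subr0.
  have -> : row_floor (0 : 'rV[R]_d) = 0 by apply/rowP => i; rewrite !mxE floor0.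
  rewrite subr0 normrZ ger0_norm// => /le_trans; apply.
  by rewrite -natr1 lerD2r natrM mulrC ler_wpM2r// limit_shape_bounded.
have n0s : n0%:R <= s by apply: le_trans ss; rewrite ler_nat leq_addr.
have [v' [[Dv' fv'] hv']] := hn0 n0 (leqnn n0) _ vg (ex_intro _ v (conj Dv erefl)) s n0s.
apply: (le_trans (h_row_floor_lip _ (s *: v'))).
have nv : `|v - v'| <= q%:R^-1.
  have := row_floor_inj_near (esym fv'); rewrite -scalerBr normrZ ger0_norm// => hv.
  by rewrite -[leRHS]mul1r ler_pdivlMr// mulrC.
rewrite -scalerBr normrZ ger0_norm//.
have hC : C <= e / 4 * s.
  rewrite [leRHS]mulrC -ler_pdivrMr//; apply: (le_trans hn1); apply: le_trans ss.
  by rewrite ler_nat leq_addl.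
have h1 : C * (s * `|v - v'|) <= e / 4 * s.
  apply: (@le_trans _ _ (C / q%:R * s)); last by rewrite ler_wpM2r.
  by rewrite -mulrA ler_wpM2l// mulrC ler_wpM2r.
move: hv' hC h1; move: (h _) (s * `|v - v'|) => H N; lra.
Qed.

(** For [k] the integer part of [s / r], the point [(s / r) x] is within [normoo x] of the multiple
    [k x], and [h (k x) <= k (h x) <= k r <= s]. *)
Lemma limit_shape_scaled x (r : R) : 0 < r -> h x <= r -> limit_shape (r^-1 *: site_row R x).
Proof.
move=> r0 hx e e0.
pose K := C * ((normoo x)%:R + 1).
have [n0 hn0] := exists_nat_ge (K / e).
exists n0 => s ns; have s0 : 0 <= s by apply: le_trans ns.
pose k := Num.truncn (s / r).
have sr0 : 0 <= s / r by rewrite divr_ge0// ltW.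
have /andP[k1 k2] := truncn_itv sr0; rewrite -/k in k1 k2.
have fk : row_floor (site_row R (x *+ k)) = x *+ k by exact: site_rowK.
have ek : site_row R (x *+ k) = k%:R *: site_row R x.
  by apply/rowP => i; rewrite -scaler_nat !mxE intrM natz.
have nk : `|s *: (r^-1 *: site_row R x) - site_row R (x *+ k)| <= (normoo x)%:R.
  rewrite ek scalerA -scalerBl normrZ (norm_site_row R d_gt0 x) -[leRHS]mul1r ler_wpM2r//.
  by move: k1 k2; rewrite -natr1 ler_norml; move: (s / r) (k%:R) => p1 p2; lra.
have h1 := h_row_floor_lip (s *: (r^-1 *: site_row R x)) (site_row R (x *+ k)).
rewrite fk in h1.
have h2 : C * (`|s *: (r^-1 *: site_row R x) - site_row R (x *+ k)| + 1) <= K.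
  by rewrite ler_wpM2l// lerD2r.
have h3 : K <= e * s.
  by rewrite mulrC -ler_pdivrMr//; exact: le_trans hn0 ns.
have h4 := hMn x k.
have h5 : k%:R * h x <= s.
  apply: (@le_trans _ _ (k%:R * r)); first by rewrite ler_wpM2l.
  by rewrite -ler_pdivlMr.
lra.
Qed.

End limit_shape.

(** The outer inclusion is asked only for [normoo x <= r], where uniform convergence applies; in the
    cluster this holds by itself, since a path of length at most [r] stays in that box. *)
Definition shape_from (R : realType) d (D : set 'rV[R]_d) (eps : R)
    (tau0 : site d -> nat) (n : nat) :=
  forall x (r : R), n%:R <= r ->
  (lattice_dilate ((1 - eps) * r) D x -> (tau0 x)%:R <= r) /\
  ((tau0 x)%:R <= r -> (normoo x)%:R <= r -> lattice_dilate ((1 + eps) * r) D x).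

Section shape_event.
Variables (R : realType) (d : nat).
Hypothesis d_gt0 : (0 < d)%N.
Variables (h : site d -> R) (C : R).
Hypothesis hMn : forall x n, h (x *+ n) <= n%:R * h x.
Hypothesis C_ge0 : 0 <= C.
Hypothesis h_lip : forall x y, h x <= h y + C * (normoo (x - y))%:R.
Hypothesis h_ge : forall x, (normoo x)%:R <= h x + 2 * C.
Variable eps : R.
Hypothesis eps01 : 0 < eps < 1.


(** Convergence is used at an integer radius [M] with [2 r < M <= 3 r], because points of the shape
    have norm at most 2. The error [eps / 6 * M] is then at most [eps / 2 * r], which fits since
    [(1 + eps / 4) (1 - eps) <= 1 - eps / 2]. *)
Lemma shape_from_uniform (tau0 : site d -> nat) :
  (forall e : R, 0 < e -> exists r0 : nat, forall r : nat, (r0 <= r)%N ->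
    forall x, (normoo x <= r)%N -> `|(tau0 x)%:R - h x| <= e * r%:R) ->
  exists n, shape_from (limit_shape h) eps tau0 n.
Proof.
move=> unif; have /andP[e0 e1] := eps01.
have e60 : 0 < eps / 6 by rewrite divr_gt0.
have e40 : 0 < eps / 4 by rewrite divr_gt0.
have [r0 hr0] := unif _ e60.
have [nD hD] := limit_shape_uniform d_gt0 C_ge0 h_lip h_ge e40.
have [n1 hn1] := exists_nat_ge (nD%:R / (1 - eps)).
exists (r0 + n1 + 1)%N => x r nr.
have rr0 : r0%:R <= r by apply: le_trans nr; rewrite ler_nat -addnA leq_addr.
have rn1 : n1%:R <= r.
  by apply: le_trans nr; rewrite ler_nat addnAC leq_addl.
have r1 : 1 <= r by apply: le_trans nr; rewrite natrD lerDr.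
have r_gt0 : 0 < r by apply: lt_le_trans r1.
pose M := (Num.truncn (2 * r)).+1.
have r20 : 0 <= 2 * r by rewrite mulr_ge0// ltW.
have /andP[M1 M2] := truncn_itv r20; rewrite -/M in M2.
have M3 : M%:R <= 3 * r by rewrite /M -natr1; lra.
have r0M : (r0 <= M)%N by rewrite -(ler_nat R); lra.
have hM : eps / 6 * M%:R <= eps / 2 * r.
  apply: (@le_trans _ _ (eps / 6 * (3 * r))); first by rewrite ler_wpM2l// ltW.
  by rewrite le_eqVlt; apply/orP; left; apply/eqP; field.
split.
  move=> [v Dv ev]; pose s := (1 - eps) * r.
  have s0 : 0 <= s by rewrite mulr_ge0 ?subr_ge0// ltW.
  have sr : s <= r by rewrite ler_piMl ?(ltW r_gt0)//; lra.
  have xe : x = row_floor (s *: v) by rewrite -(@site_rowK R d x); congr row_floor; exact: esym ev.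
  have xM : (normoo x <= M)%N.
    rewrite -(ler_nat R) -(norm_site_row R d_gt0 x).
    have -> : site_row R x = s *: v by exact: esym ev.
    rewrite normrZ ger0_norm//; apply: le_trans (ltW M2).
    have := ler_wpM2l s0 (limit_shape_bounded d_gt0 h_ge Dv); lra.
  have hs : h x <= (1 + eps / 4) * s.
    rewrite xe; apply: hD => //.
    by rewrite /s [leRHS]mulrC -ler_pdivrMr ?subr_gt0//; exact: le_trans hn1 rn1.
  have := hr0 M r0M x xM; rewrite ler_norml => /andP[_ ht].
  have : (1 + eps / 4) * s <= (1 - eps / 2) * r.
    by rewrite /s mulrA ler_wpM2r ?(ltW r_gt0)//; nra.
  lra.
move=> tr xr.
have xM : (normoo x <= M)%N by rewrite -(ler_nat R); lra.
have := hr0 M r0M x xM; rewrite ler_norml => /andP[ht _].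
have er : 0 < (1 + eps) * r by rewrite mulr_gt0// addr_gt0.
have hx : h x <= (1 + eps) * r.
  have : 0 <= eps * r by rewrite mulr_ge0// ltW.
  have -> : (1 + eps) * r = r + eps * r by ring.
  move: ht hM; have -> : eps / 2 * r = (eps * r) / 2 by field.
  lra.
exists (((1 + eps) * r)^-1 *: site_row R x); first exact: (limit_shape_scaled d_gt0 hMn C_ge0 h_lip er hx).
by rewrite scalerA mulfV ?gt_eqF// scale1r.
Qed.

End shape_event.

Lemma lattice_round d (x : site d) n : (0 < n)%N -> exists z : site d,
  (normoo (x - z *+ n) <= n)%N /\ (n * normoo z <= normoo x + n)%N.
Proof.
move=> n0; pose z : site d := \row_i (x ord0 i %/ n%:Z)%Z.
have xz : (normoo (x - z *+ n) <= n)%N.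
  apply/normoo_leP => i; rewrite -scaler_nat !mxE -[n%:R]/(n%:~R) intz.
  have /andP[] := divz_bounds (x ord0 i) n0.
  by move: (x ord0 i) => a; move: (a %/ n%:Z)%Z => b; rewrite mulrDl mul1r mulrC; lia.
exists z; split=> //; rewrite -normooMn.
have -> : z *+ n = x - (x - z *+ n) by rewrite opprB addrC subrK.
by apply: leq_trans (normooD _ _) _; rewrite normooN leq_add2l.
Qed.

(** For [n = k j] this says [r / (2 q) <= n <= r / q]: the mesh is fine compared with [r], yet a
    number of mesh points depending only on [q] and the dimension suffices for the box of radius
    [r]. *)
Lemma mesh_scale (k q j0 r : nat) : (0 < k)%N -> (0 < q)%N ->
  ((j0 + 2) * (k * q) <= r)%N ->
  exists j, [/\ (j0 <= j)%N, (0 < k * j)%N, (k * j * q <= r)%N & (r <= 2 * q * (k * j))%N].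
Proof.
move=> k0 q0 rr; have kq0 : (0 < k * q)%N by rewrite muln_gt0 k0.
have jj : (j0 + 2 <= r %/ (k * q))%N by rewrite leq_divRL.
exists (r %/ (k * q))%N; move: jj (leq_trunc_div r (k * q)) (ltn_ceil r kq0).
move: (r %/ (k * q))%N => j jj h1 h2.
have hj : (j.+1 * (k * q) <= 2 * j * (k * q))%N by rewrite leq_mul2r; lia.
split; [lia|rewrite muln_gt0 k0; lia|by rewrite mulnAC mulnC|].
apply: leq_trans (leq_trans (ltnW h2) hj) _.
lia.
Qed.

(** * The mean metric and uniform convergence to it *)

Section mean_metric.
Variables (R : realType) (d : nat) (P : probability (Omega d) R).
Hypothesis d_gt0 : (0 < d)%N.
Hypothesis Pinv : forall (z : site d) (A : set (Omega d)), measurable A ->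
  P (@shift_config d z @^-1` A) = P A.
Hypothesis Perg : forall z : site d, z != 0 -> ergodic P (@shift_config d z).
Variable tau : Omega d -> site d -> site d -> nat.
Hypothesis tau_refl : forall w x, tau w x x = 0%N.
Hypothesis tau_sym : forall w x y, tau w x y = tau w y x.
Hypothesis tau_tri : forall w x y u, (tau w x u <= tau w x y + tau w y u)%N.
Hypothesis tau_shift : forall (w : Omega d) x y u,
  tau (shift_config u w) x y = tau w (x + u) (y + u).
Hypothesis tau_meas : forall x y, discrete_meas (fun w => tau w x y).
Variable t : Omega d -> nat.
Hypothesis t_meas : discrete_meas t.
Hypothesis t_int : (Ex P (fun w => t w ^ (2 * d))%N < +oo)%E.
Hypothesis tau_loc : forall (w : Omega d) x y, (normoo (x - y) <= 1)%N ->
  (tau w x y <= t (shift_config x w))%N.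
Hypothesis tau_ge : {ae P, forall w, forall x y : site d, (normoo (x - y)%R <= tau w x y
  + t (shift_config x w) + t (shift_config y w))%N}.

Definition mean_cost : R := fine (Ex P t).
Definition mean_dist (x : site d) : R := fine (Ex P (fun w => tau w 0 x)).

Lemma mean_cost_fin : (Ex P t = mean_cost%:E).
Proof.
rewrite fineK// ge0_fin_numE ?Ex_ge0//; apply: le_lt_trans t_int.
apply: Ex_le => // [|w]; first exact: (discrete_meas_comp (fun n => n ^ (2 * d))%N).
case: (t w) => [//|n]; rewrite -[leqLHS]expn1 leq_pexp2l//; lia.
Qed.

Lemma mean_cost_ge0 : 0 <= mean_cost.
Proof. by rewrite fine_ge0// Ex_ge0. Qed.

Lemma Ex_tau_le x : (Ex P (fun w => tau w 0%R x) <= (mean_cost * (normoo x)%:R)%:E)%E.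
Proof.
case: (posnP (normoo x)) => [n0|n0].
  have /eqP -> : x == 0 by rewrite -normoo_eq0 n0.
  rewrite normoo0 mulr0 /Ex; under eq_integral do rewrite tau_refl.
  by rewrite integral0.
pose n := normoo x.
have mf (k : 'I_n) : discrete_meas (fun w : Omega d => t (shift_config (line_pt 0 x n k.+1) w)).
  exact: discrete_meas_shift.
apply: (@le_trans _ _ (Ex P (fun w : Omega d =>
    \sum_(k < n) t (shift_config (line_pt 0 x n k.+1) w))%N)).
  apply: Ex_le => [||w]; [exact: tau_meas|exact: discrete_meas_sum|].
  apply: (@tau_line d (tau w) (fun y => t (shift_config y w))) => //.
  - exact: tau_loc.
  - by rewrite subr0.
rewrite Ex_sum//.
under eq_bigr => k _ do rewrite (Ex_shift Pinv _ t_meas) mean_cost_fin.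
by rewrite sumEFin lee_fin sumr_const card_ord mulr_natr.
Qed.

Lemma mean_distE x : Ex P (fun w => tau w 0 x) = (mean_dist x)%:E.
Proof.
rewrite fineK// ge0_fin_numE ?Ex_ge0//.
exact: le_lt_trans (Ex_tau_le x) (ltry _).
Qed.

Lemma mean_dist_ge0 x : 0 <= mean_dist x.
Proof. by rewrite fine_ge0// Ex_ge0. Qed.

Lemma mean_dist_le x : mean_dist x <= mean_cost * (normoo x)%:R.
Proof. by rewrite -lee_fin -mean_distE Ex_tau_le. Qed.

Lemma mean_dist0 : mean_dist 0 = 0.
Proof. by apply/eqP; rewrite eq_le mean_dist_ge0 andbT (le_trans (mean_dist_le 0))// normoo0 mulr0. Qed.

Lemma mean_distD x y : mean_dist (x + y) <= mean_dist x + mean_dist y.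
Proof.
rewrite -lee_fin EFinD -!mean_distE -[in leRHS](Ex_shift Pinv x (tau_meas 0 y)).
rewrite -ExD; [|exact: tau_meas|exact: (discrete_meas_shift x (tau_meas 0 y))].
apply: Ex_le => [||w]; first exact: tau_meas.
  by apply: discrete_meas_comp2 (tau_meas _ _) _; exact: (discrete_meas_shift x (tau_meas 0 y)).
by rewrite tau_shift add0r addrC tau_tri.
Qed.

Lemma mean_distMn x n : mean_dist (x *+ n) <= n%:R * mean_dist x.
Proof.
elim: n => [|n IH]; first by rewrite mulr0n mean_dist0 mul0r.
rewrite mulrSr; apply: (le_trans (mean_distD _ _)).
by rewrite -natr1 mulrDl mul1r lerD2r.
Qed.

Lemma mean_dist_lip x y : mean_dist x <= mean_dist y + mean_cost * (normoo (x - y))%:R.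
Proof.
have -> : mean_dist x = mean_dist (y + (x - y)) by rewrite addrC subrK.
by apply: (le_trans (mean_distD _ _)); rewrite lerD2l mean_dist_le.
Qed.

Lemma mean_dist_ge x : (normoo x)%:R <= mean_dist x + 2 * mean_cost.
Proof.
have mx : discrete_meas (fun w : Omega d => t w + t (shift_config x w))%N.
  by apply: discrete_meas_comp2 => //; exact: discrete_meas_shift.
have hw : {ae P, forall w : Omega d, (normoo x)%:R + 0 * 0%N%:R <=
    0 + 1 * (tau w 0 x)%:R + 1 * (t w + t (shift_config x w))%N%:R :> R}.
  apply: filterS tau_ge => w /(_ 0 x).
  rewrite sub0r normooN shift_config0 mul0r add0r addr0 !mul1r -natrD ler_nat addnA.
  by [].
have := Ex_le_affine (P := P) (discrete_meas_cst 0%N) (tau_meas 0 x) mx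
  (ler0n _ _) (lexx 0) (lexx 0) ler01 ler01 hw.
rewrite mul0e adde0 add0e !mul1e mean_distE ExD//; last exact: discrete_meas_shift.
by rewrite (Ex_shift Pinv x t_meas) mean_cost_fin -!EFinD lee_fin; lra.
Qed.

(** By subadditivity this infimum is also the limit of [mean_dist (z *+ k) / k]. *)
Definition time_constant z : R := inf [set mean_dist (z *+ k.+1) / k.+1%:R | k in setT].

Lemma time_constant_lb z : has_lbound [set mean_dist (z *+ k.+1) / k.+1%:R | k in setT].
Proof. by exists 0 => _ [k _ <-]; rewrite divr_ge0// mean_dist_ge0. Qed.

Lemma time_constant_le z k : time_constant z * k%:R <= mean_dist (z *+ k).
Proof.
case: k => [|k]; first by rewrite mulr0 mulr0n mean_dist0.
by rewrite -ler_pdivlMr//; apply: ge_inf; [exact: time_constant_lb|exists k].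
Qed.

Lemma fekete z (e : R) : 0 < e ->
  exists k0, forall k, (k0 <= k)%N -> mean_dist (z *+ k) <= (time_constant z + e) * k%:R.
Proof.
move=> e0; have e20 : 0 < e / 2 by rewrite divr_gt0.
have [_ [p _ <-] hp] : exists2 x, [set mean_dist (z *+ k.+1) / k.+1%:R | k in setT] x & x < time_constant z + e / 2.
  apply: inf_adherent => //; split; last exact: time_constant_lb.
  by exists (mean_dist (z *+ 1) / 1); exists 0%N.
have mz0 : 0 <= time_constant z + e / 2.
  by apply: ltW; apply: le_lt_trans hp; rewrite divr_ge0// mean_dist_ge0.
rewrite ltr_pdivrMr// in hp.
pose C := mean_cost * (normoo z * p.+1)%:R.
have C0 : 0 <= C by rewrite mulr_ge0// mean_cost_ge0.
exists (Num.bound (C / (e / 2))) => k kk.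
have hk : C <= e / 2 * k%:R.
  rewrite mulrC -ler_pdivrMr//; apply: le_trans (_ : _ <= (Num.bound (C / (e / 2)))%:R) _.
    by apply/ltW/archi_boundP; rewrite divr_ge0// ltW.
  by rewrite ler_nat.
have ek := divn_eq k p.+1; set q := (k %/ p.+1)%N in ek *; set r := (k %% p.+1)%N in ek *.
have rp : (r < p.+1)%N by rewrite ltn_mod.
rewrite {1}ek mulrnDr mulnC mulrnA.
apply: (le_trans (mean_distD _ _)).
have h1 : mean_dist (z *+ p.+1 *+ q) <= q%:R * ((time_constant z + e / 2) * p.+1%:R).
  by apply: (le_trans (mean_distMn _ _)); rewrite ler_wpM2l// ltW.
have h2 : mean_dist (z *+ r) <= C.
  apply: (le_trans (mean_dist_le _)); rewrite ler_wpM2l ?mean_cost_ge0// ler_nat normooMn mulnC.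
  by rewrite leq_mul2l ltnW ?orbT.
have h3 : q%:R * ((time_constant z + e / 2) * p.+1%:R) <= (time_constant z + e / 2) * k%:R.
  by rewrite mulrCA ler_wpM2l// -natrM ler_nat [leqRHS]ek leq_addr.
have -> : (time_constant z + e) * k%:R = (time_constant z + e / 2) * k%:R + e / 2 * k%:R by field.
lra.
Qed.

Lemma tau_orbit_sum z j (w : Omega d) :
  (tau w 0 (z *+ j) <= orbit_sum z (fun w => tau w 0 z) w j)%N.
Proof.
elim: j w => [|j IH] w; first by rewrite mulr0n tau_refl.
rewrite orbit_sumS mulrSr; apply: leq_trans (tau_tri _ _ z _) _.
rewrite leq_add2l; apply: leq_trans (IH _).
by rewrite tau_shift add0r.
Qed.

(** The upper bound sums [tau] over blocks of [k] steps, with [k] so large that the mean per step is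
    within [e / 3] of the time constant; hence the restriction to multiples of [k]. It uses
    ergodicity of the shift by [z *+ k], the lower bound that of the shift by [z]. The mean at
    [k * j] lies between the time constant and the block mean per step, so it may replace either. *)
Lemma tau_limit z (e : R) : 0 < e -> exists k0, forall k, (k0 <= k)%N -> (0 < k)%N ->
  {ae P, forall w, exists j0, forall j, (j0 <= j)%N ->
    `|(tau w 0 (z *+ (k * j)))%:R - mean_dist (z *+ (k * j))| <= e * (k * j)%:R}.
Proof.
move=> e0; have [->|z0] := eqVneq z 0.
  exists 0%N => k _ _; apply: aeW => w; exists 0%N => j _.
  by rewrite mul0rn tau_refl mean_dist0 subrr normr0 mulr_ge0// ltW.
have e30 : 0 < e / 3 by rewrite divr_gt0.
have [k0 hk0] := fekete z e30.
exists k0 => k kk k_gt0; have hk := hk0 k kk.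
have zk0 : z *+ k != 0.
  by rewrite -normoo_eq0 normooMn muln_eq0 normoo_eq0 negb_or z0 -lt0n k_gt0.
have up := @birkhoff_upper R d P (z *+ k) Pinv (Perg zk0) (fun w => tau w 0 (z *+ k))
  (mean_dist (z *+ k) + e / 3) (tau_meas _ _) _.
have lo := @kingman_lower R d P z Pinv (Perg z0) tau tau_refl tau_sym tau_tri tau_shift
  tau_meas _ (time_constant z) (time_constant z - e / 3) _ _.
have {}up := up ltac:(by rewrite mean_distE lte_fin ltrDl).
have {}lo := lo ltac:(by rewrite mean_distE ltry) ltac:(by rewrite gtrBl)
   ltac:(by move=> L; rewrite mean_distE lee_fin time_constant_le).
apply: filterS2 up lo => w [j1 up] [j2 lo].
exists (j1 + j2)%N => j jj.
have {}up := up j ltac:(lia).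
have j2k : (j2 <= k * j)%N by nia.
have {}lo := lo (k * j)%N j2k.
have {}up : (tau w 0 (z *+ (k * j)))%:R <= (mean_dist (z *+ k) + e / 3) * j%:R.
  by apply: le_trans up; rewrite ler_nat mulrnA tau_orbit_sum.
have hh : mean_dist (z *+ (k * j)) <= j%:R * mean_dist (z *+ k) by rewrite mulrnA mean_distMn.
have hl := time_constant_le z (k * j).
have k1 : 1 <= k%:R :> R by rewrite ler1n.
have j0 : 0 <= j%:R :> R by [].
move: lo up hh hl hk; rewrite natrM; set T := (tau _ _ _)%:R; set H := mean_dist (z *+ (k * j)).
set Hk := mean_dist (z *+ k); move: (k%:R) (j%:R) k1 j0 (time_constant z) => K J k1 j0 M lo up hh hl hk.
have a1 : J * Hk <= J * ((M + e / 3) * K) by rewrite ler_wpM2l.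
have a2 : e / 3 * J <= e / 3 * (K * J).
  by rewrite ler_wpM2l ?(ltW e30)// ler_peMl.
rewrite ler_norml; apply/andP; split; lra.
Qed.


Lemma tau_limit_box q (e : R) : 0 < e -> exists k, (0 < k)%N /\
  {ae P, forall w, exists j0, forall j, (j0 <= j)%N -> forall z, z \in boxseq 0 q ->
    `|(tau w 0 (z *+ (k * j)))%:R - mean_dist (z *+ (k * j))| <= e * (k * j)%:R}.
Proof.
move=> e0.
have [k0 hk0] := @eventually_all_seq _ (boxseq (0 : site d) q) _
  (fun z _ => tau_limit z e0).
exists k0.+1; split=> //.
have := @ae_all _ _ _ P (site d) (fun z w => z \in boxseq 0 q -> exists j0,
  forall j, (j0 <= j)%N -> `|(tau w 0 (z *+ (k0.+1 * j)))%:R - mean_dist (z *+ (k0.+1 * j))|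
     <= e * (k0.+1 * j)%:R) _.
move=> H; have {}H := H _; apply: filterS (H _) => [w hw|z].
  exact: eventually_all_seq.
have [zq|zq] := boolP (z \in boxseq 0 q); last by apply: aeW.
by apply: filterS (hk0 k0.+1 (leqnSn k0) z zq (ltn0Sn k0)) => w hw _.
Qed.

(** Round [x] to a mesh point [y = z *+ n] with [n] of order [r / q]. Then [z] ranges over a fixed
    box, where the directional limits apply, and [y] is within [n] of [x]. Moving from [x] to [y]
    changes [tau] by at most [c * r * sqrt (2 / q)] and the mean by at most [mean_cost * n]; each of
    the three errors gets [e / 3]. *)
Lemma uniform_limit : {ae P, forall w, forall e : R, 0 < e -> exists r0, forall r,
  (r0 <= r)%N -> forall x, (normoo x <= r)%N -> `|(tau w 0 x)%:R - mean_dist x| <= e * r%:R}.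
Proof.
pose s w := (t w ^ (2 * d))%N.
have ms : discrete_meas s by exact: (discrete_meas_comp (fun n => n ^ (2 * d))%N).
(* The mesh parameter [q] will depend on the random [K], so the null sets are collected beforehand
   over all [q] and all precisions [1 / (m + 1)]. *)
have lim : {ae P, forall w, forall qm : nat * nat, exists k, (0 < k)%N /\
    exists j0, forall j, (j0 <= j)%N -> forall z, z \in boxseq 0 qm.1 ->
    `|(tau w 0 (z *+ (k * j)))%:R - mean_dist (z *+ (k * j))| <= qm.2.+1%:R^-1 * (k * j)%:R}.
  apply: ae_all => -[q m] /=.
  have m0 : 0 < m.+1%:R^-1 :> R by rewrite invr_gt0.
  have [k [k0 hk]] := tau_limit_box q m0.
  by apply: filterS hk => w hw; exists k.
apply: filterS2 lim (ae_box_sum Pinv ms t_int) => w lim [K hK] e e0.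
pose c : R := 6 * 30 ^+ d * (K%:R + 1).
have c0 : 0 <= c by rewrite !mulr_ge0 ?exprn_ge0 ?addr_ge0.
have e30 : 0 < e / 3 by rewrite divr_gt0.
pose q := (Num.bound (2 * (c / (e / 3)) ^+ 2) + Num.bound (mean_cost / (e / 3))).+1.
have q0 : 0 < q%:R :> R by rewrite ltr0n.
have hq1 : c * Num.sqrt (2 / q%:R) <= e / 3.
  have hq : 2 * (c / (e / 3)) ^+ 2 <= q%:R.
    apply: (@le_trans _ _ (Num.bound (2 * (c / (e / 3)) ^+ 2))%:R).
      by apply/ltW/archi_boundP; rewrite mulr_ge0// sqr_ge0.
    by rewrite ler_nat /q; lia.
  rewrite -[c]ger0_norm// -sqrtr_sqr -sqrtrM ?sqr_ge0//.
  rewrite -[leRHS]ger0_norm ?(ltW e30)// -sqrtr_sqr ler_wsqrtr//.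
  rewrite mulrA ler_pdivrMr// mulrC [leRHS]mulrC -ler_pdivrMr ?exprn_gt0//.
  by rewrite -mulrA -expr_div_n.
have hq2 : mean_cost / q%:R <= e / 3.
  rewrite ler_pdivrMr// mulrC -ler_pdivrMr//.
  apply: (@le_trans _ _ (Num.bound (mean_cost / (e / 3)))%:R).
    by apply/ltW/archi_boundP; rewrite divr_ge0 ?mean_cost_ge0// ltW.
  by rewrite ler_nat /q; lia.
pose m := Num.bound ((e / 3)^-1).
have hm : m.+1%:R^-1 <= e / 3.
  rewrite invf_ple ?posrE ?ltr0n//; apply: (@le_trans _ _ m%:R); last by rewrite ler_nat.
  by apply/ltW/archi_boundP; rewrite invr_ge0 ltW.
have [k [k0 [j0 hj]]] := lim ((2 * q).+1, m); rewrite /= in hj.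
have qn0 : (0 < q)%N by [].
exists ((j0 + 2) * (k * q))%N => r rr x xr.
have [j [jj n0 nq rn]] := mesh_scale k0 qn0 rr.
pose n := (k * j)%N; rewrite -/n in n0 nq rn.
have nr : (n <= r)%N by apply: leq_trans nq; rewrite leq_pmulr.
have [z [xz nz]] := lattice_round x n0.
have zb : z \in boxseq 0 (2 * q).+1.
  rewrite mem_boxseq sub0r normooN -(leq_pmul2l n0); apply: (leq_trans nz).
  by rewrite mulnS addnC leq_add2l mulnC; exact: leq_trans xr rn.
have {}hj := hj j jj z zb.
set y := z *+ n in xz *; rewrite -/n -/y in hj.
have yr : (normoo y <= 2 * r)%N.
  by rewrite normooMn; apply: leq_trans nz _; rewrite mul2n -addnn leq_add.
have n2r : (2 * n <= 2 * r)%N by rewrite leq_mul2l.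
have xr2 : (normoo x <= 2 * r)%N by apply: leq_trans xr _; rewrite leq_pmull.
(* Radius [2 r], since [y] may leave the box of radius [r] by up to [n <= r]. *)
have hxy := @morrey R d (tau w) (fun y => t (shift_config y w)) (tau_sym w) (tau_refl w)
  (tau_tri w) (tau_loc w) x y n (2 * r) K d_gt0 n0 n2r xr2 yr xz (hK _).
rewrite -/c in hxy.
have r0 : 0 <= r%:R :> R by [].
have nqr : n%:R <= r%:R / q%:R :> R by rewrite ler_pdivlMr// -natrM ler_nat.
have sq : Num.sqrt (2 * r)%:R * Num.sqrt n%:R <= r%:R * Num.sqrt (2 / q%:R) :> R.
  rewrite -sqrtrM//.
  rewrite -[r%:R in leRHS]ger0_norm// -sqrtr_sqr -sqrtrM ?sqr_ge0// ler_wsqrtr//.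
  rewrite natrM.
  have -> : r%:R ^+ 2 * (2 / q%:R) = 2 * r%:R * (r%:R / q%:R) :> R by ring.
  by rewrite ler_wpM2l// mulr_ge0.
have b1 : (tau w x y)%:R <= e / 3 * r%:R :> R.
  apply: (le_trans hxy); apply: le_trans (ler_wpM2l c0 sq) _.
  by rewrite mulrCA mulrC ler_wpM2r.
have b2 : mean_cost * n%:R <= e / 3 * r%:R.
  apply: (@le_trans _ _ (mean_cost / q%:R * r%:R)); last by rewrite ler_wpM2r.
  by rewrite -mulrA [_ * r%:R]mulrC ler_wpM2l ?mean_cost_ge0.
have b3 : m.+1%:R^-1 * n%:R <= e / 3 * r%:R :> R.
  by apply: ler_pM => //; rewrite ler_nat.
have hn : mean_cost * (normoo (x - y))%:R <= mean_cost * n%:R by rewrite ler_wpM2l ?mean_cost_ge0// ler_nat.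
have l1 := mean_dist_lip x y; have l2 := mean_dist_lip y x; rewrite normooB in l2.
have t1 : (tau w 0 x)%:R <= (tau w 0 y)%:R + (tau w x y)%:R :> R.
  by rewrite -natrD ler_nat (tau_sym w x y) tau_tri.
have t2 : (tau w 0 y)%:R <= (tau w 0 x)%:R + (tau w x y)%:R :> R.
  by rewrite -natrD ler_nat tau_tri.
move: hj; rewrite ler_norml => /andP[hj1 hj2].
have -> : e * r%:R = e / 3 * r%:R + e / 3 * r%:R + e / 3 * r%:R by field.
move: hj1 hj2 b1 b2 b3 hn l1 l2 t1 t2.
move: (e / 3 * r%:R) (m.+1%:R^-1 * n%:R) (mean_cost * n%:R) (mean_cost * _) (mean_dist x) (mean_dist y) (tau w 0 x)%:R (tau w 0 y)%:R (tau w x y)%:R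
  => A1 A2 A3 A4 A5 A6 A7 A8 A9.
rewrite ler_norml; lra.
Qed.

Lemma pseudometric_shape_theorem : exists D : set 'rV[R]_d, [/\ convex_set D, compact D
  & forall eps : R, 0 < eps < 1 ->
    {ae P, forall w, exists n, shape_from D eps (tau w 0) n}].
Proof.
exists (limit_shape mean_dist); split.
- exact: (limit_shape_convex d_gt0 mean_distD mean_cost_ge0 mean_dist_lip).
- exact: (limit_shape_compact d_gt0 mean_cost_ge0 mean_dist_lip mean_dist_ge).
move=> eps eps01; apply: filterS uniform_limit => w.
exact: (shape_from_uniform d_gt0 mean_distMn mean_cost_ge0 mean_dist_lip mean_dist_ge eps01).
Qed.

End mean_metric.

(** * From the pseudometric back to the infinite cluster *)

Section infinite_cluster_distance.
Variables (R : realType) (d : nat).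

Lemma anchor_id (xi : config d) x : S_oo xi x -> anchor xi x = x.
Proof.
move=> Sx; rewrite /anchor nearest0; first by rewrite addr0.
by apply/S_oo_shift; rewrite add0r.
Qed.

Lemma graph_ball_chem (xi : config d) x y (r : R) : reach xi x y ->
  graph_ball xi x r y <-> (chem xi x y)%:R <= r.
Proof.
move=> xy; have [[p hp sp] hmin] := chemP xy; split=> [[_ gr]|cr].
  rewrite -lee_fin; apply: le_trans gr; apply: le_ereal_inf_tmp.
  by move=> _ [q hq <-]; rewrite lee_fin ler_nat; exact: hmin.
split; first exact: connected_in_r xy.
apply: (@le_trans _ _ ((size p)%:R)%:E); first by apply: ereal_inf_lbound; exists p.
by rewrite lee_fin sp.
Qed.

(** Without a path the infimum is over the empty set, hence infinite, and exceeds every real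
    radius. *)
Lemma graph_ball_reach (xi : config d) x y (r : R) :
  graph_ball xi x r y -> reach xi x y.
Proof.
move=> [_ gr]; apply: contrapT => nxy; move: gr.
rewrite /graph_dist (_ : [set _ | _ in _] = set0) ?ereal_inf0//.
by apply/seteqP; split=> // z [p hp _]; apply: nxy; exists p.
Qed.

End infinite_cluster_distance.


(** The radius is the least [n] with [Q n w], and infinite where there is none; it has countably
    many values, hence is measurable. *)
Lemma random_radius (disp : measure_display) (T : measurableType disp) (R : realType)
    (P : probability T R) (Q : nat -> T -> Prop) :
  (forall n, measurable [set w | Q n w]) ->
  exists Rt : {RV P >-> \bar R},
    (forall w, Rt w \is a fin_num <-> exists n, Q n w) /\
    forall w (r : R), (Rt w <= r%:E)%E -> exists n, Q n w /\ n%:R <= r.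
Proof.
move=> mQ.
pose m (w : T) := xget 0%N [set n | Q n w /\ forall k, Q k w -> (n <= k)%N].
have mm : discrete_meas m.
  apply: discrete_meas_xget => [n|w n k [Qn hn] [Qk hk]].
    apply: meas_and => //; apply: meas_all => k.
    by apply: meas_imp => //; exact: meas_const.
  by apply/eqP; rewrite eqn_leq hn// hk.
have mex : measurable [set w | exists n, Q n w] by exact: meas_ex.
pose f (w : T) : \bar R := if `[< exists n, Q n w >] then ((m w)%:R)%:E else +oo%E.
have mf : measurable_fun setT f.
  exact: (measurable_fun_discrete (fun bm : bool * nat => if bm.1 then (bm.2%:R : R)%:E else +oo%E)
    (discrete_meas_pair (discrete_meas_asbool mex) mm)).
pose Rt : {RV P >-> \bar R} := HB.pack f (isMeasurableFun.Build _ _ _ _ f mf).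
have mP w : (exists n, Q n w) -> Q (m w) w.
  move=> /min_natP[n hn].
  by have [] := @xgetPex _ 0%N [set n | Q n w /\ forall k, Q k w -> (n <= k)%N] (ex_intro _ n hn).
exists Rt; split=> w.
  by rewrite /Rt /= /f; case: asboolP => h; split.
move=> r; rewrite /Rt /= /f; case: asboolP => [h|_].
  by rewrite lee_fin => mr; exists (m w); split=> //; exact: mP.
by rewrite leye_eq.
Qed.

Lemma ae_imp (disp : measure_display) (T : measurableType disp) (R : realType)
    (P : probability T R) (Q Q' : T -> Prop) :
  (forall w, Q w -> Q' w) -> {ae P, forall w, Q w} -> {ae P, forall w, Q' w}.
Proof. by move=> QQ'; apply: filterS. Qed.

Lemma ae_imp2 (disp : measure_display) (T : measurableType disp) (R : realType)
    (P : probability T R) (Q1 Q2 Q' : T -> Prop) :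
  (forall w, Q1 w -> Q2 w -> Q' w) -> {ae P, forall w, Q1 w} ->
  {ae P, forall w, Q2 w} -> {ae P, forall w, Q' w}.
Proof. by move=> QQ'; apply: filterS2. Qed.

Lemma ae_tau_ge (R : realType) (d : nat) (P : probability (Omega d) R) :
  (0 < d)%N -> {ae P, forall w : Omega d, @regular R d w} ->
  {ae P, forall (w : Omega d) (x y : site d), (normoo (x - y)%R <= @tau R d w x y
    + @local_cost R d (shift_config x w) + @local_cost R d (shift_config y w))%N}.
Proof. by move=> d_gt0 areg; apply: ae_imp areg => w rw x y; exact: tau_ge. Qed.

Lemma shape_random_radius (R : realType) (d : nat) (P : probability (Omega d) R)
    (D : set 'rV[R]_d) (eps : R) :
  {ae P, forall w : Omega d, @regular R d w} ->
  {ae P, forall w : Omega d, exists n, shape_from D eps (@tau R d w 0) n} ->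
  0 < fine (P [set xi | S_oo xi 0]) ->
  exists Rt : {RV P >-> \bar R},
    cond_prob P [set xi | Rt xi \is a fin_num] [set xi | S_oo xi 0] = 1 /\
    forall xi : Omega d, S_oo xi 0 ->
    forall r : R, (Rt xi <= r%:E)%E ->
      S_oo xi `&` lattice_dilate ((1 - eps) * r) D `<=` graph_ball xi 0 r /\
      graph_ball xi 0 r `<=` S_oo xi `&` lattice_dilate ((1 + eps) * r) D.
Proof.
move=> aereg aesh eta0.
(* Regularity is part of [Q], so the inclusions hold at every configuration with 0 in the infinite
   cluster and finite radius; elsewhere no real [r] is above [Rt]. *)
pose Q n (w : Omega d) := @regular R d w /\ shape_from D eps (@tau R d w 0) n.
have mQ n : measurable [set w | Q n w].
  apply: meas_and; first exact: meas_regular.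
  apply: meas_all => x.
  (* For fixed [x] the condition depends on the configuration only through one natural number, so
     the uncountable quantifier over [r] is harmless. *)
  exact: (meas_discrete (fun k => forall r : R, n%:R <= r ->
    (lattice_dilate ((1 - eps) * r) D x -> k%:R <= r) /\
    (k%:R <= r -> (normoo x)%:R <= r -> lattice_dilate ((1 + eps) * r) D x))
    (@discrete_meas_tau d R 0 x)).
have aeQ : {ae P, forall w : Omega d, exists n, Q n w}.
  by apply: ae_imp2 aereg aesh => w rw [n hn]; exists n.
have [Rt [Rtfin Rtle]] := random_radius P mQ.
exists Rt; split.
  have mB := @meas_S_oo d 0; set B := [set xi | S_oo xi 0] in eta0 mB *.
  have mF : measurable [set w | Rt w \is a fin_num].
    by apply: meas_ext (meas_ex mQ) => w; split=> /Rtfin.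
  have F0 : P (~` [set w | Rt w \is a fin_num]) = 0%E.
    apply: (iffLR (ae_prob0 P mF)).
    by apply: ae_imp aeQ => w /Rtfin.
  set F := [set w | _] in mF F0 *.
  have PFB : P (F `&` B) = P B.
    apply/eqP; rewrite eq_le; apply/andP; split.
      apply: le_measure; rewrite ?inE; [exact: measurableI|exact: mB|exact: subIsetr].
    apply: (@le_trans _ _ (P ((F `&` B) `|` ~` F))%E).
      apply: le_measure; rewrite ?inE; [exact: mB| |].
        by apply: measurableU; [exact: measurableI|exact: measurableC].
      by move=> w Bw; have [Fw|nFw] := pselect (F w); [left|right].
    rewrite -[leRHS]adde0 -F0; apply: measureU2; first exact: measurableI.
    exact: measurableC.
  by rewrite /cond_prob PFB divff// gt_eqF.
move=> xi S0 r /Rtle[n [[rxi hsh] nr]].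
have tauE x : S_oo xi x -> tau R xi 0 x = chem xi 0 x.
  by move=> Sx; rewrite (tau_regular _ _ rxi) !anchor_id.
split=> x.
  move=> [Sx Dx]; apply/(graph_ball_chem _ (regular_reach rxi S0 Sx)).
  by rewrite -tauE//; exact: (hsh x r nr).1.
move=> gx; have rx := graph_ball_reach gx; have Sx := S_oo_reach rx S0.
have cx := (graph_ball_chem r rx).1 gx.
split=> //; apply: (hsh x r nr).2; first by rewrite tauE.
apply: le_trans cx; rewrite ler_nat.
have [[p hp <-] _] := chemP rx.
have := path_in_norm hp; rewrite sub0r norm1N; apply: leq_trans.
exact: normoo_norm1.
Qed.

Theorem theorem1p5 (R : realType) (d : nat) (a b : R)
    (P : R -> probability (Omega d) R) :
  (2 <= d)%N -> 0 <= a -> a < b ->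
  condP1 a b P -> condP2 a b P -> condP3 a b P ->
  condS1 a b P -> condS2 a b P ->
  forall u : R, a < u < b ->
  exists D : set 'rV[R]_d,
    [/\ convex_set D, compact D
      & forall eps : R, 0 < eps < 1 ->
        exists Rt : {RV (P u) >-> \bar R},
          cond_prob (P u) [set xi | Rt xi \is a fin_num]
            [set xi | S_oo xi 0] = 1 /\
          forall xi : Omega d, S_oo xi 0 ->
          forall r : R, (Rt xi <= r%:E)%E ->
            S_oo xi `&` lattice_dilate ((1 - eps) * r) D
              `<=` graph_ball xi 0 r /\
            graph_ball xi 0 r
              `<=` S_oo xi `&` lattice_dilate ((1 + eps) * r) D].
Proof.
move=> d2 _ _ hP1 _ _ [fS [hfS hS1]] [hS2 _] u uab.
have d_gt0 : (0 < d)%N by exact: ltnW.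
have [Pinv Perg] := hP1 u uab.
have [Delta [RS [Delta0 hf]]] := hfS u uab.
have eta0 := hS2 u uab.
have hcross n : (1 <= n)%N -> ((1 - expR (- fS u n))%:E <= P u (@crossing_event R d n))%E.
  by move=> n1; have [] := hS1 u n uab n1.
have huniq n : (1 <= n)%N -> ((1 - expR (- fS u n))%:E <= P u (@uniqueness_event R d n))%E.
  by move=> n1; have [] := hS1 u n uab n1.
have aereg := ae_regular Delta0 hf hcross huniq Pinv.
(* The moment of order [2 d] is what the maximal inequality for the power sums in the Morrey
   estimate requires. *)
have tint := Ex_local_cost_pow Delta0 hf hcross huniq (2 * d).
have [D [cD kD hD]] := @pseudometric_shape_theorem R d (P u) d_gt0 Pinv Perg (@tau R d) (@tau_refl R d)
  (@tau_sym R d) (@tau_tri R d) (@tau_shift R d) (@discrete_meas_tau d R) (@local_cost R d)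
  (@discrete_meas_local_cost d R) tint (@tau_loc R d) (ae_tau_ge d_gt0 aereg).
exists D; split=> // eps eps01.
exact: shape_random_radius aereg (hD eps eps01) eta0.
Qed.
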